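(* Let $\Phi$ be a root system of type $A_\ell$, $B_\ell$ or $C_\ell$ with positive system $\Phi^+$ and simple roots $\Delta$, and let $m\in\mathbb{Z}_{>0}$. Then the cone $\mathbf{c}\mathrm{Cat}^m(\Phi)$ over the extended Catalan arrangement is flag-accurate with a simple root witness.
   Context: Let $V=\mathbb{R}^\ell\subseteq V'=\mathbb{R}^{\ell+1}$, $\Phi\subseteq V^*$ a root system of rank $\ell$ with positive roots $\Phi^+$ and simple roots $\Delta$; $z$ is the $(\ell+1)$-st coordinate on $V'$. For $\alpha\in\Phi$, $j\in\mathbb{Z}$ let $H_\alpha^j=\ker(\alpha-j)\subseteq V$ and $\mathbf{c}H_\alpha^j=\ker(\alpha-jz)\subseteq V'$. The extended Catalan arrangement is $\mathrm{Cat}^m=\{H_\alpha^j:\alpha\in\Phi^+, -m\le j\le m\}$ and its cone is $\mathbf{c}\mathrm{Cat}^m=\{\mathbf{c}H_\alpha^j:\alpha\in\Phi^+,-m\le j\le m\}\cup\{\ker z\}$. For a central arrangement $\mathcal{A}$ in $W=\mathbb{K}^n$: $L(\mathcal{A})$ is the set of intersections of subsets of $\mathcal{A}$; $\mathcal{A}^X=\{H\cap X:H\in\mathcal{A},X\not\subseteq H\}$; $\mathcal{A}$ is free if $D(\mathcal{A})=\{\theta\in\mathrm{Der}(S):\theta(\alpha_H)\in\alpha_HS\ \forall H\}$ is free over $S=\mathbb{K}[x_1,\dots,x_n]$, exponents being the degrees of a homogeneous basis. If $\mathcal{A}$ is free with exponents $e_1\le\dots\le e_n$, a witness for flag-accuracy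 is a flag $Y_1\subseteq\dots\subseteq Y_n=W$ in $L(\mathcal{A})$ with $\dim Y_d=d$ and $\mathcal{A}^{Y_d}$ free with exponents $(e_1,\dots,e_d)$; $\mathcal{A}$ is flag-accurate if one exists. A witness for the flag-accuracy of $\mathbf{c}\mathrm{Cat}^m$ (in $V'$) is a simple root witness if there are $\alpha_1,\dots,\alpha_{\ell-1}\in\Delta$ and integers $j_1,\dots,j_{\ell-1}$ such that its flat of codimension $s$ in $V'$ is $\bigcap_{i=1}^s\mathbf{c}H_{\alpha_i}^{j_i}$ for $1\le s\le\ell-1$. *)

(* Defs.v *)
From mathcomp Require Import all_boot all_order all_algebra.
From mathcomp Require Import finmap mpoly.
From mathcomp Require Import reals.

Set Implicit Arguments.
Unset Strict Implicit.
Unset Printing Implicit Defensive.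

Import Order.TTheory GRing.Theory Num.Theory.

Local Open Scope fset_scope.
Local Open Scope ring_scope.

(* Vectors of K^n are columns and linear forms on K^n are rows of coefficients,
   so that the value of the form a at v is the 1 x 1 matrix a *m v.            *)

Section Arrangements.
Variables (K : fieldType) (n : nat).
Implicit Types (A : {fset {vspace 'cV[K]_n}}) (X : {vspace 'cV[K]_n}).

Definition ker_form (a : 'rV[K]_n) : {vspace 'cV[K]_n} :=
  lker (linfun (mulmx a : 'cV[K]_n -> 'M[K]_1)).

Definition poly_form (a : 'rV[K]_n) : {mpoly K[n]} :=
  \sum_(i < n) a 0 i *: 'X_i.

Definition derivation (theta : {linear {mpoly K[n]} -> {mpoly K[n]}}) : Prop :=
  forall p q, theta (p * q) = theta p * q + p * theta q.

(* The form alpha_H is unique up to a nonzero scalar, so nothing depends on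
   its choice and we quantify over all of them.                               *)
Definition in_D A (theta : {linear {mpoly K[n]} -> {mpoly K[n]}}) : Prop :=
  derivation theta /\
  forall H a, H \in A -> H = ker_form a ->
    exists q, theta (poly_form a) = poly_form a * q.

Definition D_basis A k
    (theta : 'I_k -> {linear {mpoly K[n]} -> {mpoly K[n]}}) : Prop :=
  (forall i, in_D A (theta i)) /\
  forall eta, in_D A eta ->
    exists! c : {ffun 'I_k -> {mpoly K[n]}},
      forall p, eta p = \sum_(i < k) c i * theta i p.

(* Polynomial degree: sum_i f_i d/dx_i has degree d when every f_i does.      *)
Definition der_homog (d : nat)
    (theta : {linear {mpoly K[n]} -> {mpoly K[n]}}) : Prop :=
  forall i : 'I_n, theta 'X_i \is d.-homog.

Definition free_with_exponents A (e : seq nat) : Prop :=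
  exists theta : 'I_(size e) -> {linear {mpoly K[n]} -> {mpoly K[n]}},
    D_basis A theta /\ forall i : 'I_(size e), der_homog (nth 0%N e i) (theta i).

Definition flat A X : Prop :=
  exists2 B : {fset {vspace 'cV[K]_n}},
    B `<=` A & X = (\bigcap_(H <- B) H)%VS.

Definition restriction A X : {fset {vspace 'cV[K]_n}} :=
  [fset (H :&: X)%VS | H in A & ~~ (X <= H)%VS].

Definition param X : 'Hom('cV[K]_(\dim X), 'cV[K]_n) :=
  linfun (fun c : 'cV[K]_(\dim X) =>
    \sum_(i < \dim X) c i 0 *: (vbasis X)`_i).

End Arrangements.

(* An arrangement B of hyperplanes of the subspace X, in the linear coordinates
   on X given by a basis; freeness does not depend on the basis.              *)
Definition in_coordinates (K : fieldType) n (X : {vspace 'cV[K]_n})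
    (B : {fset {vspace 'cV[K]_n}}) : {fset {vspace 'cV[K]_(\dim X)}} :=
  [fset (param X @^-1: H)%VS | H in B].

(* Only the values Y d with 1 <= d <= n matter. *)
Definition flag_accuracy_witness (K : fieldType) n
    (A : {fset {vspace 'cV[K]_n}}) (Y : nat -> {vspace 'cV[K]_n}) : Prop :=
  exists e : seq nat,
    [/\ sorted leq e, free_with_exponents A e, Y n = fullv,
        forall d, (0 < d < n)%N -> (Y d <= Y d.+1)%VS &
        forall d, (0 < d <= n)%N ->
          [/\ flat A (Y d), \dim (Y d) = d &
              free_with_exponents
                (in_coordinates (Y d) (restriction A (Y d))) (take d e)]].

Section RootSystems.
Variables (R : realType) (l : nat).
Implicit Types (Phi Phip Delta : {fset 'rV[R]_l}).

Definition pairing (a : 'rV[R]_l) (v : 'cV[R]_l) : R := (a *m v) 0 0.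

(* Reduced crystallographic root systems in V^*, with coroots in V, so that no
   inner product has to be fixed. The coroot of a root is unique, because Phi
   is finite and spans V^*.                                                   *)
Definition is_coroot Phi (a : 'rV[R]_l) (v : 'cV[R]_l) : Prop :=
  pairing a v = 2 /\
  forall b, b \in Phi ->
    b - pairing b v *: a \in Phi /\ exists k : int, pairing b v = k%:~R.

Definition root_system Phi : Prop :=
  [/\ 0 \notin Phi,
      <<(Phi : seq 'rV[R]_l)>>%VS = fullv,
      forall a, a \in Phi -> exists v, is_coroot Phi a v &
      forall a (c : R), a \in Phi -> c *: a \in Phi -> c = 1 \/ c = -1].

Definition positive_system Phi Phip : Prop :=
  exists2 v : 'cV[R]_l,
    forall a, a \in Phi -> pairing a v != 0 &
    Phip = [fset a in Phi | 0 < pairing a v].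

Definition simple_system Phip Delta : Prop :=
  [/\ Delta `<=` Phip,
      basis_of fullv (Delta : seq 'rV[R]_l) &
      forall b, b \in Phip -> exists c : 'rV[R]_l -> nat,
        b = \sum_(a <- Delta) a *+ c a].

Inductive root_type := TypeA | TypeB | TypeC.

(* The entry at (i, j) is <alpha_i, alpha_j^vee>. Indices start at 0, the last
   simple root being the short one for B and the long one for C. All three
   matrices are (2) when l = 1.                                               *)
Definition cartan (T : root_type) (i j : 'I_l) : int :=
  if i == j then 2
  else if (i.+1 == j) && (j.+1 == l) then (if T is TypeB then -2 else -1)
  else if (j.+1 == i) && (i.+1 == l) then (if T is TypeC then -2 else -1)
  else if (i.+1 == j) || (j.+1 == i) then -1
  else 0.

Definition has_type (T : root_type) Phi Delta : Prop :=
  exists a : 'I_l -> 'rV[R]_l,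
    [/\ injective a, Delta = [fset a i | i in 'I_l] &
        forall j, exists2 v, is_coroot Phi (a j) v &
          forall i, pairing (a i) v = (cartan T i j)%:~R].

(* V' = R^(l + 1), its last coordinate being z. *)
Definition cH (a : 'rV[R]_l) (j : int) : {vspace 'cV[R]_(l + 1)} :=
  ker_form (row_mx a (- j%:~R)%:M).

Definition ker_z : {vspace 'cV[R]_(l + 1)} := ker_form (row_mx 0 1%:M).

Definition cCat (m : nat) Phip : {fset {vspace 'cV[R]_(l + 1)}} :=
  ker_z |` [fset cH a (k%:Z - m%:Z) | a in Phip, k in iota 0 (2 * m).+1].

(* The flat of codimension s is Y (l + 1 - s). *)
Definition simple_root_flag Delta
    (Y : nat -> {vspace 'cV[R]_(l + 1)}) : Prop :=
  exists (a : 'I_(l.-1) -> 'rV[R]_l) (j : 'I_(l.-1) -> int),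
    (forall i, a i \in Delta) /\
    forall s, (1 <= s <= l.-1)%N ->
      Y (l + 1 - s)%N = (\bigcap_(i < l.-1 | (i < s)%N) cH (a i) (j i))%VS.

End RootSystems.

(* Main.v *)
(* By Saito's criterion it is enough to exhibit homogeneous derivations that
   preserve the hyperplanes, are independent at one point, and whose degrees add
   up to the number of hyperplanes. In coordinates [x_0, ..., x_(l-1)] the roots
   are [x_i - x_j], [x_i] (type A), and also [x_i + x_j] with [x_i] (type B) or
   [2 x_i] (type C). Besides the Euler field we take the fields with coordinates
   [F(x_i) - F(0)] (type A) or [F(x_i) - F(-x_i)] (types B, C), where [F] solves
   the difference equation [F(t + z) - F(t) = z W(t) tau(t)^r], [tau] is [t] or
   [(t + z/2)^2], and [W] has enough zeros to make [F] agree at [y] and [y']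
   when [y - y' = c z] with [|c| <= m], for the points [y, y'] among [0, x_i, -x_i]
   whose difference is a root:
   [W(t) = \prod_(u < m) Q(t - u z)] with [Q = t \prod_i (t - x_i)] (type A) or
   [Q = \prod_i (t^2 - x_i^2)] (type C), and for type B an [m]-fold divided
   difference built on [Q = t \prod_i (t^2 - x_i^2)]. As for orthogonal
   polynomials, independence at a point with widely spaced coordinates follows
   from the constant sign of [W] between consecutive [x_i]: a linear relation
   gives a polynomial of degree [< k] with [k] sign changes. The flag fixes the
   simple roots one after the other, from the last one, to the value [m z]; the
   first fields of the basis restrict to a basis on every flat of the flag. *)

From HB Require Import structures.
Require Import Defs.
From mathcomp Require Import all_boot all_order all_fingroup all_algebra.
From mathcomp Require Import finmap mpoly.
From mathcomp Require Import reals.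
From mathcomp Require Import ring lra zify.

Set Implicit Arguments.
Unset Strict Implicit.
Unset Printing Implicit Defensive.

Import Order.TTheory GRing.Theory Num.Theory.

Local Open Scope ring_scope.

(** * Multivariate polynomials as functions *)

(** The degrees leave no slack. Together with the Euler field they must add up to the number of
    hyperplanes, which forces the values $mh+e$, with $h$ the Coxeter number ($l+1$ or $2l$) and $e$
    the exponents of $\Phi$; so [W] may only have degree $mh$. In types A and C the polynomial $Q$
    has degree $h$, and a product of [m] of its shifts fits. In type B the $x_i$ are roots, so the
    point $0$ has to be included and $Q$ has degree $h+1$. On the other hand $x_i$ and $-x_i$ need
    not be linked, as $2x_i$ is not a root; the divided difference gives up this link and in return
    loses one degree per factor. The value $mz$ for the simple roots puts the fixed coordinates of a
    flat at distance $mz$ from each other. The hyperplanes $x_i=gz$ coming from different roots then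
    coincide as often as possible without leaving gaps, and their number is what the first exponents
    require. For independence the spacing is $m+1$ at $z=1$: a gap has $m+1$ sample points, and the
    shifts used by [W] either stay where $Q$ keeps its sign or meet a root of $Q$. *)

Lemma mpoly_ring_ind (A : comNzRingType) n (P : {mpoly A[n]} -> Prop) :
  (forall c, P c%:MP) -> (forall i, P 'X_i) ->
  (forall p q, P p -> P q -> P (p + q)) ->
  (forall p q, P p -> P q -> P (p * q)) -> forall p, P p.
Proof.
move=> PC PX PD PM; elim/mpolyind => [|c m p _ _ Pp].
  by rewrite -mpolyC0.
apply: (PD) => //; rewrite -mul_mpolyC; apply: (PM) => //.
rewrite mpolyXE_id; elim/big_ind: _ => // [|i _]; first by rewrite -mpolyC1.
by elim: (m i) => [|k IH]; rewrite ?expr0 -?mpolyC1 // exprS; apply: PM.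
Qed.

Lemma mderiv_var (A : comNzRingType) n (i j : 'I_n) :
  ('X_j : {mpoly A[n]})^`M(i) = (i == j)%:R.
Proof.
rewrite mderivX mnm1E eq_sym; have [->|_] := eqVneq i j; last by rewrite scale0r.
rewrite scale1r (_ : (U_(j) - U_(j))%MM = 0%MM) ?mpolyX0 //.
by apply/mnmP => k; rewrite mnmBE subnn mnm0E.
Qed.

Lemma mnm_neq0 n (m : 'X_{1..n}) : m != 0%MM -> exists i, m i != 0%N.
Proof.
move=> m0; apply/existsP; rewrite -negb_forall; apply: contra m0 => /forallP h.
by apply/eqP/mnmP => i; rewrite mnm0E; apply/eqP.
Qed.

Section Derivations.
Variables (A : comNzRingType) (n : nat) (B : comNzRingType).
Variables (phi : {rmorphism {mpoly A[n]} -> B}).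

(** Derivations along [phi] serve twice: with the identity they expand a derivation in partial
    derivatives, with restriction to a line they give the chain rule. *)
Lemma derivation_expand (D : {mpoly A[n]} -> B) :
  {morph D : p q / p + q} -> (forall c, D c%:MP = 0) ->
  (forall p q, D (p * q) = D p * phi q + phi p * D q) ->
  forall p, D p = \sum_(i < n) phi p^`M(i) * D 'X_i.
Proof.
move=> DD DC DM; elim/mpoly_ring_ind => [c|j|p q Dp Dq|p q Dp Dq].
- by rewrite DC big1 // => i _; rewrite mderivC raddf0 mul0r.
- rewrite (bigD1 j) //= mderiv_var eqxx rmorph1 mul1r big1 ?addr0 // => i nij.
  by rewrite mderiv_var (negPf nij) rmorph0 mul0r.
- rewrite DD Dp Dq -big_split /=; apply: eq_bigr => i _.
  by rewrite mderivD rmorphD mulrDl.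
- rewrite DM Dp Dq mulr_suml mulr_sumr -big_split /=; apply: eq_bigr => i _.
  by rewrite mderivM rmorphD !rmorphM /=; ring.
Qed.

End Derivations.

Section Lines.
Variables (K : comNzRingType) (n : nat).

Definition line_poly (p : {mpoly K[n]}) (v w : 'I_n -> K) : {poly K} :=
  mmap polyC (fun i => (v i)%:P + w i *: 'X) p.

Lemma horner_line_poly p v w e :
  (line_poly p v w).[e] = p.@[fun i => v i + e * w i].
Proof.
rewrite /line_poly; elim/mpoly_ring_ind: p => [c|j|p q IHp IHq|p q IHp IHq].
- by rewrite mmapC hornerC mevalC.
- by rewrite mmapX mmap1U mevalXU !hornerE mulrC.
- by rewrite mmapD hornerD IHp IHq mevalD.
- by rewrite rmorphM hornerM IHp IHq mevalM.
Qed.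

Lemma deriv_line_poly p v w :
  (line_poly p v w)^`() = \sum_(i < n) line_poly p^`M(i) v w * (w i)%:P.
Proof.
pose phi : {rmorphism {mpoly K[n]} -> {poly K}} :=
  mmap polyC (fun i => (v i)%:P + w i *: 'X).
rewrite (@derivation_expand _ _ _ phi (fun p => (line_poly p v w)^`())).
- apply: eq_bigr => i _; congr (_ * _).
  by rewrite /line_poly mmapX mmap1U derivD derivC derivZ derivX add0r alg_polyC.
- by move=> p1 q1; rewrite /line_poly mmapD derivD.
- by move=> c; rewrite /line_poly mmapC derivC.
- by move=> p1 q1; rewrite /line_poly rmorphM derivM.
Qed.

End Lines.

Section Vanishing.
Variables (K : numFieldType).

(** The finite exceptional set [s] is for identities that are known only where some factor is
    nonzero. *)
Lemma poly_infinite_roots (q : {poly K}) (s : seq K) :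
  (forall x, x \notin s -> q.[x] = 0) -> q = 0.
Proof.
move=> q0; apply/eqP/negPn/negP => nz.
pose t := [seq x <- [seq i%:R : K | i <- iota 0 (size s + size q)] | x \notin s].
have us : uniq [seq i%:R : K | i <- iota 0 (size s + size q)].
  by rewrite map_inj_uniq ?iota_uniq // => i j /eqP; rewrite eqr_nat => /eqP.
have ut : uniq t by apply: filter_uniq.
have rt : all (root q) t.
  by apply/allP => x; rewrite mem_filter => /andP[/q0/eqP].
have := max_poly_roots nz rt ut; apply/negP; rewrite -leqNgt.
set r := [seq i%:R : K | i <- iota 0 (size s + size q)] in t us ut rt *.
have e : (count (mem s) r + size t = size s + size q)%N.
  by rewrite size_filter count_predC size_map size_iota.
have : (count (mem s) r <= size s)%N.
  rewrite -size_filter; apply: uniq_leq_size; first exact: filter_uniq.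
  by move=> x; rewrite mem_filter => /andP[].
by move=> le; rewrite -(leq_add2l (count (mem s) r)) e leq_add2r.
Qed.

(** In characteristic $0$ a nonconstant coefficient is, up to a nonzero integer factor, a
    coefficient of a partial derivative, of degree one less. That derivative is again zero
    everywhere, because it is the derivative of a restriction to a line. *)
Lemma mpoly_zero n (p : {mpoly K[n]}) : (forall v, p.@[v] = 0) -> p = 0.
Proof.
move=> p0; apply/mpolyP => m; rewrite mcoeff0.
move: {2}(mdeg m) (leqnn (mdeg m)) => k.
elim: k p m p0 => [|k IH] p m p0 hm; have [/eqP m0|] := boolP (mdeg m == 0%N).
- have -> : m = 0%MM by apply/eqP; rewrite -mdeg_eq0 m0.
  rewrite -(p0 (fun=> 0)) mevalE.
  have vanish (m' : 'X_{1..n}) : m' != 0%MM ->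
      p@_m' * \prod_(i < n) (0 : K) ^+ m' i = 0.
    by move=> /mnm_neq0[i hi]; rewrite (bigD1 i) //= expr0n (negPf hi) mul0r mulr0.
  have [h0|h0] := boolP (0%MM \in msupp p); last first.
    rewrite (memN_msupp_eq0 h0) big1_seq // => m' /andP[_ hm'].
    by apply: vanish; apply: contraNneq h0 => <-.
  rewrite (bigD1_seq 0%MM) ?msupp_uniq //= big1 ?mulr1; last first.
    by move=> i _; rewrite mnm0E expr0.
  by rewrite big1 ?addr0.
- by move: hm; rewrite leqn0 => ->.
- by apply: IH => //; rewrite m0.
rewrite mdeg_eq0 => /mnm_neq0[i hi].
have e : (m - U_(i) + U_(i))%MM = m.
  by rewrite submK // lep1mP.
have dp : (p^`M(i))@_(m - U_(i)) = 0.
  apply: IH; last first.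
    by rewrite -ltnS (leq_trans _ hm) // -{2}e mdegD mdeg1 addn1.
  move=> v; have l0 : line_poly p v (fun j => (i == j)%:R) = 0.
    by apply: (@poly_infinite_roots _ [::]) => x _; rewrite horner_line_poly p0.
  have := deriv_line_poly p v (fun j => (i == j)%:R).
  rewrite l0 deriv0 (bigD1 i) //= eqxx mulr1 big1 ?addr0; last first.
    by move=> j nj; rewrite eq_sym (negPf nj) mulr0.
  move=> /(congr1 (horner^~ 0)); rewrite horner0 horner_line_poly => ->.
  by apply: meval_eq => j; rewrite mul0r addr0.
move: dp; rewrite mcoeff_mderiv e => /eqP; rewrite mulrn_eq0 /= => /eqP //.
Qed.

End Vanishing.

(** * Homogeneous polynomial functions *)

Section HomogeneousFunctions.
Variables (K : fieldType).

(** Homogeneity is a property of functions, so that a field known only through its values, such as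
    one built from antidifferences, needs no explicit polynomial. *)
Definition homog_fun n (d : nat) (f : 'cV[K]_n -> K) : Prop :=
  exists2 p : {mpoly K[n]}, p \is d.-homog & forall v, f v = p.@[fun i => v i 0].

Variable n : nat.
Implicit Types (f g : 'cV[K]_n -> K).

Lemma homog_fun_ext d f g : f =1 g -> homog_fun d f -> homog_fun d g.
Proof. by move=> e [p hp fp]; exists p => // v; rewrite -e. Qed.

Lemma homog_fun0 d : homog_fun d (fun _ : 'cV[K]_n => 0).
Proof. by exists 0 => [|v]; rewrite ?meval0 // dhomog0. Qed.

Lemma homog_funC c : homog_fun 0 (fun _ : 'cV[K]_n => c).
Proof.
exists c%:MP => [|v]; last by rewrite mevalC.
by rewrite -[_%:MP]mulr1 mul_mpolyC; apply: dhomogZ; apply: dhomog1.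
Qed.

Lemma homog_funD d f g :
  homog_fun d f -> homog_fun d g -> homog_fun d (fun v => f v + g v).
Proof.
move=> [p hp fp] [q hq gq]; exists (p + q) => [|v]; first exact: dhomogD.
by rewrite mevalD fp gq.
Qed.

Lemma homog_funM d d' f g :
  homog_fun d f -> homog_fun d' g -> homog_fun (d + d') (fun v => f v * g v).
Proof.
move=> [p hp fp] [q hq gq]; exists (p * q) => [|v]; first exact: dhomogM.
by rewrite mevalM fp gq.
Qed.

Lemma homog_funZ d c f : homog_fun d f -> homog_fun d (fun v => c * f v).
Proof. by move=> hf; rewrite -[d]add0n; apply: homog_funM (homog_funC c) hf. Qed.

Lemma homog_funN d f : homog_fun d f -> homog_fun d (fun v => - f v).
Proof. by move/(homog_funZ (-1)); apply: homog_fun_ext => v; rewrite mulN1r. Qed.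

Lemma homog_fun_sum d (I : eqType) (r : seq I) (F : I -> 'cV[K]_n -> K) :
  {in r, forall i, homog_fun d (F i)} -> homog_fun d (fun v => \sum_(i <- r) F i v).
Proof.
elim: r => [|i r IH] hF.
  by apply: homog_fun_ext (homog_fun0 d) => v; rewrite big_nil.
apply: (@homog_fun_ext _ (fun v => F i v + \sum_(j <- r) F j v)) => [v|].
  by rewrite big_cons.
apply: homog_funD; first by apply: hF; rewrite mem_head.
by apply: IH => j jr; apply: hF; rewrite inE jr orbT.
Qed.

Lemma homog_fun_prod (I : Type) (r : seq I) (d : I -> nat) (F : I -> 'cV[K]_n -> K) :
  (forall i, homog_fun (d i) (F i)) ->
  homog_fun (\sum_(i <- r) d i)%N (fun v => \prod_(i <- r) F i v).
Proof.
move=> hF; elim: r => [|i r IH].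
  by rewrite big_nil; apply: homog_fun_ext (homog_funC 1) => v; rewrite big_nil.
rewrite big_cons; apply: homog_fun_ext (homog_funM (hF i) IH) => v.
by rewrite big_cons.
Qed.

Lemma homog_funX d f k : homog_fun d f -> homog_fun (d * k) (fun v => f v ^+ k).
Proof.
move=> hf; elim: k => [|k IH].
  by rewrite muln0; apply: homog_fun_ext (homog_funC 1).
by rewrite mulnS; apply: homog_fun_ext (homog_funM hf IH) => v; rewrite exprS.
Qed.

Lemma homog_fun_coord i : homog_fun 1 (fun v : 'cV[K]_n => v i 0).
Proof. by exists 'X_i => [|v]; rewrite ?mevalXU // dhomogX /= mdeg1. Qed.

Lemma homog_fun_form (a : 'rV[K]_n) : homog_fun 1 (fun v => (a *m v) 0 0).
Proof.
apply: (@homog_fun_ext _ (fun v => \sum_i a 0 i * v i 0)) => [v|].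
  by rewrite mxE.
by apply: homog_fun_sum => i _; apply: homog_funZ; apply: homog_fun_coord.
Qed.

End HomogeneousFunctions.

Lemma homog_fun_comp (K : fieldType) n k d (f : 'cV[K]_n -> K) (M : 'M[K]_(n, k)) :
  homog_fun d f -> homog_fun d (fun w => f (M *m w)).
Proof.
move=> [p hp fp].
apply: (@homog_fun_ext _ _ _ (fun w => \sum_(m <- msupp p)
   p@_m * \prod_(i < n) (row i M *m w) 0 0 ^+ m i)) => [w|].
  rewrite fp mevalE; apply: eq_bigr => m _; congr (_ * _); apply: eq_bigr => i _.
  by rewrite -row_mul mxE.
apply: homog_fun_sum => m mp; apply: homog_funZ.
have -> : d = (\sum_(i < n) 1 * m i)%N.
  by rewrite -(dhomog_mf hp mp) /= mdegE; apply: eq_bigr => i _; rewrite mul1n.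
by apply: homog_fun_prod => i; apply: homog_funX; apply: homog_fun_form.
Qed.

(** * Divisibility by linear forms *)

Section LinearForms.
Variables (K : numFieldType) (n : nat).

Lemma memv_ker_form (a : 'rV[K]_n) v : (v \in ker_form a) = ((a *m v) 0 0 == 0).
Proof.
rewrite memv_ker lfunE /=; apply/eqP/eqP => [->|e]; first by rewrite mxE.
by apply/matrixP => i j; rewrite !ord1 e mxE.
Qed.

Lemma form_addZ (a : 'rV[K]_n) (v w : 'cV[K]_n) c :
  (a *m (v + c *: w)) 0 0 = (a *m v) 0 0 + c * (a *m w) 0 0.
Proof. by rewrite mulmxDr -scalemxAr mxE [X in _ + X]mxE. Qed.

Lemma meval_poly_form (a : 'rV[K]_n) (v : 'cV[K]_n) :
  (poly_form a).@[fun i => v i 0] = (a *m v) 0 0.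
Proof.
rewrite /poly_form raddf_sum mxE; apply: eq_bigr => i _ /=.
by rewrite mevalZ mevalXU.
Qed.

Lemma poly_form_homog (a : 'rV[K]_n) : poly_form a \is 1.-homog.
Proof.
by apply: rpred_sum => i _; apply: dhomogZ; rewrite dhomogX /= mdeg1.
Qed.

Lemma comp_mpoly_congr k (al : {mpoly K[k]}) (s t u : n.-tuple {mpoly K[k]}) :
  (forall i, tnth s i - tnth t i = al * tnth u i) ->
  forall p : {mpoly K[n]}, exists q, (p \mPo s) - (p \mPo t) = al * q.
Proof.
move=> stu; elim/mpoly_ring_ind => [c|i|p q [p' hp] [q' hq]|p q [p' hp] [q' hq]].
- by exists 0; rewrite !comp_mpolyC subrr mulr0.
- by exists (tnth u i); rewrite -stu !comp_mpolyXU !(tnth_nth 0).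
- by exists (p' + q'); rewrite !comp_mpolyD mulrDr -hp -hq opprD addrACA.
- exists (p' * (q \mPo s) + (p \mPo t) * q'); rewrite !rmorphM /= mulrDr.
  by rewrite mulrA -hp mulrCA -hq mulrBl mulrBr addrA subrK.
Qed.

(* Project onto the kernel of [a] along a vector [w] with [a w = 1]: the
   projection changes every coordinate by a multiple of the form. *)
Lemma poly_form_dvd (a : 'rV[K]_n) (p : {mpoly K[n]}) : a != 0 ->
  (forall v : 'cV[K]_n, v \in ker_form a -> p.@[fun i => v i 0] = 0) ->
  exists q, p = poly_form a * q.
Proof.
move=> a0 p0.
have [w aw] : exists w : 'cV[K]_n, (a *m w) 0 0 = 1.
  have [i ai] : exists i, a 0 i != 0.
    apply/existsP; rewrite -negb_forall; apply: contra a0 => /forallP h.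
    by apply/eqP/matrixP => i j; rewrite ord1 mxE; apply/eqP.
  exists ((a 0 i)^-1 *: delta_mx i 0).
  by rewrite -scalemxAr mxE -colE mxE mulVf.
pose s := [tuple 'X_i | i < n] : n.-tuple {mpoly K[n]}.
pose t := [tuple 'X_i - (w i 0)%:MP * poly_form a | i < n].
pose u := [tuple (w i 0)%:MP | i < n] : n.-tuple {mpoly K[n]}.
have [i|q] := @comp_mpoly_congr _ (poly_form a) s t u _ p.
  by rewrite !tnth_mktuple; ring.
rewrite comp_mpoly_id => pt; exists q; rewrite -pt.
suff -> : p \mPo t = 0 by rewrite subr0.
apply: mpoly_zero => v; rewrite comp_mpoly_meval.
pose v' : 'cV[K]_n := \col_i v i; pose v'' := v' + - (a *m v') 0 0 *: w.
rewrite -(p0 v''); last by rewrite memv_ker_form form_addZ aw mulr1 subrr.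
apply: meval_eq => i; rewrite tnth_mktuple mevalB mevalM mevalC mevalXU.
have -> : v'' i 0 = v i - (a *m v') 0 0 * w i 0.
  by rewrite [LHS]mxE [X in _ + X]mxE [X in X + _]mxE mulNr.
rewrite mulrC; congr (_ - _ * _).
by rewrite -meval_poly_form; apply: meval_eq => j; rewrite mxE.
Qed.

(* Only one variable is needed to cancel a form: restrict to a line. *)
Lemma meval_mul_form_eq0 (H : {vspace 'cV[K]_n}) (a : 'rV[K]_n) (q : {mpoly K[n]}) w :
  w \in H -> (a *m w) 0 0 != 0 ->
  (forall v, v \in H -> (poly_form a * q).@[fun i => v i 0] = 0) ->
  forall v, v \in H -> q.@[fun i => v i 0] = 0.
Proof.
move=> wH aw h v vH; pose l := line_poly q (fun i => v i 0) (fun i => w i 0).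
have lE e : l.[e] = q.@[fun i => (v + e *: w) i 0].
  by rewrite horner_line_poly; apply: meval_eq => i; rewrite !mxE.
suff l0 : l = 0.
  have := lE 0; rewrite l0 horner0 => ->; apply: meval_eq => i.
  by rewrite scale0r addr0.
apply: (@poly_infinite_roots _ _ [:: - (a *m v) 0 0 / (a *m w) 0 0]) => e.
rewrite inE => ne; rewrite lE.
have veH : v + e *: w \in H by rewrite memvD // memvZ.
have /eqP := h _ veH; rewrite mevalM meval_poly_form mulf_eq0 => /orP[|/eqP //].
rewrite form_addZ addrC addr_eq0 => /eqP ee.
by case/negP: ne; rewrite -ee mulfK.
Qed.

(** The forms are divided out one after the other. The quotient by the earlier forms still vanishes
    on the kernel of the next form [b], since each earlier form is nonzero somewhere on that kernel
    and can be cancelled there. *)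
Lemma prod_poly_form_dvd (L : seq 'rV[K]_n) (p : {mpoly K[n]}) :
  0 \notin L ->
  (forall i j, (i < j < size L)%N ->
     exists2 v, v \in ker_form L`_j & v \notin ker_form L`_i) ->
  (forall a v, a \in L -> v \in ker_form a -> p.@[fun i => v i 0] = 0) ->
  exists q, p = (\prod_(a <- L) poly_form a) * q.
Proof.
elim/last_ind: L p => [|L b IH] p; first by exists p; rewrite big_nil mul1r.
rewrite mem_rcons inE negb_or => /andP[b0 L0] hL hp.
have [||q pq] := IH p L0.
- move=> i j /andP[ij jL]; have [|v] := hL i j.
    by rewrite ij size_rcons ltnS ltnW.
  by rewrite !nth_rcons jL (ltn_trans ij jL); exists v.
- by move=> a v aL; apply: hp; rewrite mem_rcons inE aL orbT.
have nb : b != 0 by rewrite eq_sym.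
have [v vb|q' qq'] := poly_form_dvd nb (p := q).
  have {hp}: forall v, v \in ker_form b ->
      ((\prod_(a <- L) poly_form a) * q).@[fun i => v i 0] = 0.
    by move=> u ub; rewrite -pq; apply: hp ub; rewrite mem_rcons mem_head.
  have : forall a, a \in L -> exists2 w, w \in ker_form b & (a *m w) 0 0 != 0.
    move=> a aL; have [|w] := hL (index a L) (size L).
      by rewrite index_mem aL size_rcons leqnn.
    rewrite !nth_rcons ltnn eqxx index_mem aL nth_index // => wb wa.
    by exists w; rewrite // -memv_ker_form.
  elim: (L) q {pq IH} v vb => [|a L' IH'] q v vb hL' hq.
    by rewrite -(hq v vb) big_nil mul1r.
  apply: IH' => // [a' a'L|]; first by apply: hL'; rewrite inE a'L orbT.
  have [w wb aw] := hL' a (mem_head _ _).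
  by apply: (meval_mul_form_eq0 wb aw) => u ub; rewrite -[RHS](hq u ub) big_cons mulrA.
by exists q'; rewrite pq qq' -cats1 big_cat big_seq1 mulrA.
Qed.

End LinearForms.

(** * Saito's criterion *)

Section VectorFields.
Variables (K : comNzRingType) (n : nat).
Local Notation S := {mpoly K[n]}.

Definition field_der (y : 'rV[S]_n) (p : S) : S := \sum_(i < n) y 0 i * p^`M(i).

Lemma field_der_is_linear y : linear (field_der y).
Proof.
move=> c p q; rewrite /field_der scaler_sumr -big_split /=.
by apply: eq_bigr => i _; rewrite mderivD mderivZ mulrDr scalerAr.
Qed.

HB.instance Definition _ y :=
  GRing.isLinear.Build K S S _ (field_der y) (field_der_is_linear y).

Lemma field_derM y p q : field_der y (p * q) = field_der y p * q + p * field_der y q.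
Proof.
rewrite /field_der mulr_suml mulr_sumr -big_split /=; apply: eq_bigr => i _.
by rewrite mderivM mulrDr !mulrA; congr (_ + _ * _); apply: mulrC.
Qed.

Lemma field_derX y i : field_der y 'X_i = y 0 i.
Proof.
rewrite /field_der (bigD1 i) //= mderiv_var eqxx mulr1 big1 ?addr0 // => j nj.
by rewrite mderiv_var (negPf nj) mulr0.
Qed.

End VectorFields.

Section DerivationsOverFields.
Variables (K : fieldType) (n : nat).

Lemma derivation_field (eta : {linear {mpoly K[n]} -> {mpoly K[n]}}) :
  derivation eta -> eta =1 field_der (\row_i eta 'X_i).
Proof.
move=> etaM p; rewrite (@derivation_expand _ _ _ idfun eta) //=.
- by apply: eq_bigr => i _; rewrite mxE mulrC.
- exact: raddfD.
- move=> c; rewrite -[c%:MP]mulr1 mul_mpolyC linearZ /=.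
  have := etaM 1 1; rewrite !mulr1 mul1r => /eqP.
  by rewrite -subr_eq0 opprD addrA subrr sub0r oppr_eq0 => /eqP ->; rewrite scaler0.
Qed.

Lemma field_der_form (y : 'rV[{mpoly K[n]}]_n) (a : 'rV[K]_n) :
  field_der y (poly_form a) = \sum_i a 0 i *: y 0 i.
Proof.
rewrite /poly_form raddf_sum; apply: eq_bigr => i _ /=.
by rewrite linearZ /= field_derX.
Qed.

End DerivationsOverFields.

Section Homogeneity.
Variables (K : idomainType) (n : nat).

Lemma prod_dhomog (I : Type) (r : seq I) (d : I -> nat) (F : I -> {mpoly K[n]}) :
  (forall i, F i \is (d i).-homog) ->
  \prod_(i <- r) F i \is (\sum_(i <- r) d i)%N.-homog.
Proof.
move=> hF; elim: r => [|i r IH]; first by rewrite !big_nil dhomog1.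
by rewrite !big_cons; apply: dhomogM.
Qed.

Lemma det_dhomog k (d : 'I_k -> nat) (M : 'M[{mpoly K[n]}]_k) :
  (forall i j, M i j \is (d i).-homog) -> \det M \is (\sum_i d i)%N.-homog.
Proof.
move=> hM; apply: rpred_sum => s _; rewrite mulr_sign.
have h : \prod_i M i (s i) \is (\sum_i d i)%N.-homog by apply: prod_dhomog.
by case: ifP => _ //; rewrite dhomogN.
Qed.

Lemma msize_dhomog d (p : {mpoly K[n]}) : p != 0 -> p \is d.-homog -> msize p = d.+1.
Proof. by move=> p0 hp; rewrite -(mlead_deg p0) (dhomog_mf hp (mlead_supp p0)). Qed.

End Homogeneity.

Section Cramer.
Variables (K : comNzRingType) (n : nat).

Definition row_subst (M : 'M[K]_n) (y : 'rV[K]_n) (r : 'I_n) : 'M[K]_n :=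
  \matrix_(i, j) if i == r then y 0 j else M i j.

(** Cramer's rule: the numerators are determinants with one row replaced, so a common divisor of all
    determinants with tangent rows divides them as well. *)
Lemma det_row_subst M y r : \det (row_subst M y r) = (y *m \adj M) 0 r.
Proof.
rewrite (expand_det_row _ r) mxE; apply: eq_bigr => j _.
rewrite !mxE eqxx /cofactor; congr (_ * (_ * \det _)).
apply/matrixP => i k; rewrite !mxE; case: eqP => // e.
by case/eqP: (neq_lift r i).
Qed.

End Cramer.

(** At [v] all rows lie in the hyperplane defined by [a], hence are dependent. *)
Lemma det_meval_eq0 (K : fieldType) n (N : 'M[{mpoly K[n]}]_n) (a : 'rV[K]_n) v :
  a != 0 -> (forall r, (\sum_i a 0 i *: N r i).@[v] = 0) -> (\det N).@[v] = 0.
Proof.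
move=> a0 h; rewrite -det_map_mx; apply: contraNeq a0 => nz.
have uN : map_mx (meval v) N \in unitmx by rewrite unitmxE unitfE.
suff : map_mx (meval v) N *m a^T = 0.
  move/(congr1 (mulmx (invmx (map_mx (meval v) N)))); rewrite mulKmx // mulmx0.
  by move/(congr1 trmx); rewrite trmxK trmx0 => ->.
apply/matrixP => r j; rewrite ord1 !mxE -[RHS](h r) raddf_sum.
by apply: eq_bigr => i _; rewrite !mxE /= mevalZ mulrC.
Qed.

(* The determinant of the coefficients is divisible by every form of [L], and
   so by their product; comparing degrees the quotient is a constant. *)
Lemma saito_criterion (K : numFieldType) (e : seq nat) n
    (A : {fset {vspace 'cV[K]_n}}) (f : nat -> 'cV[K]_n -> 'cV[K]_n)
    (v0 : 'cV[K]_n) (L : seq 'rV[K]_n) :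
  size e = n ->
  (forall r i, (r < n)%N -> homog_fun (nth 0%N e r) (fun v => f r v i 0)) ->
  (forall H r v, H \in A -> (r < n)%N -> v \in H -> f r v \in H) ->
  (forall c : 'I_n -> K, \sum_(r < n) c r *: f r v0 = 0 -> forall r, c r = 0) ->
  size L = sumn e ->
  (forall a, a \in L -> ker_form a \in A) ->
  0 \notin L ->
  (forall i j, (i < j < size L)%N ->
     exists2 v, v \in ker_form L`_j & v \notin ker_form L`_i) ->
  free_with_exponents A e.
Proof.
(* With [size e] in place of [n], the index type of the basis in [free_with_exponents] is that of
   the rows of [M]. *)
move=> se; case: n / se A f v0 L => A f v0 L; set n := size e.
move=> hom pres indep sL LA L0 Lpair.
pose ev (v : 'cV[K]_n) : 'I_n -> K := fun i => v i 0.
have hP0 (r i : 'I_n) : exists p : {mpoly K[n]},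
    p \is (nth 0%N e r).-homog /\ forall v, f r v i 0 = p.@[ev v].
  by have [p hp fp] := hom r i (ltn_ord r); exists p.
have [P hP] := fin_all_exists (fun r => fin_all_exists (hP0 r)).
pose M : 'M[{mpoly K[n]}]_n := \matrix_(r, i) P r i.
(* Tangency tested on values: the derivation with coefficients [y], applied to the form [a],
   vanishes on the hyperplane of [a]. *)
pose orth (y : 'rV[{mpoly K[n]}]_n) := forall (a : 'rV[K]_n) v,
  ker_form a \in A -> v \in ker_form a -> (\sum_i a 0 i *: y 0 i).@[ev v] = 0.
have orthM r : orth (row r M).
  move=> a v aA va; have := pres _ r v aA (ltn_ord r) va.
  rewrite memv_ker_form mxE => /eqP fr; rewrite -[RHS]fr raddf_sum.
  by apply: eq_bigr => i _; rewrite !mxE /= mevalZ; have [_ ->] := hP r i.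
have dvdL (N : 'M[{mpoly K[n]}]_n) : (forall r, orth (row r N)) ->
    exists q, \det N = \prod_(a <- L) poly_form a * q.
  move=> oN; apply: prod_poly_form_dvd => // a v aL va.
  have a0 : a != 0 by apply: contraNneq L0 => <-.
  apply: (det_meval_eq0 a0) => r; rewrite -[RHS](oN r a v (LA a aL) va).
  by congr (meval _ _); apply: eq_bigr => i _; rewrite mxE.
have detM0 : \det M != 0.
  suff : (\det M).@[ev v0] != 0 by apply: contraNneq => ->; rewrite meval0.
  rewrite -det_map_mx; apply/negP => /det0P[c nzc cM].
  case/eqP: nzc; apply/rowP => r; rewrite mxE; apply: indep.
  apply/matrixP => i j; rewrite ord1 summxE.
  have := congr1 (fun X : 'rV_n => X 0 i) cM; rewrite /= mxE [RHS]mxE => ci.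
  rewrite [RHS]mxE -[RHS]ci; apply: eq_bigr => r' _.
  by rewrite !mxE; have [_ ->] := hP r' i.
have [q detq] := dvdL M orthM.
have [c c0 qc] : exists2 c, c != 0 & q = c%:MP.
  apply/msize_poly1P/eqP.
  move: (detM0); rewrite detq mulf_eq0 negb_or => /andP[nzL nzq].
  have hL : \prod_(a <- L) poly_form a \is (size L).-homog.
    rewrite -(sum1_size L); apply: prod_dhomog => a; exact: poly_form_homog.
  have hM : \det M \is (sumn e).-homog.
    have -> : sumn e = (\sum_(i < n) nth 0%N e i)%N.
      by rewrite sumnE (big_nth 0%N) big_mkord.
    by apply: det_dhomog => r i; rewrite mxE; have [] := hP r i.
  have := msize_dhomog detM0 hM; rewrite detq msizeM // (msize_dhomog nzL hL) sL.
  by rewrite addSn /= -[X in _ = X]addn1 => /eqP; rewrite eqn_add2l => /eqP.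
(* The determinant of [M] is a nonzero constant times the product of the forms, and that product
   divides every Cramer numerator of a tangent row; the coefficients are therefore polynomials. *)
have cramer (y : 'rV[{mpoly K[n]}]_n) : orth y ->
    exists u : 'rV_n, y = u *m M.
  move=> oy.
  have hg0 (r : 'I_n) : exists g, (y *m \adj M) 0 r = \prod_(a <- L) poly_form a * g.
    rewrite -det_row_subst; apply: dvdL => r' a v aA va.
    have [->|nr] := eqVneq r' r.
      rewrite -[RHS](oy a v aA va); congr (meval _ _).
      by apply: eq_bigr => i _; rewrite !mxE eqxx.
    rewrite -[RHS](orthM r' a v aA va); congr (meval _ _).
    by apply: eq_bigr => i _; rewrite !mxE (negPf nr).
  have [g hg] := fin_all_exists hg0.
  exists (\row_r (c^-1 *: g r)).
  set u := \row_r _; have yu : y *m \adj M = \det M *: u.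
    apply/rowP => r; rewrite hg !mxE detq qc -mulrA mul_mpolyC scalerA.
    by rewrite divff // scale1r.
  have : \det M *: y = \det M *: (u *m M).
    by rewrite scalemxAl -yu -mulmxA mul_adj_mx mul_mx_scalar.
  move/eqP; rewrite -subr_eq0 -scalerBr scalemx_eq0 (negPf detM0) /= subr_eq0.
  by move/eqP.
exists (fun r => field_der (row r M)); split; last first.
  move=> r i; rewrite /= field_derX !mxE; by have [] := hP r i.
split=> [r|eta [der_eta in_eta]].
  split=> [p q'|H a HA Ha]; first exact: field_derM.
  (* [A] is not assumed to consist of hyperplanes here; for the whole space the form is zero and the
     divisibility reads $0=0$. *)
  have [->|a0] := eqVneq a 0.
    exists 0; have -> : poly_form (0 : 'rV[K]_n) = 0.
      by apply: big1 => i _; rewrite mxE scale0r.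
    by rewrite linear0 mulr0.
  apply: poly_form_dvd => // v va; rewrite /= field_der_form.
  by apply: (orthM r a v _ va); rewrite -Ha.
have [|u hu] := cramer (\row_i eta 'X_i).
  move=> a v aA va; have [q' hq'] := in_eta _ a aA erefl.
  have := congr1 (meval (ev v)) hq'; rewrite mevalM meval_poly_form.
  move: va; rewrite memv_ker_form => /eqP ->; rewrite mul0r => <-.
  by rewrite derivation_field // field_der_form.
exists [ffun r => u 0 r]; split=> [p|u' hu'].
  rewrite derivation_field // hu /field_der.
  under [RHS]eq_bigr do rewrite ffunE mulr_sumr.
  rewrite exchange_big; apply: eq_bigr => i _.
  by rewrite mxE mulr_suml; apply: eq_bigr => r _; rewrite !mxE mulrA.
apply/ffunP => r; rewrite ffunE.
have e1 : (u - \row_r u' r) *m M = 0.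
  rewrite mulmxBl -hu; apply/rowP => i; rewrite !mxE hu'.
  apply/eqP; rewrite subr_eq0; apply/eqP; apply: eq_bigr => r' _.
  by rewrite /= field_derX !mxE.
have : (u - \row_r u' r) *m M *m \adj M = 0 by rewrite e1 mul0mx.
rewrite -mulmxA mul_mx_adj mul_mx_scalar => /eqP; rewrite scalemx_eq0 (negPf detM0) /=.
by move/eqP/rowP/(_ r); rewrite !mxE => /eqP; rewrite subr_eq0 => /eqP.
Qed.

(** * Restriction to a flat *)

Section Restriction.
Variables (K : numFieldType) (n : nat) (X : {vspace 'cV[K]_n}).

Definition inj_mx : 'M[K]_(n, \dim X) := \matrix_(i, j) (vbasis X)`_j i 0.

(** The coordinates are extended to the whole ambient space; only the values on [X] matter, where
    [inj_mx] undoes them. *)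
Definition coord_mx : 'M[K]_(\dim X, n) :=
  \matrix_(i, j) coord (vbasis X) i (delta_mx j 0).

Definition param_fun (w : 'cV[K]_(\dim X)) : 'cV[K]_n :=
  \sum_(i < \dim X) w i 0 *: (vbasis X)`_i.

Lemma param_fun_is_linear : linear param_fun.
Proof.
move=> c u v; rewrite /param_fun scaler_sumr -big_split /=.
by apply: eq_bigr => i _; rewrite !mxE scalerDl scalerA.
Qed.

HB.instance Definition _ :=
  GRing.isLinear.Build K 'cV[K]_(\dim X) 'cV[K]_n _ param_fun param_fun_is_linear.

Lemma param_funE w : param X w = param_fun w.
Proof. exact: (lfunE param_fun w). Qed.

Lemma paramE w : param X w = inj_mx *m w.
Proof.
rewrite param_funE; apply/matrixP => i j; rewrite ord1 summxE mxE.
by apply: eq_bigr => k _; rewrite !mxE mulrC.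
Qed.

Lemma coord_mxE (u : 'cV[K]_n) : coord_mx *m u = \col_i coord (vbasis X) i u.
Proof.
apply/matrixP => i j; rewrite ord1 !mxE.
have {2}-> : u = \sum_k u k 0 *: delta_mx k 0.
  apply/matrixP => k k'; rewrite ord1 summxE (bigD1 k) //= big1 ?addr0.
    by rewrite !mxE !eqxx mulr1.
  by move=> l lk; rewrite !mxE eq_sym (negPf lk) mulr0.
by rewrite linear_sum; apply: eq_bigr => k _; rewrite linearZ mxE mulrC.
Qed.

Lemma coord_mxK (u : 'cV[K]_n) : u \in X -> inj_mx *m (coord_mx *m u) = u.
Proof.
move=> uX; rewrite {2}(coord_vbasis uX) coord_mxE.
apply/matrixP => i j; rewrite ord1 summxE mxE; apply: eq_bigr => k _.
by rewrite !mxE mulrC.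
Qed.

Lemma inj_mx_mem (w : 'cV[K]_(\dim X)) : inj_mx *m w \in X.
Proof.
rewrite -paramE param_funE.
by apply: memv_suml => i _; rewrite memvZ // vbasis_mem // mem_nth // size_tuple.
Qed.

End Restriction.

(** Saito's criterion on [X] with all hypotheses stated in the ambient space. The fields preserve
    [X], so they can be conjugated by a basis of [X]; each form of [L] stands for its restriction to
    [X]. *)
Lemma free_restriction (K : numFieldType) (e : seq nat) n
    (A : {fset {vspace 'cV[K]_n}}) (X : {vspace 'cV[K]_n})
    (f : nat -> 'cV[K]_n -> 'cV[K]_n) (v0 : 'cV[K]_n) (L : seq 'rV[K]_n) :
  size e = \dim X ->
  (forall r i, (r < \dim X)%N -> homog_fun (nth 0%N e r) (fun v => f r v i 0)) ->
  (forall H r v, H \in A -> (r < \dim X)%N -> v \in H -> f r v \in H) ->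
  (forall r v, (r < \dim X)%N -> v \in X -> f r v \in X) ->
  v0 \in X ->
  (forall c : 'I_(\dim X) -> K, \sum_(r < \dim X) c r *: f r v0 = 0 -> forall r, c r = 0) ->
  size L = sumn e ->
  (forall a, a \in L -> exists2 H, H \in A & (H :&: X = ker_form a :&: X)%VS) ->
  (forall a, a \in L -> ~~ (X <= ker_form a)%VS) ->
  (forall i j, (i < j < size L)%N ->
     exists2 v, v \in (ker_form L`_j :&: X)%VS & v \notin ker_form L`_i) ->
  free_with_exponents (in_coordinates X (restriction A X)) e.
Proof.
move=> se hom pres presX v0X indep sL LA L0 Lpair.
have memker (a : 'rV[K]_n) w :
    (w \in ker_form (a *m inj_mx X)) = (inj_mx X *m w \in ker_form a).
  by rewrite !memv_ker_form mulmxA.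
apply: (@saito_criterion _ _ _ _ (fun r w => coord_mx X *m f r (inj_mx X *m w))
  (coord_mx X *m v0) [seq a *m inj_mx X | a <- L]) => //.
- move=> r i rX.
  apply: (@homog_fun_ext _ _ _ (fun w => \sum_j coord_mx X i j * f r (inj_mx X *m w) j 0)).
    by move=> w; rewrite mxE.
  apply: homog_fun_sum => j _; apply: homog_funZ.
  exact: (homog_fun_comp (inj_mx X) (hom r j rX)).
- move=> H r w /imfsetP[/= H' /imfsetP[/= H0 /andP[H0A _] ->] ->] rX.
  rewrite -!memv_preim !paramE !memv_cap => /andP[w0 _].
  have hX := presX r _ rX (inj_mx_mem w).
  by rewrite coord_mxK // hX (pres H0).
- move=> c hc r; apply: (indep c).
  rewrite -[LHS](@coord_mxK _ _ X); last first.
    by apply: memv_suml => r' _; apply: memvZ; apply: presX.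
  rewrite mulmx_sumr -[RHS](mulmx0 _ (inj_mx X)); congr (_ *m _).
  rewrite -[RHS]hc; apply: eq_bigr => r' _.
  by rewrite -scalemxAr coord_mxK.
- by rewrite size_map.
- move=> _ /mapP[a aL ->]; have [H HA HX] := LA a aL.
  apply/imfsetP; exists (H :&: X)%VS => /=.
    apply/imfsetP; exists H => //=; rewrite inE HA /=.
    apply: contra (L0 a aL) => XH.
    by rewrite (_ : X = ker_form a :&: X)%VS ?capvSl // -HX; apply/esym/capv_idPr.
  apply/vspaceP => w; rewrite -memv_preim paramE HX memv_cap inj_mx_mem andbT.
  exact: memker.
- apply/mapP => -[a aL e0]; case/negP: (L0 a aL); apply/subvP => v vX.
  by rewrite -(coord_mxK vX) -memker -e0 memv_ker_form mul0mx mxE.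
- rewrite size_map => i j ijL; have [v] := Lpair i j ijL; rewrite memv_cap.
  case/andP: ijL => ij jL; have iL := ltn_trans ij jL.
  move=> /andP[vj vX] vi; exists (coord_mx X *m v).
    by rewrite (nth_map 0) // memker coord_mxK.
  by rewrite (nth_map 0) // memker coord_mxK.
Qed.

(** * Difference equations *)

Section Antidifference.
Variables (K : numFieldType) (z : K).

(** Course-of-values recursion through the list of earlier terms. The recurrence comes from
    $(t+z)^{n+1}-t^{n+1}=(n+1)zt^n+\sum_{j<n}\binom{n+1}{j}z^{n-j}(zt^j)$. *)
Fixpoint bern_seq (n : nat) : seq {poly K} :=
  if n is k.+1 then
    rcons (bern_seq k) (k.+1%:R^-1 *: ('X^(k.+1) -
      \sum_(j < k) ('C(k.+1, j)%:R * z ^+ (k - j)) *: (bern_seq k)`_j))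
  else [::].

(* Homogeneous variant of the Bernoulli polynomials (without constant term):
   the step of the difference operator is [z]. *)
Definition bern (n : nat) : {poly K} := (bern_seq n.+1)`_n.

Lemma size_bern_seq n : size (bern_seq n) = n.
Proof. by elim: n => //= n IH; rewrite size_rcons IH. Qed.

Lemma nth_bern_seq n j : (j < n)%N -> (bern_seq n)`_j = bern j.
Proof.
elim: n => // n IH; rewrite ltnS leq_eqVlt => /orP[/eqP -> //|jn].
by rewrite -IH // [bern_seq n.+1]/= nth_rcons size_bern_seq jn.
Qed.

Lemma bernE n : bern n = n.+1%:R^-1 *: ('X^(n.+1) -
  \sum_(j < n) ('C(n.+1, j)%:R * z ^+ (n - j)) *: bern j).
Proof.
rewrite {1}/bern /= nth_rcons size_bern_seq ltnn eqxx; congr (_ *: (_ - _)).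
by apply: eq_bigr => j _; rewrite nth_bern_seq.
Qed.

(** Keeping the factor [z] on the right avoids any division by [z]: [bern n] is jointly homogeneous
    of degree [n.+1] in the variable and [z]. *)
Lemma bern_diff n t : (bern n).[t + z] - (bern n).[t] = z * t ^+ n.
Proof.
elim/ltn_ind: n => n IH; rewrite bernE !hornerZ -mulrBr !hornerD !hornerN !hornerXn.
rewrite !horner_sum.
have e : (t + z) ^+ n.+1 - t ^+ n.+1 -
    \sum_(j < n) 'C(n.+1, j)%:R * z ^+ (n - j) * (z * t ^+ j) = n.+1%:R * (z * t ^+ n).
  rewrite addrC [t + z]addrC exprDn !big_ord_recr /= subnn expr0 binn mulr1n mul1r.
  have -> : (n.+1 - n = 1)%N by lia.
  rewrite expr1 binSn -[X in _ + X *+ _ + _]mulr1 -mulrnAr.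
  have -> : \sum_(i < n) z ^+ (n.+1 - i) * t ^+ i *+ 'C(n.+1, i) =
      \sum_(j < n) 'C(n.+1, j)%:R * z ^+ (n - j) * (z * t ^+ j).
    apply: eq_bigr => i _; rewrite subSn 1?ltnW // exprS -mulr_natl; ring.
  rewrite -[n.+1%:R in LHS]mulr_natr mul1r; ring.
have nz : n.+1%:R != 0 :> K by rewrite pnatr_eq0.
rewrite -[RHS](mulKf nz) -e.
congr (_ * _); rewrite opprD addrACA; congr (_ + _).
rewrite opprK addrC -opprB; congr (- _); rewrite -sumrB; apply: eq_bigr => j _.
by rewrite !hornerZ -mulrBr IH.
Qed.

Definition antidiff (g : {poly K}) : {poly K} := \sum_(j < size g) g`_j *: bern j.

Lemma antidiff_wide d (g : {poly K}) : (size g <= d)%N ->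
  antidiff g = \sum_(j < d) g`_j *: bern j.
Proof.
move=> gd; rewrite /antidiff (big_ord_widen d (fun j => g`_j *: bern j)) //.
rewrite big_mkcond; apply: eq_bigr => j _; case: ltnP => // gj.
by rewrite nth_default // scale0r.
Qed.

Lemma antidiff_diff g t : (antidiff g).[t + z] - (antidiff g).[t] = z * g.[t].
Proof.
rewrite /antidiff !horner_sum -sumrB [in RHS]horner_coef mulr_sumr.
by apply: eq_bigr => j _; rewrite !hornerZ -mulrBr bern_diff mulrCA.
Qed.

Lemma antidiff_sum_diff g t c :
  (antidiff g).[t + c%:R * z] - (antidiff g).[t] = z * \sum_(u < c) g.[t + u%:R * z].
Proof.
elim: c => [|c IH]; first by rewrite big_ord0 mul0r addr0 subrr mulr0.
rewrite big_ord_recr mulrDr -IH -antidiff_diff /=.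
have -> : t + c.+1%:R * z = t + c%:R * z + z by rewrite -natr1; ring.
ring.
Qed.

Lemma antidiff_const g t c : (forall u, (u < c)%N -> g.[t + u%:R * z] = 0) ->
  (antidiff g).[t + c%:R * z] = (antidiff g).[t].
Proof.
move=> h; apply/eqP; rewrite -subr_eq0 antidiff_sum_diff big1 ?mulr0 // => u _.
exact: h.
Qed.

Lemma antidiffD g1 g2 : antidiff (g1 + g2) = antidiff g1 + antidiff g2.
Proof.
pose d := maxn (size g1) (size g2).
rewrite !(@antidiff_wide d) ?leq_maxl ?leq_maxr ?size_polyD // -big_split /=.
by apply: eq_bigr => j _; rewrite coefD scalerDl.
Qed.

Lemma antidiffZ c g : antidiff (c *: g) = c *: antidiff g.
Proof.
rewrite !(@antidiff_wide (size g)) ?size_scale_leq // scaler_sumr.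
by apply: eq_bigr => j _; rewrite coefZ scalerA.
Qed.

Lemma antidiff_sum (I : Type) (r : seq I) (F : I -> {poly K}) :
  antidiff (\sum_(i <- r) F i) = \sum_(i <- r) antidiff (F i).
Proof.
apply: (big_morph _ antidiffD); rewrite /antidiff size_poly0; exact: big_ord0.
Qed.

End Antidifference.

(** * Polynomials with homogeneous coefficients *)

Section HomogeneousFamilies.
Variables (K : numFieldType) (n : nat).
Implicit Types (P Q : 'cV[K]_n -> {poly K}).

(** Joint homogeneity of degree [d] in the point [v] and the polynomial variable, which has weight
    one. *)
Definition homog_poly (d : nat) P : Prop :=
  (forall v, size (P v) <= d.+1)%N /\
  forall j, (j <= d)%N -> homog_fun (d - j) (fun v => (P v)`_j).

Lemma homog_poly_ext d P Q : P =1 Q -> homog_poly d P -> homog_poly d Q.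
Proof.
move=> e [h1 h2]; split=> [v|j jd]; first by rewrite -e.
by apply: homog_fun_ext (h2 j jd) => v; rewrite e.
Qed.

Lemma homog_polyC d (c : 'cV[K]_n -> K) :
  homog_fun d c -> homog_poly d (fun v => (c v)%:P).
Proof.
move=> hc; split=> [v|[|j] _].
- by rewrite (leq_trans (size_polyC_leq1 _)).
- by rewrite subn0; apply: homog_fun_ext hc => v; rewrite coefC.
- by apply: homog_fun_ext (homog_fun0 _ _ _) => v; rewrite coefC.
Qed.

Lemma homog_polyXn k : homog_poly k (fun _ => 'X^k).
Proof.
split=> [v|j jd]; first by rewrite size_polyXn.
have [->|nj] := eqVneq j k.
  by rewrite subnn; apply: homog_fun_ext (homog_funC _ 1) => v; rewrite coefXn eqxx.
by apply: homog_fun_ext (homog_fun0 _ _ _) => v; rewrite coefXn (negPf nj).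
Qed.

Lemma homog_polyX : homog_poly 1 (fun _ => 'X).
Proof. exact: (homog_polyXn 1). Qed.

Lemma homog_polyD d P Q :
  homog_poly d P -> homog_poly d Q -> homog_poly d (fun v => P v + Q v).
Proof.
move=> [p1 p2] [q1 q2]; split=> [v|j jd].
  by rewrite (leq_trans (size_polyD _ _)) // geq_max p1 q1.
apply: homog_fun_ext (homog_funD (p2 j jd) (q2 j jd)) => v; by rewrite coefD.
Qed.

Lemma homog_poly_coef d P j k : (j + k = d)%N -> homog_poly d P ->
  homog_fun k (fun v => (P v)`_j).
Proof. by move=> jk [_ /(_ j)]; rewrite -jk leq_addr addKn => /(_ isT). Qed.

Lemma homog_polyM d d' P Q :
  homog_poly d P -> homog_poly d' Q -> homog_poly (d + d') (fun v => P v * Q v).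
Proof.
move=> hP hQ; split=> [v|k kd].
  apply: leq_trans (size_polyMleq _ _) _.
  by have := hP.1 v; have := hQ.1 v; lia.
apply: (@homog_fun_ext _ _ _ (fun v => \sum_(i < k.+1) (P v)`_i * (Q v)`_(k - i))).
  by move=> v; rewrite coefM.
apply: homog_fun_sum => i _; have := ltn_ord i; rewrite ltnS => ik.
have [id|id] := leqP i d; last first.
  by apply: homog_fun_ext (homog_fun0 _ _ _) => v; rewrite (nth_default 0 (leq_trans (hP.1 v) id)) mul0r.
have [kd'|kd'] := leqP (k - i) d'; last first.
  by apply: homog_fun_ext (homog_fun0 _ _ _) => v; rewrite mulrC (nth_default 0 (leq_trans (hQ.1 v) kd')) mul0r.
have -> : (d + d' - k = (d - i) + (d' - (k - i)))%N by lia.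
by apply: homog_funM; apply: homog_poly_coef; [|exact: hP| |exact: hQ]; lia.
Qed.

Lemma homog_polyZ d d' (c : 'cV[K]_n -> K) P : homog_fun d c -> homog_poly d' P ->
  homog_poly (d + d') (fun v => c v *: P v).
Proof.
move=> hc hP; apply: homog_poly_ext (homog_polyM (homog_polyC hc) hP) => v.
by rewrite mul_polyC.
Qed.

Lemma homog_polyN d P : homog_poly d P -> homog_poly d (fun v => - P v).
Proof.
move=> hP; apply: homog_poly_ext (homog_polyZ (homog_funC _ (-1)) hP) => v.
by rewrite scaleN1r.
Qed.

Lemma homog_poly0 d : homog_poly d (fun _ => 0).
Proof. exact/homog_polyC/homog_fun0. Qed.

Lemma homog_poly_sum d (I : Type) (r : seq I) (F : I -> 'cV[K]_n -> {poly K}) :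
  (forall i, homog_poly d (F i)) -> homog_poly d (fun v => \sum_(i <- r) F i v).
Proof.
move=> hF; elim: r => [|i r IH].
  by apply: homog_poly_ext (homog_poly0 d) => v; rewrite big_nil.
by apply: homog_poly_ext (homog_polyD (hF i) IH) => v; rewrite big_cons.
Qed.

Lemma homog_poly_prod d (I : Type) (r : seq I) (F : I -> 'cV[K]_n -> {poly K}) :
  (forall i, homog_poly d (F i)) ->
  homog_poly (d * size r) (fun v => \prod_(i <- r) F i v).
Proof.
move=> hF; elim: r => [|i r IH].
  rewrite muln0; apply: homog_poly_ext (homog_polyC (homog_funC _ 1)) => v.
  by rewrite big_nil.
rewrite mulnS; apply: homog_poly_ext (homog_polyM (hF i) IH) => v.
by rewrite big_cons.
Qed.

Lemma homog_polyE d P k : homog_poly d P -> homog_poly (d * k) (fun v => P v ^+ k).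
Proof.
move=> hP; elim: k => [|k IH].
  by rewrite muln0; apply: homog_poly_ext (homog_polyC (homog_funC _ 1)).
by rewrite mulnS; apply: homog_poly_ext (homog_polyM hP IH) => v; rewrite exprS.
Qed.

Lemma homog_poly_comp d P Q :
  homog_poly d P -> homog_poly 1 Q -> homog_poly d (fun v => P v \Po Q v).
Proof.
move=> hP hQ.
apply: (@homog_poly_ext _ (fun v => \sum_(i < d.+1) (P v)`_i *: Q v ^+ i)).
  move=> v; rewrite comp_polyE.
  rewrite [RHS](big_ord_widen d.+1 (fun i => (P v)`_i *: Q v ^+ i)) ?hP.1 //.
  rewrite [RHS]big_mkcond; apply: eq_bigr => i _; case: ltnP => // Pi.
  by rewrite nth_default // scale0r.
apply: homog_poly_sum => i; have := ltn_ord i; rewrite ltnS => id.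
have := homog_polyZ (hP.2 i id) (homog_polyE i hQ).
by rewrite mul1n subnK.
Qed.

Lemma homog_poly_shift d P (c : 'cV[K]_n -> K) :
  homog_poly d P -> homog_fun 1 c -> homog_poly d (fun v => P v \Po ('X + (c v)%:P)).
Proof.
move=> hP hc; apply: homog_poly_comp => //.
exact: (homog_polyD homog_polyX (homog_polyC hc)).
Qed.

Lemma homog_poly_horner d P (x : 'cV[K]_n -> K) :
  homog_poly d P -> homog_fun 1 x -> homog_fun d (fun v => (P v).[x v]).
Proof.
move=> hP hx; have := homog_poly_comp hP (homog_polyC hx).
move/(homog_poly_coef (add0n d)); apply: homog_fun_ext => v.
by rewrite comp_polyCr coefC.
Qed.

Lemma homog_bern (z : 'cV[K]_n -> K) k :
  homog_fun 1 z -> homog_poly k.+1 (fun v => bern (z v) k).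
Proof.
move=> hz; elim/ltn_ind: k => k IH.
apply: homog_poly_ext (fun v => esym (bernE (z v) k)) _.
apply: (@homog_polyZ 0 k.+1 (fun _ => _)); first exact: homog_funC.
apply: homog_polyD; first exact: homog_polyXn.
apply: homog_polyN; apply: homog_poly_sum => j.
have e : ((0 + 1 * (k - j)) + j.+1 = k.+1)%N by have := ltn_ord j; lia.
have := homog_polyZ (homog_funM (homog_funC _ 'C(k.+1, j)%:R) (homog_funX (k - j) hz))
  (IH j (ltn_ord j)).
by rewrite e.
Qed.

Lemma homog_antidiff (z : 'cV[K]_n -> K) d P :
  homog_fun 1 z -> homog_poly d P -> homog_poly d.+1 (fun v => antidiff (z v) (P v)).
Proof.
move=> hz hP; apply: homog_poly_ext (fun v => esym (antidiff_wide _ (hP.1 v))) _.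
apply: homog_poly_sum => j; have := ltn_ord j; rewrite ltnS => jd.
have := homog_polyZ (hP.2 j jd) (homog_bern j hz).
by rewrite addnS subnK.
Qed.

End HomogeneousFamilies.

(** * Divided differences *)

Section DividedDifferences.
Variable A : comNzRingType.
Implicit Types (H Q : {poly A}) (s k h : A).

(** The quotient $(H(s)-H(-s))/(2s)$, written on coefficients: the odd powers of [H] survive,
    lowered by one. *)
Definition odd_quot H : {poly A} := \poly_(j < size H) (if odd j then 0 else H`_j.+1).

Lemma coef_odd_quot H j : (odd_quot H)`_j = if odd j then 0 else H`_j.+1.
Proof.
rewrite coef_poly; case: ltnP => // Hj; case: ifP => // _.
by rewrite nth_default // ltnW.
Qed.

Lemma odd_quot_horner H s : H.[s] - H.[- s] = 2 * s * (odd_quot H).[s].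
Proof.
rewrite !(@horner_coef_wide _ (size H).+1 H) // -sumrB big_ord_recl !expr0 subrr add0r.
rewrite (@horner_coef_wide _ (size H)) ?size_poly // mulr_sumr.
apply: eq_bigr => j _; rewrite coef_odd_quot lift0 exprNn -signr_odd /=.
case: (odd j) => /=; first by rewrite expr0 mul1r subrr mul0r mulr0.
by rewrite expr1 exprS; ring.
Qed.

Lemma odd_quot_even H s : (odd_quot H).[- s] = (odd_quot H).[s].
Proof.
rewrite !horner_coef; apply: eq_bigr => j _; rewrite coef_odd_quot exprNn -signr_odd.
by case: (odd j); rewrite ?mul0r // expr0 mul1r.
Qed.

(** Each stage multiplies by a shift of [Q] and divides by $2s$, so [m] stages have degree $m(\deg
    Q-1)$; this is the degree that type B requires. The center [k] and the argument both move by
    [h], so that the values of [Q] that occur are spaced by [2 * h]. *)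
Fixpoint div_diff h Q (m : nat) k : {poly A} :=
  if m is m'.+1 then
    odd_quot ((Q \Po ('X + k%:P)) * (div_diff h Q m' (k + h) \Po ('X + h%:P)))
  else 1.

Lemma div_diffS h Q m k s : 2 * s * (div_diff h Q m.+1 k).[s] =
  Q.[s + k] * (div_diff h Q m (k + h)).[s + h] -
  Q.[- s + k] * (div_diff h Q m (k + h)).[- s + h].
Proof. by rewrite /= -odd_quot_horner !hornerM !horner_comp !hornerE. Qed.

Lemma div_diff_even h Q m k s : (div_diff h Q m k).[- s] = (div_diff h Q m k).[s].
Proof. by case: m => [|m] /=; rewrite ?hornerE // odd_quot_even. Qed.

End DividedDifferences.

Lemma map_odd_quot (A B : comNzRingType) (f : {rmorphism A -> B}) (H : {poly A}) :
  map_poly f (odd_quot H) = odd_quot (map_poly f H).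
Proof.
apply/polyP => j; rewrite coef_map !coef_odd_quot coef_map /=.
by case: ifP => // _; rewrite rmorph0.
Qed.

Lemma map_div_diff (A B : comNzRingType) (f : {rmorphism A -> B}) h (Q : {poly A}) m k :
  map_poly f (div_diff h Q m k) = div_diff (f h) (map_poly f Q) m (f k).
Proof.
elim: m k => [|m IH] k /=; first by rewrite rmorph1.
by rewrite map_odd_quot rmorphM /= !map_comp_poly !rmorphD /= !map_polyX !map_polyC IH rmorphD.
Qed.

(* At a point where no denominator vanishes, the divided difference is a
   combination of products of [m] values of [Q], one for each [b <= m]. *)
Lemma div_diff_eq0 (A : idomainType) (h : A) (Q : {poly A}) m k s :
  2 != 0 :> A -> (forall j : int, s + j%:~R * h != 0) ->
  (forall b, (b <= m)%N ->
     (exists2 i, (i < b)%N & Q.[s + k + i%:R * (2 * h)] = 0) \/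
     (exists2 i, (i < m - b)%N & Q.[- s + k + i%:R * (2 * h)] = 0)) ->
  (div_diff h Q m k).[s] = 0.
Proof.
move=> nz2; elim: m k s => [|m IH] k s nz window.
  by have [[i]|[i]] := window 0%N isT.
have s0 : s != 0 by have := nz 0; rewrite mul0r addr0.
apply: (mulfI (mulf_neq0 nz2 s0)); rewrite mulr0 div_diffS.
have eS i : (i.+1)%:R * (2 * h) = h + h + i%:R * (2 * h) by rewrite -natr1; ring.
have -> : Q.[s + k] * (div_diff h Q m (k + h)).[s + h] = 0.
  have [->|Qs] := eqVneq Q.[s + k] 0; first by rewrite mul0r.
  rewrite IH ?mulr0 // => [j|b bm].
    by have := nz (j + 1); rewrite intrD mulrDl mul1r addrCA addrC.
  (* The factor at [s + k] is one more of the values on the side of [s], hence [b.+1]; it is not the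
     vanishing one, so the index can be lowered. *)
  have [[[|i] ib Qi]|[i ib Qi]] := window b.+1 bm.
  - by case/eqP: Qs; rewrite -Qi mul0r addr0.
  - by left; exists i => //; rewrite -Qi eS; congr (_.[_]); ring.
  - by right; exists i => //; rewrite -Qi; congr (_.[_]); ring.
have [->|Qs] := eqVneq Q.[- s + k] 0; first by rewrite mul0r subr0.
rewrite IH ?mulr0 ?subr0 // => [j|b bm].
  have := nz (- j - 1); rewrite -oppr_eq0 => ne.
  suff -> : - s + h + j%:~R * h = - (s + (- j - 1)%:~R * h) by [].
  by rewrite intrD !mulrNz; ring.
(* In the second term [s] is replaced by [- s], which exchanges the roles of [b] and [m - b]. *)
have [[i ib Qi]|[[|i] ib Qi]] := window (m - b)%N (leq_trans (leq_subr _ _) (leqnSn _)).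
- by right; exists i => //; rewrite -Qi; congr (_.[_]); ring.
- by case/eqP: Qs; rewrite -Qi mul0r addr0.
- left; exists i; first by move: ib; lia.
  by rewrite -Qi eS; congr (_.[_]); ring.
Qed.

Section Weight.
Variables (K : numFieldType).

(* Moving [y] and [y'] along a common indeterminate keeps their difference and
   makes the point generic. *)
Lemma div_diff_pair (z : K) (Q1 : {poly K}) y y' m c v :
  y = y' + c%:R * z -> (v < c <= m)%N ->
  (div_diff (z / 2) (('X - y%:P) * ('X + y'%:P) * Q1) m (z / 2)).[y' + v%:R * z + z / 2] = 0.
Proof.
move=> yy' /andP[vc cm]; set h := z / 2.
have hz : h + h = z by rewrite /h -splitr.
pose Qe : {poly {poly K}} :=
  ('X - (y%:P + 'X)%:P) * ('X + (y'%:P + 'X)%:P) * map_poly polyC Q1.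
pose se : {poly K} := (y' + v%:R * z + h)%:P + 'X.
have fe : map_poly (horner_eval 0) Qe = ('X - y%:P) * ('X + y'%:P) * Q1.
  have fQ1 : map_poly (horner_eval 0) (map_poly polyC Q1) = Q1.
    rewrite -map_poly_comp map_poly_id // => x _ /=.
    by rewrite /horner_eval hornerC.
  rewrite /Qe !rmorphM /= map_polyXsubC map_polyXaddC /= fQ1.
  by rewrite /horner_eval !hornerE.
have hE : h = horner_eval 0 h%:P by rewrite /horner_eval hornerC.
have sE : y' + v%:R * z + h = horner_eval 0 se by rewrite /horner_eval !hornerE.
rewrite -fe {1 2}hE sE -map_div_diff horner_map /=.
rewrite div_diff_eq0 ?rmorph0 // => [|j|b bm].
- by rewrite -polyC_natr polyC_eq0 pnatr_eq0.
- rewrite /se; suff -> : (y' + v%:R * z + h)%:P + 'X + j%:~R * h%:P =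
    'X + (y' + v%:R * z + h + j%:~R * h)%:P by rewrite -size_poly_eq0 size_XaddC.
  by rewrite [in RHS]polyCD [(j%:~R * h)%:P]polyCM rmorph_int addrA [_ + 'X]addrC.
have hA (x e : {poly K}) : ('X + e%:P).[x] = x + e by rewrite hornerD hornerX hornerC.
have rootl : Qe.[y%:P + 'X] = 0 by rewrite /Qe !hornerE subrr !mul0r.
have rootr : Qe.[- (y'%:P + 'X)] = 0
  by rewrite /Qe 2!hornerM hA addNr mulr0 mul0r.
(* Of the [b] values on the side of $s$, the one with index $c-v-1$ is taken at $y$. If there are
   too few of them, then $v<m-b$, and the value with index $v$ on the side of $-s$ is taken at
   $-y'$. *)
have [cb|cb] := leqP c (v + b).
  left; exists (c - v).-1; first by lia.
  rewrite -rootl; congr (_.[_]); rewrite /se yy'.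
  have -> : c%:R = v%:R + 1 + (c - v).-1%:R :> K.
    by rewrite natr1 -natrD; congr _%:R; lia.
  rewrite -hz !(polyCD, polyCM, polyC_natr, polyC1); ring.
right; exists v; first by lia.
rewrite -rootr; congr (_.[_]); rewrite /se -hz !(polyCD, polyCM, polyC_natr); ring.
Qed.

End Weight.

(** * Sign of the divided difference in a gap *)

Section WeightSign.
Variables (K : realFieldType) (Q : {poly K}) (a b sg : K).
Hypothesis (Qodd : forall x, Q.[- x] = - Q.[x]).
Hypothesis (a0 : 0 <= a) (Qa : Q.[a] = 0) (Qb : Q.[b] = 0).
Hypothesis (Qge0 : forall x, a <= x <= b -> 0 <= sg * Q.[x]).
Hypothesis (Qgt0 : forall x, a < x < b -> 0 < sg * Q.[x]).
Local Notation h := (1 / 2 : K).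
Local Notation G := (div_diff h Q).

(** Since [Q] is odd and the divided differences are even, the difference turns into a sum, whose
    two terms have the same sign as long as [Q] keeps its sign. *)
Lemma div_diffS_odd m k s : 2 * s * (sg ^+ m.+1 * (G m.+1 k).[s]) =
  (sg * Q.[s + k]) * (sg ^+ m * (G m (k + h)).[s + h]) +
  (sg * Q.[s - k]) * (sg ^+ m * (G m (k + h)).[s - h]).
Proof.
have -> : 2 * s * (sg ^+ m.+1 * (G m.+1 k).[s]) =
  sg ^+ m.+1 * (2 * s * (G m.+1 k).[s]) by ring.
rewrite div_diffS.
have -> : - s + k = - (s - k) by ring.
have -> : - s + h = - (s - h) by ring.
rewrite Qodd div_diff_even exprS; ring.
Qed.

(** [N] and [N'] count the unit steps from [s + k] up to [b] and from [s - k] down to [a]. Each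
    stage uses up one of them, and when none is left the zero of [Q] at the end of the interval
    kills the term before the interval is left. *)
Lemma div_diff_ge0 m k s (N N' : nat) :
  0 < k -> s + k + N%:R = b -> s - k = a + N'%:R -> 0 <= sg ^+ m * (G m k).[s].
Proof.
elim: m k s N N' => [|m IH] k s N N' k0 eb ea.
  by rewrite expr0 mul1r /= hornerC ler01.
have N0 : 0 <= N%:R :> K by [].
have N'0 : 0 <= N'%:R :> K by [].
have s0 : 0 < 2 * s.
  by have := a0; lra.
rewrite -(pmulr_rge0 _ s0) div_diffS_odd; apply: addr_ge0.
  case: N eb N0 => [|N] eb N0.
    have -> : s + k = b by lra.
    by rewrite Qb mulr0 mul0r.
  apply: mulr_ge0; first by apply: Qge0; apply/andP; split; lra.
  by apply: (IH _ _ N N'); rewrite -?natr1 in eb; lra.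
case: N' ea N'0 => [|N'] ea N'0.
  have -> : s - k = a by lra.
  by rewrite Qa mulr0 mul0r.
apply: mulr_ge0; first by apply: Qge0; apply/andP; split; lra.
by apply: (IH _ _ N N'); rewrite -?natr1 in ea; lra.
Qed.

(** With [m <= N] the branch that always moves up evaluates [Q] strictly inside the interval, so it
    contributes a positive term. *)
Lemma div_diff_gt0 m k s (N N' : nat) : 0 < k -> s + k + N%:R = b ->
  s - k = a + N'%:R -> (m <= N)%N -> 0 < sg ^+ m * (G m k).[s].
Proof.
elim: m k s N N' => [|m IH] k s N N' k0 eb ea mN.
  by rewrite expr0 mul1r /= hornerC ltr01.
have N'0 : 0 <= N'%:R :> K by [].
have s0 : 0 < 2 * s.
  by have := a0; lra.
case: N mN eb => // N mN eb; have N0 : 0 <= N%:R :> K by [].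
rewrite -natr1 in eb.
rewrite -(pmulr_rgt0 _ s0) div_diffS_odd; apply: ltr_pwDl.
  apply: mulr_gt0; first by apply: Qgt0; apply/andP; split; lra.
  by apply: (IH _ _ N N') => //; lra.
case: N' ea N'0 => [|N'] ea N'0.
  have -> : s - k = a by lra.
  by rewrite Qa mulr0 mul0r.
apply: mulr_ge0; first by apply: Qge0; apply/andP; split; lra.
by apply: (div_diff_ge0 m (N := N.+1) (N' := N')); rewrite -?natr1 ?natr1 in ea *; lra.
Qed.

End WeightSign.

Section HomogeneousWeight.
Variables (K : numFieldType) (n : nat).

Lemma homog_odd_quot d (P : 'cV[K]_n -> {poly K}) :
  homog_poly d.+1 P -> homog_poly d (fun v => odd_quot (P v)).
Proof.
move=> hP; split=> [v|j jd].
  rewrite /odd_quot; apply/leq_sizeP => j dj; rewrite coef_odd_quot.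
  by case: ifP => // _; rewrite nth_default // (leq_trans (hP.1 v)).
have := homog_poly_coef (k := d - j) (j := j.+1) _ hP.
rewrite addSn subnKC // => /(_ erefl) hj.
have [oj|oj] := boolP (odd j).
  by apply: homog_fun_ext (homog_fun0 _ _ _) => v; rewrite coef_odd_quot oj.
by apply: homog_fun_ext hj => v; rewrite coef_odd_quot (negPf oj).
Qed.

Lemma homog_div_diff d (h k : 'cV[K]_n -> K) (Q : 'cV[K]_n -> {poly K}) m :
  homog_fun 1 h -> homog_fun 1 k -> homog_poly d.+1 Q ->
  homog_poly (d * m) (fun v => div_diff (h v) (Q v) m (k v)).
Proof.
move=> hh + hQ; elim: m k => [|m IH] k hk.
  by rewrite muln0; apply: homog_polyC (homog_funC _ 1).
apply: homog_odd_quot; rewrite mulnS -addSn; apply: homog_polyM.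
  exact: homog_poly_shift.
by apply: homog_poly_shift => //; apply: IH; apply: homog_funD.
Qed.

End HomogeneousWeight.

(** * The basic derivations *)

Lemma root_type_dec (T T' : root_type) : T = T' \/ T <> T'.
Proof. by case: T; case: T'; (by left) || (by right). Qed.

Section Components.
Variables (K : numFieldType) (T : root_type) (l m : nat).
Implicit Types (x : nat -> K) (z y : K).

Definition points_poly x : {poly K} :=
  match T with
  | TypeA => 'X * \prod_(i < l) ('X - (x i)%:P)
  | TypeB => 'X * \prod_(i < l) ('X^2 - (x i ^+ 2)%:P)
  | TypeC => \prod_(i < l) ('X^2 - (x i ^+ 2)%:P)
  end.

Definition weight x z : {poly K} :=
  if T is TypeB then div_diff (z / 2) (points_poly x) m (z / 2) \Po ('X + (z / 2)%:P)
  else \prod_(u < m) (points_poly x \Po ('X - (u%:R * z)%:P)).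

(** $(t+z/2)^2$ is invariant under $t\mapsto -z-t$, the map that sends the step from $t$ to $t+z$ to
    its negative. *)
Definition modulus z : {poly K} :=
  if T is TypeA then 'X else ('X + (z / 2)%:P) ^+ 2.

Definition partner y : K := if T is TypeA then 0 else - y.

Definition primitive x z (p : {poly K}) : {poly K} :=
  antidiff z (weight x z * (p \Po modulus z)).

Definition component x z p y : K :=
  (primitive x z p).[y] - (primitive x z p).[partner y].

(** The condition for the weight to vanish along a chain of at most [m] steps from [y'] up to [y].
    In type B the two factors must be available separately; for the pair $x_i$, $-x_i$ the factor
    $X-x_i$ would have to occur twice. *)
Definition linked x y y' : Prop :=
  if T is TypeB then
    exists Q1, points_poly x = ('X - y%:P) * ('X + y'%:P) * Q1
  else (points_poly x).[y'] = 0.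

Lemma weight_linked x z y y' c v : linked x y y' ->
  y = y' + c%:R * z -> (v < c <= m)%N -> (weight x z).[y' + v%:R * z] = 0.
Proof.
have gen : (points_poly x).[y'] = 0 -> (v < c <= m)%N ->
    (\prod_(u < m) (points_poly x \Po ('X - (u%:R * z)%:P))).[y' + v%:R * z] = 0.
  move=> h /andP[vc cm]; rewrite horner_prod.
  rewrite (bigD1 (Ordinal (leq_trans vc cm))) //= horner_comp hornerXsubC addrK.
  by rewrite h mul0r.
rewrite /linked /weight; case T => //; first by move=> h _; apply: gen.
  move=> [Q1 ->] e cm; rewrite horner_comp !hornerE.
  exact: div_diff_pair e cm.
by move=> h _; apply: gen.
Qed.

Lemma primitive_linked x z p y y' (c : int) : linked x y y' -> linked x y' y ->
  y - y' = c%:~R * z -> (`|c| <= m)%N ->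
  (primitive x z p).[y] = (primitive x z p).[y'].
Proof.
have gen y1 y2 (d : nat) : linked x y1 y2 -> y1 = y2 + d%:R * z -> (d <= m)%N ->
    (primitive x z p).[y1] = (primitive x z p).[y2].
  move=> lk e dm; rewrite {1}e; apply: antidiff_const => u ud.
  by rewrite hornerM (weight_linked lk e) ?mul0r // ud.
case: c => c l1 l2 e cm; first by apply: (gen _ _ c) => //; rewrite -e; ring.
apply/esym/(gen _ _ c.+1) => //; rewrite NegzE mulrNz mulNr in e.
by rewrite -[y](subrK y') e; ring.
Qed.

Lemma points_polyN x y : T <> TypeA ->
  (points_poly x).[- y] = (if T is TypeB then -1 else 1) * (points_poly x).[y].
Proof.
rewrite /points_poly; case T => // _; rewrite ?hornerM !horner_prod ?hornerX.
  rewrite mulN1r mulNr; congr (- (_ * _)); apply: eq_bigr => i _.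
  by rewrite !hornerE sqrrN.
by rewrite mul1r; apply: eq_bigr => i _; rewrite !hornerE sqrrN.
Qed.

Definition sgn_pt (s : bool) y := if s then - y else y.

Lemma points_poly_root x i s : (i < l)%N -> (T = TypeA -> s = false) ->
  (points_poly x).[sgn_pt s (x i)] = 0.
Proof.
move=> il; have [TA /(_ TA) ->|TA _] := root_type_dec T TypeA.
  rewrite /points_poly TA hornerM horner_prod (bigD1 (Ordinal il)) //=.
  by rewrite hornerXsubC subrr mul0r mulr0.
suff e : (points_poly x).[x i] = 0.
  by case: s => //=; rewrite points_polyN // e mulr0.
have e0 : ('X^2 - (x i ^+ 2)%:P).[x i] = 0 by rewrite !hornerE subrr.
have e : (\prod_(i < l) ('X^2 - (x i ^+ 2)%:P)).[x i] = 0.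
  by rewrite horner_prod (bigD1 (Ordinal il)) //= e0 mul0r.
by rewrite /points_poly; case: T TA => // _; rewrite ?hornerM e ?mulr0.
Qed.

Lemma sqr_factor x i s : 'X^2 - (x i ^+ 2)%:P =
  ('X - (sgn_pt s (x i))%:P) * ('X + (sgn_pt s (x i))%:P) :> {poly K}.
Proof.
have -> : x i ^+ 2 = sgn_pt s (x i) ^+ 2 by case: s; rewrite /= ?sqrrN.
by rewrite polyCM -expr2 subr_sqr.
Qed.

Lemma linked_pair x i j s t : (i < l)%N -> (j < l)%N ->
  (T = TypeA -> s = false /\ t = false) -> (T = TypeB -> i != j) ->
  linked x (sgn_pt s (x i)) (sgn_pt t (x j)).
Proof.
move=> il jl hA hB; have [TB|TB] := root_type_dec T TypeB.
  rewrite /linked /points_poly TB.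
  rewrite (bigD1 (Ordinal il)) //= (bigD1 (Ordinal jl)) /=; last first.
    by rewrite -val_eqE /= eq_sym hB.
  rewrite (sqr_factor x i s) (sqr_factor x j t); set P := \prod_(_ < l | _) _.
  exists ('X * ('X + (sgn_pt s (x i))%:P) * ('X - (sgn_pt t (x j))%:P) * P); ring.
have h : (points_poly x).[sgn_pt t (x j)] = 0.
  by apply: points_poly_root => // /hA[].
by rewrite /linked; move: TB h; case T.
Qed.

Lemma linked_zero x i s : (i < l)%N -> T <> TypeC -> (T = TypeA -> s = false) ->
  linked x (sgn_pt s (x i)) 0 /\ linked x 0 (sgn_pt s (x i)).
Proof.
move=> il TC hA; have [TB|TB] := root_type_dec T TypeB.
  rewrite /linked /points_poly TB (bigD1 (Ordinal il)) //= (sqr_factor x i s).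
  set P := \prod_(_ < l | _) _; split.
    by exists (('X + (sgn_pt s (x i))%:P) * P); rewrite polyC0; ring.
  by exists (('X - (sgn_pt s (x i))%:P) * P); rewrite polyC0; ring.
have TA : T = TypeA by move: TB TC; case T.
have h := points_poly_root x il hA.
rewrite /linked TA; split=> //.
by rewrite /points_poly TA hornerM hornerX mul0r.
Qed.

(** Tangency to $x_i-x_j=cz$. Outside type A the partners $-x_i$ and $-x_j$ are linked too, with
    [- c] in place of [c]. *)
Lemma component_diff x z p i j (c : int) : (i < l)%N -> (j < l)%N -> i != j ->
  x i - x j = c%:~R * z -> (`|c| <= m)%N ->
  component x z p (x i) = component x z p (x j).
Proof.
move=> il jl ij e cm; rewrite /component.
have -> : (primitive x z p).[x i] = (primitive x z p).[x j].
  by apply: (primitive_linked _ _ _ e cm);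
    [apply: (@linked_pair x i j false false)|apply: (@linked_pair x j i false false)];
    rewrite // eq_sym.
congr (_ - _); rewrite /partner.
have [TA|TA] := root_type_dec T TypeA.
  by rewrite TA.
have -> : match T with TypeA => 0 | _ => - x i end = - x i by move: TA; case T.
have -> : match T with TypeA => 0 | _ => - x j end = - x j by move: TA; case T.
have cm' : (`|- c| <= m)%N by rewrite abszN.
apply: (primitive_linked _ _ _ _ cm').
- by apply: (@linked_pair x i j true true).
- by apply: (@linked_pair x j i true true); rewrite // eq_sym.
- by rewrite mulrNz mulNr -e; ring.
Qed.

Lemma component_sum x z p i j (c : int) : T <> TypeA ->
  (i < l)%N -> (j < l)%N -> i != j ->
  x i + x j = c%:~R * z -> (`|c| <= m)%N ->
  component x z p (x i) + component x z p (x j) = 0.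
Proof.
move=> TA il jl ij e cm; rewrite /component.
have pE y : partner y = - y by rewrite /partner; move: TA; case T.
rewrite !pE.
have -> : (primitive x z p).[x i] = (primitive x z p).[- x j].
  apply: (primitive_linked _ _ _ _ cm); last by rewrite opprK.
    by apply: (@linked_pair x i j false true).
  by apply: (@linked_pair x j i true false); rewrite // eq_sym.
have -> : (primitive x z p).[x j] = (primitive x z p).[- x i].
  apply: (primitive_linked _ _ _ _ cm); last by rewrite opprK addrC.
    by apply: (@linked_pair x j i false true); rewrite // eq_sym.
  by apply: (@linked_pair x i j true false).
ring.
Qed.

(** In type C the root $2x_i$ compares $x_i$ with $-x_i$ directly. In types A and B the comparison
    is with $0$, which in type B is made from both $x_i$ and $-x_i$. *)
Lemma component_root x z p i (c : int) : (i < l)%N ->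
  (if T is TypeC then 2 else 1) * x i = c%:~R * z -> (`|c| <= m)%N ->
  component x z p (x i) = 0.
Proof.
move=> il e cm; rewrite /component.
have [TC|TC] := root_type_dec T TypeC.
  rewrite TC in e; rewrite /partner TC.
  apply/eqP; rewrite subr_eq0; apply/eqP/(primitive_linked _ _ _ _ cm).
  - by apply: (@linked_pair x i i false true); rewrite // TC.
  - by apply: (@linked_pair x i i true false); rewrite // TC.
  - by rewrite -e; ring.
have {}e : x i = c%:~R * z by rewrite -e; move: TC; case T; rewrite // mul1r.
have -> : (primitive x z p).[x i] = (primitive x z p).[0].
  have [l1 l2] := @linked_zero x i false il TC (fun _ => erefl).
  by apply: (primitive_linked _ l1 l2 _ cm); rewrite subr0.
have [TA|TA] := root_type_dec T TypeA; first by rewrite /partner TA subrr.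
have [l1 l2] := @linked_zero x i true il TC (fun h => False_ind _ (TA h)).
have -> : partner (x i) = - x i by rewrite /partner; move: TA; case T.
suff -> : (primitive x z p).[- x i] = (primitive x z p).[0] by rewrite subrr.
apply: (primitive_linked _ l1 l2 _ (c := - c)); last by rewrite abszN.
by rewrite /= subr0 mulrNz mulNr -e.
Qed.

(** A linear relation among the fields becomes the vanishing of the components of one polynomial of
    degree [< k]. *)
Lemma component_linear x z k (lam : nat -> K) y :
  component x z (\poly_(r < k) lam r) y =
  \sum_(r < k) lam r * component x z 'X^r y.
Proof.
rewrite /component.
have -> : primitive x z (\poly_(r < k) lam r) =
    \sum_(r < k) lam r *: primitive x z 'X^r.
  rewrite /primitive poly_def raddf_sum mulr_sumr antidiff_sum.
  by apply: eq_bigr => r _; rewrite /= comp_polyZ -scalerAr antidiffZ.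
rewrite !horner_sum -sumrB; apply: eq_bigr => r _.
by rewrite !hornerZ mulrBr.
Qed.

End Components.

(** The numbers $mh+e$: $h=l+1$ and $e=1,\dots,l$ in type A, $h=2l$ and $e=1,3,\dots,2l-1$ in types
    B and C. *)
Definition exponent (T : root_type) (l m r : nat) : nat :=
  if T is TypeA then (m * l.+1 + r).+1 else (2 * (m * l + r)).+1.

Section HomogeneousComponents.
Variables (K : numFieldType) (T : root_type) (l m n : nat).
Variables (x : nat -> 'cV[K]_n -> K) (z : 'cV[K]_n -> K).
Hypotheses (hx : forall i, homog_fun 1 (x i)) (hz : homog_fun 1 z).
Local Notation xs v := (fun i => x i v).

Lemma homog_const_mul (c : K) d (f : 'cV[K]_n -> K) : homog_fun d f ->
  homog_fun d (fun v => f v * c).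
Proof. by move/(homog_funZ c); apply: homog_fun_ext => v; rewrite mulrC. Qed.

Lemma homog_points_poly :
  homog_poly (match T with TypeA => l.+1 | TypeB => (2 * l).+1 | TypeC => 2 * l end)
    (fun v => points_poly T l (xs v)).
Proof.
have sz : size (index_enum 'I_l) = l by rewrite -sum1_size sum1_card card_ord.
have hsq : homog_poly (2 * l) (fun v => \prod_(i < l) ('X^2 - (x i v ^+ 2)%:P)).
  rewrite -[X in (2 * X)%N]sz; apply: homog_poly_prod => i.
  apply: homog_polyD; first exact: homog_polyXn.
  apply: homog_polyN; apply: homog_polyC; exact: (homog_funX 2 (hx i)).
rewrite /points_poly; case: T => //; last first.
  by rewrite -addn1 addnC; apply: homog_polyM => //; exact: homog_polyX.
rewrite -addn1 addnC; apply: homog_polyM; first exact: homog_polyX.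
rewrite -[X in homog_poly X]mul1n -[X in (1 * X)%N]sz; apply: homog_poly_prod => i.
by apply: homog_polyD; [exact: homog_polyX | apply: homog_polyN; apply: homog_polyC].
Qed.

Lemma homog_weight :
  homog_poly (if T is TypeA then m * l.+1 else 2 * (m * l))%N
    (fun v => weight T l m (xs v) (z v)).
Proof.
have hQ := homog_points_poly.
have hh : homog_fun 1 (fun v => z v / 2) by apply: homog_const_mul.
have gen d : homog_poly d (fun v => points_poly T l (xs v)) -> homog_poly (d * m)
    (fun v => \prod_(u < m) (points_poly T l (xs v) \Po ('X - (u%:R * z v)%:P))).
  move=> hd; have sz : size (index_enum 'I_m) = m by rewrite -sum1_size sum1_card card_ord.
  rewrite -[X in (d * X)%N]sz; apply: homog_poly_prod => u.
  apply: homog_poly_comp => //; apply: homog_polyD; first exact: homog_polyX.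
  by apply: homog_polyN; apply: homog_polyC; apply: homog_funZ.
move: hQ gen; rewrite /weight; case: T => hQ gen.
- by rewrite mulnC; apply: gen.
- rewrite mulnCA mulnC; apply: homog_poly_shift => //.
  exact: homog_div_diff.
- by rewrite mulnCA mulnC; apply: gen.
Qed.

Lemma homog_component (y : 'cV[K]_n -> K) r : homog_fun 1 y ->
  homog_fun (exponent T l m r) (fun v => component T l m (xs v) (z v) 'X^r (y v)).
Proof.
move=> hy.
have hp : homog_poly (exponent T l m r) (fun v => primitive T l m (xs v) (z v) 'X^r).
  have hh : homog_fun 1 (fun v => z v / 2) by apply: homog_const_mul.
  have := homog_weight; rewrite /primitive /exponent /modulus; case: T => hW;
    apply: homog_antidiff => //.
  - apply: homog_polyM => //.
    by apply: homog_poly_ext (homog_polyXn _ _ r) => v; rewrite comp_polyXr.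
  - rewrite mulnDr; apply: homog_polyM => //.
    apply: homog_poly_ext (homog_polyE r (homog_polyE 2
      (homog_polyD (homog_polyX _ _) (homog_polyC hh)))) => v.
    by rewrite comp_Xn_poly.
  - rewrite mulnDr; apply: homog_polyM => //.
    apply: homog_poly_ext (homog_polyE r (homog_polyE 2
      (homog_polyD (homog_polyX _ _) (homog_polyC hh)))) => v.
    by rewrite comp_Xn_poly.
apply: homog_funD; first exact: homog_poly_horner.
apply: homog_funN; apply: homog_poly_horner => //; rewrite /partner.
by case: T; [exact: homog_fun0 | exact: homog_funN | exact: homog_funN].
Qed.

End HomogeneousComponents.

(** * Sign changes between consecutive coordinates *)

Section Signs.
Variable R : rcfType.
Implicit Types (Q p : {poly R}) (a b c s : R).

Definition sgn_on a b s Q : Prop :=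
  (forall x, a <= x <= b -> 0 <= s * Q.[x]) /\ (forall x, a < x < b -> 0 < s * Q.[x]).

Lemma sgn_onM a b s s' Q Q' :
  sgn_on a b s Q -> sgn_on a b s' Q' -> sgn_on a b (s * s') (Q * Q').
Proof.
move=> [h1 h2] [h1' h2']; split=> x hx; rewrite hornerM mulrACA.
  by apply: mulr_ge0; [apply: h1|apply: h1'].
by apply: mulr_gt0; [apply: h2|apply: h2'].
Qed.

Lemma sgn_on_prod a b (l : nat) (F : nat -> {poly R}) :
  (forall i, (i < l)%N -> exists s, sgn_on a b s (F i)) ->
  exists s, sgn_on a b s (\prod_(i < l) F i).
Proof.
elim: l => [|l IH] h.
  by exists 1; split=> x _; rewrite big_ord0 hornerC mul1r.
have [i il|s hs] := IH; first by apply: h; rewrite ltnW.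
have [s' hs'] := h l (leqnn _).
by exists (s * s'); rewrite big_ord_recr /=; apply: sgn_onM.
Qed.

(** The second alternative is the symmetric gap around $0$, available in type C because the factor
    ['X] is absent there. *)
Lemma sgn_on_points T l (x : nat -> R) a b :
  (forall i, (i < l)%N -> 0 <= x i) ->
  (0 <= a /\ (forall i, (i < l)%N -> x i <= a \/ b <= x i)) \/
  (T = TypeC /\ a = - b /\ 0 <= b /\ (forall i, (i < l)%N -> b <= x i)) ->
  exists s, sgn_on a b s (points_poly T l x).
Proof.
move=> x0 [[a0 hx]|[-> [-> [b0 hx]]]]; last first.
  apply: (@sgn_on_prod _ _ l (fun i => 'X^2 - (x i ^+ 2)%:P)) => i il.
  have xb := hx i il; exists (-1); split=> y /andP[y1 y2]; rewrite !hornerE /=; nra.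
have hX : sgn_on a b 1 'X.
  by split=> y /andP[y1 y2]; rewrite hornerX mul1r; lra.
have hlin : exists s, sgn_on a b s (\prod_(i < l) ('X - (x i)%:P)).
  apply: (@sgn_on_prod _ _ l (fun i => 'X - (x i)%:P)) => i il.
  have [xa|xb] := hx i il; [exists 1|exists (-1)];
    by split=> y /andP[y1 y2]; rewrite !hornerE /=; lra.
have hsq : exists s, sgn_on a b s (\prod_(i < l) ('X^2 - (x i ^+ 2)%:P)).
  apply: (@sgn_on_prod _ _ l (fun i => 'X^2 - (x i ^+ 2)%:P)) => i il.
  have xi0 := x0 i il.
  have [xa|xb] := hx i il; [exists 1|exists (-1)];
    by split=> y /andP[y1 y2]; rewrite !hornerE /=; nra.
rewrite /points_poly; case: T.
- by have [s hs] := hlin; exists (1 * s); apply: sgn_onM.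
- by have [s hs] := hsq; exists (1 * s); apply: sgn_onM.
- exact: hsq.
Qed.

(** Shifts beyond the lower end do no harm: for [v < m] the product contains the value at [a], so
    either this is zero, or the sign is known [m] further down. *)
Lemma prod_window_ge0 Q a a' s m v : sgn_on a' (a + m%:R + 1) s Q -> a' <= a ->
  (a' = a /\ Q.[a] = 0) \/ a' + m%:R <= a -> (v <= m)%N ->
  0 <= s ^+ m * \prod_(u < m) Q.[a + v%:R - u%:R].
Proof.
move=> [h1 h2] a'a lo vm.
have gen : (forall u : 'I_m, a' <= a + v%:R - u%:R) ->
    0 <= s ^+ m * \prod_(u < m) Q.[a + v%:R - u%:R].
  move=> hu; rewrite -[X in s ^+ X](card_ord m) -prodr_const -big_split /=.
  apply: prodr_ge0 => u _; apply: h1; rewrite hu /=.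
  have : 0 <= u%:R :> R by [].
  have : v%:R <= m%:R :> R by rewrite ler_nat.
  lra.
case: lo => [[e Qa]|lo]; last first.
  apply: gen => u; have : u%:R <= m%:R :> R by rewrite ler_nat ltnW.
  have : 0 <= v%:R :> R by [].
  lra.
have [mv|vm'] := leqP m v.
  apply: gen => u; rewrite e; have : u%:R <= v%:R :> R by rewrite ler_nat (leq_trans (ltnW (ltn_ord u))).
  lra.
by rewrite (bigD1 (Ordinal vm')) //= addrK Qa mul0r mulr0.
Qed.

Lemma prod_window_gt0 Q a s m : sgn_on a (a + m%:R + 1) s Q ->
  0 < s ^+ m * \prod_(u < m) Q.[a + m%:R - u%:R].
Proof.
move=> [h1 h2]; rewrite -[X in s ^+ X](card_ord m) -prodr_const -big_split /=.
apply: prodr_gt0 => u _; apply: h2; apply/andP.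
have : u%:R + 1 <= m%:R :> R by rewrite natr1 ler_nat.
have : 0 <= u%:R :> R by [].
by move=> *; split; lra.
Qed.

(** The same for the reflected weight, whose shifts go up: for [v > 0] the factor with [u = m - v]
    sits at the root [a + m + 1]. *)
Lemma prod_window_up_ge0 Q a s m v : sgn_on a (a + m%:R + 1) s Q ->
  Q.[a + m%:R + 1] = 0 -> (v <= m)%N ->
  0 <= s ^+ m * \prod_(u < m) Q.[a + v%:R + 1 + u%:R].
Proof.
move=> [h1 h2] Qb vm.
have [v0|v0] := posnP v.
  rewrite -[X in s ^+ X](card_ord m) -prodr_const -big_split /=.
  apply: prodr_ge0 => u _; apply: h1; apply/andP; rewrite v0.
  have : u%:R <= m%:R :> R by rewrite ler_nat ltnW.
  have : 0 <= u%:R :> R by [].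
  by move=> *; split; lra.
have mv : (m - v < m)%N by lia.
rewrite (bigD1 (Ordinal mv)) //= (_ : a + v%:R + 1 + (m - v)%:R = a + m%:R + 1).
  by rewrite Qb mul0r mulr0.
by rewrite natrB //; ring.
Qed.

(** With nonnegative weights, not all zero, the sum cannot vanish if [q] has one strict sign at all
    sample points; the intermediate value theorem does the rest. *)
Lemma weighted_sum_root q c N (w : nat -> R) :
  (forall u, (u < N)%N -> 0 <= w u) -> (exists2 u, (u < N)%N & 0 < w u) ->
  \sum_(u < N) q.[c + u%:R] * w u = 0 ->
  exists2 t, c <= t <= c + N.-1%:R & root q t.
Proof.
move=> w0 [u0 u0N wu0] sum0.
have ivt (u u' : 'I_N) : q.[c + u%:R] <= 0 -> 0 <= q.[c + u'%:R] ->
    exists2 t, c <= t <= c + N.-1%:R & root q t.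
  have bd (k : 'I_N) : 0 <= (k%:R : R) <= N.-1%:R.
    by rewrite ler0n ler_nat; have := ltn_ord k; lia.
  have /andP[b1 b2] := bd u; have /andP[b1' b2'] := bd u'.
  move=> h h'; have [uu'|uu'] := lerP (u%:R : R) u'%:R.
    have [||t /andP[t1 t2] rt] := @poly_ivt _ q (c + u%:R) (c + u'%:R); first by lra.
      by rewrite h h'.
    by exists t => //; apply/andP; split; lra.
  have [||t /andP[t1 t2] rt] := @poly_ivt _ (- q) (c + u'%:R) (c + u%:R); first by lra.
    by rewrite !hornerN; apply/andP; split; lra.
  by exists t; [apply/andP; split; lra | rewrite -rootN].
have [/existsP[u hu]|/existsPn hpos] := boolP [exists u : 'I_N, q.[c + u%:R] <= 0].
  have [/existsP[u' hu']|/existsPn hneg] := boolP [exists u : 'I_N, 0 <= q.[c + u%:R]].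
    exact: ivt hu hu'.
  suff : 0 < \sum_(u < N) - (q.[c + u%:R] * w u) by rewrite sumrN sum0 oppr0 ltxx.
  rewrite (bigD1 (Ordinal u0N)) //=; apply: ltr_pwDl.
    have := hneg (Ordinal u0N); rewrite -ltNge /= => h; nra.
  apply: sumr_ge0 => u' _; have := hneg u'; rewrite -ltNge => h.
  have := w0 u' (ltn_ord u'); nra.
suff : 0 < \sum_(u < N) (q.[c + u%:R] * w u) by rewrite sum0 ltxx.
rewrite (bigD1 (Ordinal u0N)) //=; apply: ltr_pwDl.
  have := hpos (Ordinal u0N); rewrite -ltNge /= => h; nra.
apply: sumr_ge0 => u' _; have := hpos u'; rewrite -ltNge => h.
have := w0 u' (ltn_ord u'); nra.
Qed.

End Signs.

(** * Independence *)

Section Independence.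
Variables (R : rcfType) (T : root_type) (l m : nat) (x : nat -> R).
Local Notation Q := (points_poly T l x).
Local Notation W := (weight T l m x 1).

(** Outside type A a component adds the steps of the antidifference near [t] and near [-1 - t]. The
    modulus takes the same value at both, so the two weights can be added first. *)
Definition sym_weight (t : R) : R :=
  if T is TypeA then W.[t] else W.[t] + W.[- 1 - t].

Lemma component_step p c :
  component T l m x 1 p (c + m.+1%:R) - component T l m x 1 p c =
  \sum_(u < m.+1) (p \Po modulus T 1).[c + u%:R] * sym_weight (c + u%:R).
Proof.
set g := W * (p \Po modulus T 1).
have gE t : g.[t] = (p \Po modulus T 1).[t] * W.[t] by rewrite hornerM mulrC.
have up t : (antidiff 1 g).[t + m.+1%:R] - (antidiff 1 g).[t] =
    \sum_(u < m.+1) g.[t + u%:R].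
  have := antidiff_sum_diff 1 g t m.+1; rewrite mulr1 mul1r => ->.
  by apply: eq_bigr => u _; rewrite mulr1.
have -> : component T l m x 1 p (c + m.+1%:R) - component T l m x 1 p c =
    ((antidiff 1 g).[c + m.+1%:R] - (antidiff 1 g).[c]) +
    ((antidiff 1 g).[partner T c] - (antidiff 1 g).[partner T (c + m.+1%:R)]).
  by rewrite /component /primitive -/g; ring.
rewrite up; have [TA|TA] := root_type_dec T TypeA.
  rewrite /partner /sym_weight TA subrr addr0; apply: eq_bigr => u _.
  by rewrite gE TA.
have pE y : partner T y = - y by rewrite /partner; move: TA; case: (T).
have sE t : sym_weight t = W.[t] + W.[- 1 - t].
  by rewrite /sym_weight; move: TA; case: (T).
have mE t : (p \Po modulus T 1).[- 1 - t] = (p \Po modulus T 1).[t].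
  rewrite !horner_comp; congr (_.[_]).
  have -> : modulus T 1 = ('X + (1 / 2)%:P) ^+ 2 :> {poly R}.
    by rewrite /modulus; move: TA; case: (T).
  by rewrite !hornerE /=; field.
rewrite !pE; have -> : - c = - (c + m.+1%:R) + m.+1%:R by ring.
rewrite up (reindex_inj rev_ord_inj) /= -big_split /=.
rewrite (reindex_inj rev_ord_inj) /=; apply: eq_bigr => u _.
have um : (u <= m)%N by rewrite -ltnS.
rewrite !subSS subKn // gE gE sE mulrDr.
have -> : - (c + m.+1%:R) + (m - u)%:R = - 1 - (c + u%:R).
  by rewrite natrB // -natr1; ring.
by rewrite mE.
Qed.

(** No coordinate lies strictly inside the gap of length [m + 1]. The exceptional case is the lowest
    gap in type C when no coordinate is fixed, where [0] is not a root of [Q]. *)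
Lemma sym_weight_sign a : 0 <= a ->
  (forall i, (i < l)%N -> 0 <= x i) ->
  (forall i, (i < l)%N -> x i <= a \/ a + m%:R + 1 <= x i) ->
  Q.[a + m%:R + 1] = 0 ->
  Q.[a] = 0 \/ (T = TypeC /\ a = 0 /\ forall i, (i < l)%N -> m%:R + 1 <= x i) ->
  exists s, (forall v, (v <= m)%N -> 0 <= s * sym_weight (a + v%:R)) /\
    (exists2 v, (v <= m)%N & 0 < s * sym_weight (a + v%:R)).
Proof.
move=> a0 x0 hx Qb Qa; have m0 : 0 <= m%:R :> R by [].
have hs0 : exists s, sgn_on a (a + m%:R + 1) s Q /\ exists a',
    [/\ sgn_on a' (a + m%:R + 1) s Q, a' <= a & (a' = a /\ Q.[a] = 0) \/ a' + m%:R <= a].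
  have [Qa0|[TC [a_0 hx']]] := Qa.
    have [|s hs] := @sgn_on_points _ T l x a (a + m%:R + 1) x0; first by left.
    by exists s; split=> //; exists a; split=> //; left.
  (* The mirror image of the gap is added, which leaves room for the [m] downward shifts of the
     weight. *)
  have [|s hs] := @sgn_on_points _ T l x (- (a + m%:R + 1)) (a + m%:R + 1) x0.
    right; split=> //; split=> //; split; first by lra.
    by move=> i il; rewrite a_0 add0r; apply: hx'.
  exists s; split; last first.
    by exists (- (a + m%:R + 1)); split=> //; [lra|right; lra].
  by case: hs => h1 h2; split=> y /andP[y1 y2]; [apply: h1|apply: h2]; apply/andP; split; lra.
have [s [hs [a' [hs' a'a lo]]]] := hs0.
exists (s ^+ m); have [TB|TB] := root_type_dec T TypeB.
  have Q0 : Q.[a] = 0 by case: Qa => // -[]; rewrite TB.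
  have Qodd y : Q.[- y] = - Q.[y] by rewrite points_polyN TB //= mulN1r.
  have WE t : W.[t] = (div_diff (1 / 2) Q m (1 / 2)).[t + 1 / 2].
    by rewrite /weight TB horner_comp !hornerE.
  have sE t : sym_weight t = 2 * (div_diff (1 / 2) Q m (1 / 2)).[t + 1 / 2].
    rewrite /sym_weight TB -TB !WE (_ : - 1 - t + 1 / 2 = - (t + 1 / 2)); last by field.
    by rewrite div_diff_even; ring.
  have [h1 h2] := hs.
  have half0 : 0 < 1 / 2 :> R by lra.
  split=> [v vm|].
    rewrite sE mulrCA mulr_ge0 //.
    apply: (div_diff_ge0 Qodd a0 Q0 Qb h1 m (N := m - v) (N' := v)) => //.
      by rewrite natrB //; field.
    by field.
  (* At the lower end all [m] unit steps towards the upper end are still available, as strict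
     positivity requires. *)
  exists 0%N => //; rewrite sE mulrCA mulr_gt0 // addr0.
  by apply: (div_diff_gt0 Qodd a0 Q0 Qb h1 h2 (N := m) (N' := 0)) => //; field.
have WE t : W.[t] = \prod_(u < m) Q.[t - u%:R].
  have -> : W = \prod_(u < m) (Q \Po ('X - (u%:R * 1)%:P)).
    by rewrite /weight; move: TB; case: (T).
  by rewrite horner_prod; apply: eq_bigr => u _; rewrite mulr1 horner_comp hornerXsubC.
have W1 v : (v <= m)%N -> 0 <= s ^+ m * W.[a + v%:R].
  by move=> vm; rewrite WE; apply: (prod_window_ge0 hs').
have W1m : 0 < s ^+ m * W.[a + m%:R] by rewrite WE; apply: prod_window_gt0.
have [TA|TA] := root_type_dec T TypeA.
  by rewrite /sym_weight TA -TA; split; last exists m.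
have TC : T = TypeC by move: TA TB; case: (T).
have W2 v : (v <= m)%N -> 0 <= s ^+ m * W.[- 1 - (a + v%:R)].
  move=> vm; rewrite WE (eq_bigr (fun u : 'I_m => Q.[a + v%:R + 1 + u%:R])).
    exact: prod_window_up_ge0.
  move=> u _; rewrite (_ : - 1 - (a + v%:R) - u%:R = - (a + v%:R + 1 + u%:R)).
    by rewrite points_polyN // TC mul1r.
  by ring.
rewrite /sym_weight TC -TC; split=> [v vm|].
  by rewrite mulrDr addr_ge0 ?W1 ?W2.
by exists m => //; rewrite mulrDr ltr_pwDl ?W2.
Qed.

Lemma modulus_inj s t : 0 <= s -> s < t ->
  (modulus T 1 : {poly R}).[s] != (modulus T 1 : {poly R}).[t].
Proof.
move=> s0 st; rewrite /modulus; case: (T); rewrite !hornerE /= ?lt_eqF //; nra.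
Qed.

(** This is the situation on a flat with [k] free coordinates, which lie above the fixed ones. The
    start [b] of the lowest gap must also be a zero of all components: it is the largest fixed
    coordinate, or $0$ if none is fixed. *)
Lemma component_independent k b (lam : nat -> R) : (k <= l)%N -> 0 <= b ->
  (forall i, (i < k)%N -> x i = b + (k - i)%:R * m.+1%:R) ->
  (forall i, (k <= i < l)%N -> 0 <= x i <= b) ->
  (exists2 i, (k <= i < l)%N & x i = b) \/ (b = 0 /\ k = l) ->
  (forall r, (r < k)%N -> component T l m x 1 'X^r b = 0) ->
  (forall i, (i < k)%N -> \sum_(r < k) lam r * component T l m x 1 'X^r (x i) = 0) ->
  forall r, (r < k)%N -> lam r = 0.
Proof.
move=> kl b0 xtop xlow hb cb0 hlam.
pose p : {poly R} := \poly_(r < k) lam r.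
pose c i : R := b + i%:R * m.+1%:R.
have m0 : 0 <= m%:R :> R by [].
have cS i : c i.+1 = c i + m.+1%:R by rewrite /c -(natr1 i); ring.
have c_mono i j : (i <= j)%N -> c i <= c j.
  move=> ij; have : i%:R <= j%:R :> R by rewrite ler_nat.
  by rewrite /c lerD2l => h; rewrite ler_wpM2r.
have cb i : b <= c i by rewrite -[X in X <= _]addr0 lerD2l mulr_ge0.
have cx i : (0 < i <= k)%N -> x (k - i)%N = c i.
  by move=> /andP[i0 ik]; rewrite xtop ?subKn // ltn_subrL i0 (leq_trans i0).
have comp0 i : (i <= k)%N -> component T l m x 1 p (c i) = 0.
  rewrite component_linear; case: i => [_|i ik].
    by rewrite big1 // => r _; rewrite /c mul0r addr0 cb0 ?mulr0.
  by rewrite -cx ?ik // hlam // ltn_subrL /= (leq_trans _ ik).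
have x0 i : (i < l)%N -> 0 <= x i.
  move=> il; case: (ltnP i k) => ik; last first.
    by have /andP[] : 0 <= x i <= b by apply: xlow; rewrite ik.
  by rewrite xtop // addr_ge0 // mulr_ge0.
have Qx i : (i < l)%N -> Q.[x i] = 0 by move=> il; apply: (points_poly_root x (s := false)).
have rt (i : 'I_k) : exists t, c i <= t <= c i + m%:R /\ root (p \Po modulus T 1) t.
  have ik := ltn_ord i.
  have cS' : c i + m%:R + 1 = c i.+1 by rewrite cS -natr1 addrA.
  have [||j jl|||s [s1 s2]] := @sym_weight_sign (c i).
  - exact: le_trans (cb i).
  - exact: x0.
  - rewrite cS'; case: (ltnP j k) => jk; last first.
      have /andP[_ h] : 0 <= x j <= b by apply: xlow; rewrite jk.
      by left; apply: le_trans h (cb i).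
    rewrite -[j](subKn (ltnW jk)) cx; last by rewrite subn_gt0 jk leq_subr.
    by case: (leqP (k - j) i) => h; [left|right]; apply: c_mono.
  - by rewrite cS' -cx ?ik // Qx // (leq_trans _ kl) // ltn_subrL /= (leq_trans _ ik).
  - case: (posnP i) => i0; last first.
      left; rewrite -cx ?i0 1?ltnW // Qx // (leq_trans _ kl) // ltn_subrL i0.
      exact: leq_ltn_trans ik.
    rewrite i0 /c mul0r addr0; case: hb => [[j /andP[_ jl] <-]|[-> kel]].
      by left; apply: Qx.
    (* With no fixed coordinate the lowest gap starts at [0], a root of the points polynomial
       through its factor ['X] except in type C. *)
    have [TC|TC] := root_type_dec T TypeC; last first.
      by left; rewrite /points_poly; move: TC; case: (T); rewrite // hornerM hornerX mul0r.
    right; split=> //; split=> // j; rewrite -kel => jk.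
    have -> : m%:R + 1 = c 1%N - b :> R by rewrite /c -natr1; ring.
    rewrite -[j](subKn (ltnW jk)) cx; last by rewrite subn_gt0 jk leq_subr.
    rewrite lerBlDr; apply: le_trans (c_mono 1%N (k - j)%N _) _; first by rewrite subn_gt0.
    by rewrite lerDl.
  have [|||t ht rt] := @weighted_sum_root _ (p \Po modulus T 1) (c i) m.+1
      (fun u => s * sym_weight (c i + u%:R)).
  - by move=> u um; apply: s1.
  - by have [v vm hv] := s2; exists v.
  - have := component_step p (c i); rewrite -cS (comp0 _ ik) (comp0 _ (ltnW ik)) subrr => e.
    rewrite -[RHS](mulr0 s) [X in s * X]e mulr_sumr; apply: eq_bigr => u _.
    by rewrite mulrCA.
  by exists t.
have [t ht] := fin_all_exists rt.
suff p0 : p = 0.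
  by move=> r rk; have := coef_poly k lam r; rewrite rk -/p p0 coef0.
apply/eqP/negPn/negP => nz.
pose ys := [seq (modulus T 1 : {poly R}).[t i] | i <- enum 'I_k].
(* The roots lie in [[c i, c i + m]], and [c i.+1] is [c i + m + 1], so they are distinct. They are
   also nonnegative, where the modulus is injective. *)
have tmono (i j : 'I_k) : (i < j)%N -> t i < t j.
  move=> ij; have [/andP[_ h1] _] := ht i; have [/andP[h2 _] _] := ht j.
  have := c_mono _ _ ij; rewrite cS -natr1; lra.
have t0 i : 0 <= t i.
  by have [/andP[h1 _] _] := ht i; apply: le_trans h1; apply: le_trans (cb i).
have ys_uniq : uniq ys.
  rewrite map_inj_uniq ?enum_uniq // => i j /eqP e.
  case: (ltngtP i j) => [ij|ij|/val_inj //].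
    by move: e; rewrite (negPf (modulus_inj (t0 i) (tmono _ _ ij))).
  by move: e; rewrite eq_sym (negPf (modulus_inj (t0 j) (tmono _ _ ij))).
have ys_root : all (root p) ys.
  by apply/allP => _ /mapP[i _ ->]; have [_] := ht i; rewrite /root horner_comp.
have := max_poly_roots nz ys_root ys_uniq; rewrite size_map size_enum_ord.
by rewrite ltnNge size_poly.
Qed.

End Independence.

(** * Roots of types A, B and C *)

Ltac decide_nat := repeat match goal with
  | |- context [@eq_op _ ?m ?n] => first
      [ rewrite (_ : (m == n :> nat) = true); last by lia
      | rewrite (_ : (m == n :> nat) = false); last by lia ]
  | |- context [leq ?m ?n] => first
      [ rewrite (_ : leq m n = true); last by lia
      | rewrite (_ : leq m n = false); last by lia ]
  end.

(** The multiple of a coordinate that is a root. *)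
Definition root_scale (R : nzRingType) (T : root_type) : R := if T is TypeC then 2 else 1.

Section Roots.
Variables (R : realType) (l : nat) (T : root_type).
Local Notation nT := (root_scale R T).

Section Coordinates.
Variables (a : 'I_l -> 'rV[R]_l) (v : 'I_l -> 'cV[R]_l).
Hypothesis cartanP : forall i j, pairing (a i) (v j) = (cartan T i j)%:~R.

Definition xweight (j : nat) : R := if j.+1 == l then nT^-1 else 1.

(* In these coordinates the simple roots are [x 0 - x 1], ..., and [x (l-1)]
   (type C: twice it); [x l = 0]. *)
Definition xform (i : nat) : 'rV[R]_l := \sum_(j < l | (i <= j)%N) xweight j *: a j.
Local Notation x := xform.

Lemma root_scale_gt0 : 0 < nT.
Proof. by rewrite /root_scale; case: T. Qed.

Lemma xform_ge i : (l <= i)%N -> x i = 0.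
Proof. by move=> li; apply: big1 => j; have := ltn_ord j; lia. Qed.

Lemma xformS (i : 'I_l) : x i = xweight i *: a i + x i.+1.
Proof.
rewrite /xform (bigD1 i) //=; congr (_ + _); apply: eq_bigl => j.
by rewrite ltn_neqAle andbC eq_sym.
Qed.

Lemma simple_diff (i : 'I_l) : (i.+1 < l)%N -> a i = x i - x i.+1.
Proof.
by move=> il; rewrite xformS addrK /xweight (ltn_eqF il) scale1r.
Qed.

Lemma simple_last (i : 'I_l) : i.+1 = l -> a i = nT *: x i.
Proof.
move=> il; rewrite xformS xform_ge ?il // addr0 /xweight il eqxx scalerA.
by rewrite divff ?scale1r // gt_eqF // root_scale_gt0.
Qed.

Lemma pairingD (b c : 'rV[R]_l) u : pairing (b + c) u = pairing b u + pairing c u :> R.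
Proof. by rewrite /pairing mulmxDl mxE. Qed.

Lemma pairingZ k (b : 'rV[R]_l) u : pairing (k *: b) u = k * pairing b u :> R.
Proof. by rewrite /pairing -scalemxAl mxE. Qed.

Lemma pairing0 (u : 'cV[R]_l) : pairing 0 u = 0 :> R.
Proof. by rewrite /pairing mul0mx mxE. Qed.

(** The pairing of [x i] with the simple coroot [j]. In type A every coordinate is a difference with
    the extra point [x l = 0], which the last reflection moves; therefore the last coroot pairs
    nontrivially with all of them. *)
Definition xpairing (i j : nat) : R :=
  if (j.+1 < l)%N then (i == j)%:R - (i == j.+1)%:R
  else match T with
       | TypeA => (i < l)%N%:R + (i == j)%:R
       | TypeB => (i == j)%:R * 2
       | TypeC => (i == j)%:R
       end.

Lemma pairing_xform i (j : 'I_l) : pairing (x i) (v j) = xpairing i j.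
Proof.
have hj := ltn_ord j.
have top k : (l <= k)%N -> pairing (x k) (v j) = xpairing k j.
  move=> lk; rewrite xform_ge // pairing0 /xpairing.
  have -> : (k == j) = false by apply/negP => /eqP; lia.
  have -> : (k < l)%N = false by lia.
  case: (ltnP j.+1 l) => jl; last by case: T; rewrite ?addr0 ?mul0r.
  have -> : (k == j.+1) = false by apply/negP => /eqP; lia.
  by rewrite subr0.
have [k hk] := ubnP (l - i); elim: k i hk => // k IH i hk.
have [il|li] := ltnP i l; last exact: top.
rewrite (xformS (Ordinal il)) pairingD pairingZ cartanP IH /=; last by lia.
rewrite /xweight /cartan /xpairing /root_scale -!val_eqE /=.
have [jl|jl] := ltnP j.+1 l; have [il'|il'] := eqVneq i.+1 l;
  case: (ltngtP i j) => ij; have [ij'|ij'] := eqVneq i.+1 j;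
  have [ji|ji] := eqVneq i j.+1; try (by exfalso; lia);
  decide_nat => /=; case: T; lra.
Qed.

Definition reflection (j : 'I_l) (b : 'rV[R]_l) : 'rV[R]_l := b - pairing b (v j) *: a j.

Lemma reflectionD j b c : reflection j (b + c) = reflection j b + reflection j c.
Proof. by rewrite /reflection pairingD scalerDl opprD addrACA. Qed.

Lemma reflectionZ j k b : reflection j (k *: b) = k *: reflection j b.
Proof. by rewrite /reflection pairingZ scalerBr scalerA. Qed.

Lemma reflectionB j b c : reflection j (b - c) = reflection j b - reflection j c.
Proof. by rewrite -scaleN1r reflectionD reflectionZ scaleN1r. Qed.

Lemma reflectionK j b : reflection j (reflection j b) = b.
Proof.
have ajj : pairing (a j) (v j) = 2 by rewrite cartanP /cartan eqxx.
have e : pairing (reflection j b) (v j) = - pairing b (v j).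
  by rewrite /reflection -scaleNr pairingD pairingZ ajj; ring.
by rewrite {1}/reflection e scaleNr opprK /reflection subrK.
Qed.

Definition swap_next (j i : nat) : nat :=
  if i == j then j.+1 else if i == j.+1 then j else i.

Lemma reflection_next (j : 'I_l) i : (j.+1 < l)%N ->
  reflection j (x i) = x (swap_next j i).
Proof.
move=> jl; rewrite /reflection pairing_xform /xpairing jl simple_diff //.
rewrite /swap_next; have [->|ij] := eqVneq i j.
  have -> : (j == j.+1 :> nat) = false by lia.
  by rewrite subr0 scale1r opprB addrC subrK.
have [->|ij'] := eqVneq i j.+1; last by rewrite subrr scale0r subr0.
by rewrite sub0r scaleN1r opprK addrC subrK.
Qed.

Lemma reflection_last (j : 'I_l) i : j.+1 = l -> (i < l)%N -> T <> TypeA ->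
  reflection j (x i) = (-1) ^+ (i == j) *: x i.
Proof.
move=> jl il TA; rewrite /reflection pairing_xform /xpairing jl ltnn simple_last //.
rewrite /root_scale; move: TA; have [->|ij] := eqVneq i j; case: T => // _;
  rewrite ?mul1r ?mul0r ?scale0r ?subr0 ?scale1r ?expr0 ?expr1 ?scale1r // scaleN1r.
  by rewrite scaler_nat mulr2n opprD addrA subrr sub0r.
by rewrite scaler_nat mulr2n opprD addrA subrr sub0r.
Qed.

(** The last reflection exchanges [x j] with the origin [x l]; the common translation by [- x j]
    restores the normalization and cancels in differences. *)
Lemma reflection_lastA (j : 'I_l) i : j.+1 = l -> (i <= l)%N -> T = TypeA ->
  reflection j (x i) = x (swap_next j i) - x j.
Proof.
move=> jl il TA; rewrite /reflection pairing_xform /xpairing jl ltnn simple_last //.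
rewrite /root_scale TA scale1r /swap_next.
have [->|ij] := eqVneq i j.
  have -> : (j < l)%N by [].
  by rewrite jl [x l]xform_ge // scalerDl !scale1r opprD addrA subrr.
have [->|ij'] := eqVneq i j.+1.
  by rewrite jl ltnn addr0 scale0r subr0 subrr [x l]xform_ge.
have -> : (i < l)%N by lia.
by rewrite addr0 scale1r.
Qed.

(** The expected roots of both signs. In type A the indices run up to [l], so that [x l = 0] makes
    single coordinates into differences. *)
Definition signed_root (b : 'rV[R]_l) : Prop :=
  if T is TypeA then exists i j, [/\ (i <= l)%N, (j <= l)%N, i != j & b = x i - x j]
  else (exists i j (s t : bool), [/\ (i < l)%N, (j < l)%N, i != j &
          b = (-1) ^+ s *: x i + (-1) ^+ t *: x j]) \/
       (exists i (s : bool), (i < l)%N /\ b = (-1) ^+ s *: (nT *: x i)).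

Lemma swap_next_lt j i n : (j.+1 < n)%N -> (i < n)%N -> (swap_next j i < n)%N.
Proof. by move=> jn il; rewrite /swap_next; case: eqP => // _; case: eqP => // _; lia. Qed.

Lemma swap_next_neq j i i' : i != i' -> swap_next j i != swap_next j i'.
Proof.
move=> ne; rewrite /swap_next.
by case: (i =P j); case: (i' =P j); case: (i =P j.+1); case: (i' =P j.+1); lia.
Qed.

Lemma signed_root_reflection (j : 'I_l) b : signed_root b -> signed_root (reflection j b).
Proof.
have hj := ltn_ord j; rewrite /signed_root; have [TA|TA] := root_type_dec T TypeA.
  rewrite TA => -[i [i' [il i'l ii' ->]]]; exists (swap_next j i), (swap_next j i').
  have jl : (j.+1 < l.+1)%N by [].
  split; rewrite -1?ltnS; try exact: swap_next_lt; first exact: swap_next_neq.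
  rewrite reflectionB; case: (ltnP j.+1 l) => jl'; first by rewrite !reflection_next.
  have {}jl' : j.+1 = l by lia.
  by rewrite !reflection_lastA // opprB addrA subrK.
have gen (P : Prop) (P' : Prop) : (P' -> if T is TypeA then P else P') by move: TA; case: (T).
have gen' (P : Prop) (P' : Prop) : (if T is TypeA then P else P') -> P' by move: TA; case: (T).
move/gen' => h; apply: (gen); move: h.
case: (ltnP j.+1 l) => jl.
  case=> [[i [i' [s [t [il i'l ii' ->]]]]]|[i [s [il ->]]]].
    left; exists (swap_next j i), (swap_next j i'), s, t.
    split; try exact: swap_next_lt; first exact: swap_next_neq.
    by rewrite reflectionD !reflectionZ !reflection_next.
  right; exists (swap_next j i), s; split; first exact: swap_next_lt.
  by rewrite !reflectionZ reflection_next.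
have {}jl : j.+1 = l by lia.
case=> [[i [i' [s [t [il i'l ii' ->]]]]]|[i [s [il ->]]]].
  left; exists i, i', (s (+) (i == j)), (t (+) (i' == j)); split=> //.
  by rewrite reflectionD !reflectionZ !reflection_last // !scalerA -!signr_addb.
right; exists i, (s (+) (i == j)); split=> //.
by rewrite !reflectionZ reflection_last // !scalerA signr_addb; congr (_ *: _); ring.
Qed.

Lemma signed_root_simple (j : 'I_l) : signed_root (a j).
Proof.
have hj := ltn_ord j; rewrite /signed_root.
have [jl|jl] := ltnP j.+1 l.
  have hA : [/\ (j <= l)%N, (j.+1 <= l)%N, nat_of_ord j != j.+1 & a j = x j - x j.+1].
    by split; rewrite ?simple_diff //; lia.
  have hB : [/\ (j < l)%N, (j.+1 < l)%N, nat_of_ord j != j.+1 &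
      a j = (-1) ^+ false *: x j + (-1) ^+ true *: x j.+1].
    by split; rewrite ?simple_diff ?expr0 ?expr1 ?scale1r ?scaleN1r //; lia.
  case: T hA hB => hA hB; first by exists (nat_of_ord j), j.+1.
    by left; exists (nat_of_ord j), j.+1, false, true.
  by left; exists (nat_of_ord j), j.+1, false, true.
have {}jl : j.+1 = l by lia.
have := simple_last jl; rewrite /root_scale; case: T => h.
- exists (nat_of_ord j), l; split=> //; try lia.
  by rewrite h scale1r [X in _ - X]xform_ge ?subr0.
- by right; exists (nat_of_ord j), false; rewrite expr0 scale1r.
- by right; exists (nat_of_ord j), false; rewrite expr0 scale1r.
Qed.

End Coordinates.
End Roots.

Lemma perm_imfset_ord (A : choiceType) n (f : 'I_n -> A) : injective f ->
  perm_eq [fset f i | i in 'I_n]%fset [seq f i | i <- enum 'I_n].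
Proof.
move=> inj; apply: uniq_perm; first exact: fset_uniq.
  by rewrite map_inj_uniq ?enum_uniq.
move=> b; apply/imfsetP/mapP => [[i _ ->]|[i _ ->]]; exists i => //.
exact: mem_enum.
Qed.

(** * The positive roots in coordinates *)

Section RootList.
Variables (R : realType) (l : nat) (T : root_type).
Variables (Phi Phip Delta : {fset 'rV[R]_l}).
Hypotheses (hPhi : root_system Phi) (hPhip : positive_system Phi Phip).
Hypothesis hDelta : simple_system Phip Delta.
Variables (a : 'I_l -> 'rV[R]_l) (v : 'I_l -> 'cV[R]_l).
Hypotheses (a_inj : injective a) (Delta_a : Delta = [fset a i | i in 'I_l]%fset).
Hypothesis corootP : forall j, is_coroot Phi (a j) (v j).
Hypothesis cartanP : forall i j, pairing (a i) (v j) = (cartan T i j)%:~R.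
Local Notation nT := (root_scale R T).
Local Notation x := (xform T a).
Local Notation refl := (reflection a v).

Lemma simple_Delta j : a j \in Delta.
Proof. by rewrite Delta_a; apply/imfsetP; exists j. Qed.

Lemma simple_Phip j : a j \in Phip.
Proof. by have [/fsubsetP h _ _] := hDelta; apply: h; apply: simple_Delta. Qed.

Lemma Phip_Phi b : b \in Phip -> b \in Phi.
Proof. by case: hPhip => u _ ->; rewrite !inE => /andP[]. Qed.

Lemma Phip_dec b : b \in Phi -> b \in Phip \/ - b \in Phip.
Proof.
move=> bPhi; have [_ _ co _] := hPhi; have [w [bw /(_ b bPhi)[+ _]]] := co b bPhi.
rewrite bw => nb; have {}nb : - b \in Phi.
  by move: nb; rewrite -[X in X - _]scale1r -scalerBl (_ : 1 - 2 = -1 :> R) ?scaleN1r //; ring.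
case: hPhip => u h0 ->; rewrite !inE bPhi nb /=.
have -> : pairing (- b) u = - pairing b u by rewrite -scaleN1r pairingZ mulN1r.
by have := h0 b bPhi; rewrite oppr_gt0; case: ltgtP => //; auto.
Qed.

Lemma reflection_Phi j b : b \in Phi -> refl j b \in Phi.
Proof. by move=> bPhi; have [_ /(_ b bPhi)[]] := corootP j. Qed.

Definition simple_mx : 'M[R]_l := \matrix_i a i.
Definition xform_mx : 'M[R]_l := \matrix_(i < l) x i.

Lemma simple_mx_unit : simple_mx \in unitmx.
Proof.
rewrite -row_full_unit -sub1mx; apply/row_subP => i; rewrite row1.
have [_ /andP[/eqP sp _] _] := hDelta.
have aD b : b \in Delta -> (b <= simple_mx)%MS.
  by rewrite Delta_a => /imfsetP[j _ ->]; rewrite -(rowK a j) row_sub.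
have : delta_mx 0 i \in <<Delta : seq 'rV[R]_l>>%VS by rewrite sp memvf.
move/(coord_span (X := in_tuple Delta)) => ->; apply: summx_sub => k _.
apply: scalemx_sub; apply: aD; exact: mem_nth.
Qed.

Lemma xform_mx_unit : xform_mx \in unitmx.
Proof.
rewrite -row_full_unit -sub1mx; apply: submx_trans (_ : simple_mx <= _)%MS.
  by rewrite sub1mx row_full_unit simple_mx_unit.
apply/row_subP => i; rewrite rowK.
have xX (k : 'I_l) : (x k <= xform_mx)%MS by rewrite -[x k](rowK (fun k : 'I_l => x k)) row_sub.
have [il|il] := ltnP i.+1 l.
  rewrite (simple_diff T a il) -scaleN1r.
  by apply: addmx_sub => //; apply: scalemx_sub; apply: (xX (Ordinal il)).
have {}il : i.+1 = l by have := ltn_ord i; lia.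
by rewrite (simple_last T a il); apply: scalemx_sub.
Qed.

Definition simple_coord (b : 'rV[R]_l) (i : 'I_l) : R := (b *m invmx simple_mx) 0 i.

Lemma simple_coord_sum (c : 'I_l -> R) i : simple_coord (\sum_j c j *: a j) i = c i.
Proof.
have -> : \sum_j c j *: a j = (\row_j c j) *m simple_mx.
  by rewrite mulmx_sum_row; apply: eq_bigr => j _; rewrite mxE rowK.
by rewrite /simple_coord mulmxK ?simple_mx_unit // mxE.
Qed.

Lemma Phip_sum b : b \in Phip -> exists c : 'I_l -> nat, b = \sum_i (c i)%:R *: a i.
Proof.
have [_ _ h] := hDelta => /h[c ->]; exists (fun i => c (a i)).
rewrite Delta_a (perm_big _ (perm_imfset_ord a_inj)) big_map big_enum /=.
by apply: eq_bigr => i _; rewrite scaler_nat.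
Qed.

Lemma pairing_sum (I : Type) (r : seq I) (P : pred I) (F : I -> 'rV[R]_l) u :
  pairing (\sum_(i <- r | P i) F i) u = \sum_(i <- r | P i) pairing (F i) u.
Proof. by rewrite /pairing mulmx_suml summxE. Qed.

(* In the coordinates [y] of the basis [x], nonpositive pairings with the
   simple coroots make [y] increasing with last term [<= 0], while the first
   term is a coefficient of a positive root. *)
Lemma positive_pairing b : (0 < l)%N -> b \in Phip -> exists j, 0 < pairing b (v j).
Proof.
move=> l0 bP; have [/existsP[j hj]|/existsPn hn] := boolP [exists j, 0 < pairing b (v j)].
  by exists j.
have {}hn j : pairing b (v j) <= 0 by rewrite leNgt.
exfalso; have [P0 _ _ _] := hPhi.
have b0 : b != 0 by apply: contraNneq P0 => <-; apply: Phip_Phi.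
pose y (i : nat) := if insub i is Some k then (b *m invmx xform_mx) 0 k else 0 : R.
have yE (k : 'I_l) : y k = (b *m invmx xform_mx) 0 k by rewrite /y valK.
have by_ : b = \sum_(k < l) y k *: x k.
  rewrite -[LHS](mulmxKV xform_mx_unit) mulmx_sum_row.
  by apply: eq_bigr => k _; rewrite yE rowK.
have pb (j : 'I_l) : pairing b (v j) = \sum_(k < l) y k * xpairing R l T k j.
  rewrite {1}by_ pairing_sum; apply: eq_bigr => k _.
  by rewrite pairingZ (pairing_xform cartanP).
have y0 : 0 <= y 0%N.
  have [c hc] := Phip_sum bP; rewrite (yE (Ordinal l0)) hc mulmx_suml summxE.
  apply: sumr_ge0 => i _; rewrite -scalemxAl mxE; apply: mulr_ge0 => //.
  have xe (k : 'I_l) : x k *m invmx xform_mx = delta_mx 0 k.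
    by rewrite -[x k](rowK (fun k : 'I_l => x k)) -row_mul mulmxV ?xform_mx_unit // row1.
  have [il|il] := ltnP i.+1 l.
    rewrite (simple_diff T a il) mulmxBl xe (xe (Ordinal il)) !mxE /=.
    by rewrite -!val_eqE /= subr0.
  have {}il : i.+1 = l by have := ltn_ord i; lia.
  rewrite (simple_last T a il) -scalemxAl xe !mxE.
  by apply: mulr_ge0 => //; rewrite ltW // root_scale_gt0.
have ymono i : (i.+1 < l)%N -> y i <= y i.+1.
  move=> il; have := hn (Ordinal (ltnW il)); rewrite pb /xpairing /= il.
  under eq_bigr do rewrite mulrBr.
  rewrite sumrB (bigD1 (Ordinal (ltnW il))) //= eqxx mulr1 big1 ?addr0; last first.
    by move=> k; rewrite -val_eqE /= => /negPf ->; rewrite mulr0.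
  rewrite (bigD1 (Ordinal il)) //= eqxx mulr1 big1 ?addr0; last first.
    by move=> k; rewrite -val_eqE /= => /negPf ->; rewrite mulr0.
  by rewrite subr_le0.
have yge i : (i < l)%N -> 0 <= y i.
  by elim: i => // i IH il; apply: le_trans (ymono i il); apply: IH; apply: ltnW.
have ylast : y l.-1 <= 0.
  have ll : (l.-1 < l)%N by lia.
  have := hn (Ordinal ll); rewrite pb /xpairing /= prednK // ltnn.
  have d1 : \sum_(k < l) y k * (k == l.-1 :> nat)%:R = y l.-1.
    rewrite (bigD1 (Ordinal ll)) //= eqxx mulr1 big1 ?addr0 //.
    by move=> k; rewrite -val_eqE /= => /negPf ->; rewrite mulr0.
  case: (T).
  (* In type A the pairing is [y l.-1] plus the sum of all [y k], which is already known to be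
     nonnegative. *)
  - under eq_bigr do rewrite ltn_ord mulrDr mulr1.
    rewrite big_split /= d1 => h.
    have : 0 <= \sum_(k < l) y k by apply: sumr_ge0 => k _; apply: yge.
    lra.
  - under eq_bigr do rewrite mulrA.
    by rewrite -mulr_suml d1 => h; lra.
  - by rewrite d1.
have yle i : (i < l)%N -> y i <= 0.
  move=> il; apply: le_trans ylast; have : (i + (l.-1 - i) = l.-1)%N by lia.
  move: (l.-1 - i)%N => d; elim: d i il => [|d IH] k kl e; first by rewrite -e addn0.
  have kl' : (k.+1 < l)%N by lia.
  by apply: le_trans (ymono k kl') _; apply: IH => //; lia.
case/eqP: b0; rewrite by_ big1 // => k _.
have -> : y k = 0 by apply/eqP; rewrite eq_le yge ?yle.
by rewrite scale0r.
Qed.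

(** Induction on the height. A simple reflection with positive pairing lowers the height; if [b]
    involves another simple root, its coefficient there is unchanged, so the reflected root is still
    positive. Otherwise [b] is a multiple of a simple root, hence equal to it as [Phi] is reduced.
    Simple reflections permute the signed roots, which leads back to [b]. *)
Lemma Phip_signed_root b : (0 < l)%N -> b \in Phip -> signed_root T a b.
Proof.
move=> l0 bP; have [c hc] := Phip_sum bP.
have [N hN] := ubnP (\sum_i c i)%N; elim: N b bP c hc hN => // N IH b bP c hc hN.
have [j pj] := positive_pairing l0 bP.
have [[i /andP[ij ci]]|cz] : (exists i, (i != j) && (c i != 0%N)) \/ forall i, i != j -> c i = 0%N.
- have [/existsP|/existsPn h] := boolP [exists i, (i != j) && (c i != 0%N)]; first by left.
  right=> i ij; have := h i; rewrite ij /= negbK => /eqP //.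
- have rPhi := reflection_Phi j (Phip_Phi bP).
  have [k hk] : exists k : int, pairing b (v j) = k%:~R.
    by have [_ /(_ b (Phip_Phi bP))[]] := corootP j.
  have k0 : (0 < k)%R by move: pj; rewrite hk ltr0z.
  pose d i' : R := (c i')%:R - (i' == j)%:R * k%:~R.
  have rE : refl j b = \sum_i d i *: a i.
    rewrite /reflection hk {1}hc /d.
    under [RHS]eq_bigr do rewrite scalerBl.
    rewrite sumrB; congr (_ - _); rewrite (bigD1 j) //= eqxx mul1r big1 ?addr0 //.
    by move=> i' /negPf ->; rewrite mul0r scale0r.
  have rP : refl j b \in Phip.
    have [//|nP] := Phip_dec rPhi; have [e he] := Phip_sum nP.
    have := simple_coord_sum (fun i' => (e i')%:R) i; rewrite -he rE -sumrN.
    under eq_bigr do rewrite -scaleNr.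
    rewrite simple_coord_sum /d (negPf ij) mul0r subr0 => e1.
    have : (0 : R) < (c i)%:R by rewrite ltr0n lt0n.
    have : (0 : R) <= (e i)%:R by [].
    by move: e1; lra.
  have [e he] := Phip_sum rP.
  have ed i' : (e i')%:R = d i' by rewrite -(simple_coord_sum (fun i => (e i)%:R)) -he rE simple_coord_sum.
  rewrite -(reflectionK cartanP j b); apply: (signed_root_reflection cartanP).
  apply: (IH _ rP e he); rewrite -ltnS; apply: leq_trans hN; rewrite ltnS.
  have : (\sum_i e i)%N%:R = (\sum_i c i)%N%:R - k%:~R :> R.
    rewrite !natr_sum; under eq_bigr do rewrite ed /d.
    rewrite sumrB; congr (_ - _); rewrite (bigD1 j) //= eqxx mul1r big1 ?addr0 //.
    by move=> i' /negPf ->; rewrite mul0r.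
  move=> es; rewrite -(ltr_nat R) es; have : (0 : R) < k%:~R by rewrite ltr0z.
  lra.
have bE : b = (c j)%:R *: a j.
  rewrite hc (bigD1 j) //= big1 ?addr0 // => i ij.
  by rewrite cz // scale0r.
have [_ _ _ red] := hPhi.
have [||e|e] := red (a j) (c j)%:R; first exact/Phip_Phi/simple_Phip.
- by rewrite -bE; apply: Phip_Phi.
- by rewrite bE e scale1r; apply: signed_root_simple.
have : (0 : R) <= (c j)%:R by [].
by rewrite e; lra.
Qed.

Section Positivity.
Variable u : 'cV[R]_l.
Hypothesis Phip_u : forall b, (b \in Phip) = (b \in Phi) && (0 < pairing b u).

Lemma pairing_simple_gt0 j : 0 < pairing (a j) u.
Proof. by have := simple_Phip j; rewrite Phip_u => /andP[]. Qed.

Lemma pairing_xform_ge0 i : 0 <= pairing (x i) u.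
Proof.
rewrite /xform pairing_sum; apply: sumr_ge0 => j _; rewrite pairingZ.
apply: mulr_ge0; last exact/ltW/pairing_simple_gt0.
by rewrite /xweight; case: ifP => // _; rewrite invr_ge0 ltW // root_scale_gt0.
Qed.

Lemma pairing_xform_gt0 i : (i < l)%N -> 0 < pairing (x i) u.
Proof.
move=> il; rewrite (xformS T a (Ordinal il)) pairingD pairingZ.
apply: ltr_pwDl; last exact: pairing_xform_ge0.
apply: mulr_gt0; last exact: pairing_simple_gt0.
by rewrite /xweight; case: ifP => // _; rewrite invr_gt0 root_scale_gt0.
Qed.

Lemma pairing_xform_lt i j : (i < j)%N -> (j <= l)%N -> pairing (x j) u < pairing (x i) u.
Proof.
elim: j => // j IH; rewrite ltnS leq_eqVlt => /orP[/eqP ->|ij] jl.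
  rewrite (xformS T a (Ordinal jl)) pairingD pairingZ /= ltrDr.
  apply: mulr_gt0; last exact: pairing_simple_gt0.
  by rewrite /xweight; case: ifP => // _; rewrite invr_gt0 root_scale_gt0.
apply: lt_trans (IH ij (ltnW jl)).
rewrite (xformS T a (Ordinal jl)) pairingD pairingZ /= ltrDr.
apply: mulr_gt0; last exact: pairing_simple_gt0.
by rewrite /xweight; case: ifP => // _; rewrite invr_gt0 root_scale_gt0.
Qed.

End Positivity.

Lemma diff_Phi i j : (i < j)%N -> (j < l)%N -> x i - x j \in Phi.
Proof.
elim: j => // j IH; rewrite ltnS leq_eqVlt => /orP[/eqP ->|ij] jl.
  by rewrite -(simple_diff T a (i := Ordinal (ltnW jl)) jl); apply/Phip_Phi/simple_Phip.
have := reflection_Phi (Ordinal (ltnW jl)) (IH ij (ltnW jl)).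
rewrite reflectionB !(reflection_next cartanP) //= /swap_next eqxx.
by rewrite (ltn_eqF ij) (ltn_eqF (leqW ij)).
Qed.

(** Reflections move the index of the last simple root downwards. In type A the last reflection
    turns [x i - x l.-1] into [x i] instead. *)
Lemma scaled_Phi i : (i < l)%N -> nT *: x i \in Phi.
Proof.
move=> il; have ll : (l.-1 < l)%N by lia.
have lS : (Ordinal ll).+1 = l by rewrite /= prednK //; lia.
have base : nT *: x l.-1 \in Phi.
  by rewrite -(simple_last T a lS); apply/Phip_Phi/simple_Phip.
have [->|il'] := eqVneq i l.-1; first exact: base.
have [TA|TA] := root_type_dec T TypeA.
  have := reflection_Phi (Ordinal ll) (diff_Phi (i := i) (j := l.-1) _ ll).
  rewrite reflectionB !(reflection_lastA cartanP) //=; [|lia|lia].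
  rewrite /swap_next eqxx (negPf il') prednK ?(ltn_eqF il); last by lia.
  rewrite opprB addrA subrK [x l]xform_ge // subr0 /root_scale TA scale1r.
  by apply; lia.
have [d hd] := ubnP (l - i); elim: d i il {il'} hd => // d IH i il hd.
have [il'|il'] := ltnP i.+1 l; last by have -> : i = l.-1 by lia.
have := reflection_Phi (Ordinal il) (IH i.+1 il' _).
rewrite reflectionZ (reflection_next cartanP) //= /swap_next eqxx.
have -> : (i.+1 == i) = false by lia.
by apply; lia.
Qed.

Lemma sum_Phi i j : T <> TypeA -> (i < j)%N -> (j < l)%N -> x i + x j \in Phi.
Proof.
move=> TA ij jl; have ll : (l.-1 < l)%N by lia.
have lS : (Ordinal ll).+1 = l by rewrite /= prednK //; lia.
have base k : (k < l.-1)%N -> x k + x l.-1 \in Phi.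
  move=> kl; have := reflection_Phi (Ordinal ll) (diff_Phi kl ll).
  rewrite reflectionB !(reflection_last cartanP) //=; last by lia.
  by rewrite eqxx (ltn_eqF kl) expr0 scale1r expr1 scaleN1r opprK.
have [d hd] := ubnP (l - j); elim: d j ij jl hd => // d IH j ij jl hd.
have [jl'|jl'] := ltnP j.+1 l; last first.
  have jE : j = l.-1 by lia.
  by rewrite jE in ij *; apply: base.
have := reflection_Phi (Ordinal jl) (IH j.+1 (leqW ij) jl' _).
rewrite reflectionD !(reflection_next cartanP) //= /swap_next eqxx.
have -> : (j.+1 == j) = false by lia.
rewrite (ltn_eqF ij) (ltn_eqF (leqW ij)).
by apply; lia.
Qed.

(** The converse direction to [Phip_signed_root]: that lemma bounds the roots from above and gives
    tangency, this one provides enough hyperplanes for the degree count. *)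
Lemma Phip_list : [/\ forall i j, (i < j)%N -> (j < l)%N -> x i - x j \in Phip,
  forall i, (i < l)%N -> nT *: x i \in Phip &
  T <> TypeA -> forall i j, (i < j)%N -> (j < l)%N -> x i + x j \in Phip].
Proof.
have [u u0 Pu] := hPhip.
have hu b : (b \in Phip) = (b \in Phi) && (0 < pairing b u) by rewrite Pu !inE.
split=> [i j ij jl|i il|TA i j ij jl]; rewrite hu.
- rewrite diff_Phi // -scaleN1r pairingD pairingZ mulN1r subr_gt0.
  by rewrite (pairing_xform_lt hu) // ltnW.
- by rewrite scaled_Phi // pairingZ mulr_gt0 ?root_scale_gt0 ?(pairing_xform_gt0 hu).
- rewrite sum_Phi // pairingD addr_gt0 ?(pairing_xform_gt0 hu) //.
  exact: ltn_trans jl.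
Qed.

End RootList.

(** * Counting hyperplanes *)

Definition leading_one (K : nzRingType) n (y : 'rV[K]_n) : Prop :=
  exists i, y 0 i = 1 /\ forall j : 'I_n, (j < i)%N -> y 0 j = 0.

(** Distinct normalized forms are not proportional. The vectors $e_q-y_qe_i$ lie in the kernel of
    $y$, and a form that vanishes on all of them is a multiple of $y$. *)
Lemma leading_one_sep (K : fieldType) n (y y' : 'rV[K]_n) :
  leading_one y -> leading_one y' -> y != y' ->
  exists2 w : 'cV[K]_n, (y *m w) 0 0 = 0 & (y' *m w) 0 0 != 0.
Proof.
move=> [i [yi yi0]] [i' [yi' yi0']] ne.
have val_at (u : 'rV[K]_n) q c :
    (u *m (delta_mx q 0 - c *: delta_mx i 0 : 'cV[K]_n)) 0 0 = u 0 q - c * u 0 i.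
  by rewrite mulmxBr -scalemxAr -!colE !mxE.
have [/existsP[q hq]|/existsPn h] := boolP [exists q, y' 0 q != y 0 q * y' 0 i].
  exists (delta_mx q 0 - y 0 q *: delta_mx i 0); first by rewrite val_at yi mulr1 subrr.
  by rewrite val_at subr_eq0.
have {}h q : y' 0 q = y 0 q * y' 0 i by apply/eqP; have := h q; rewrite negbK.
have y'i : y' 0 i != 0.
  by apply: contraTneq isT => y'i; move: (h i'); rewrite yi' y'i mulr0 => /eqP; rewrite oner_eq0.
have ii' : i = i'.
  case: (ltngtP i i') => [ii'|ii'|/val_inj //].
    by case/eqP: y'i; apply: yi0'.
  by move: (h i'); rewrite yi' yi0 // mul0r => /eqP; rewrite oner_eq0.
case/eqP: ne; apply/rowP => q.
have : y' 0 i = 1 by rewrite ii'.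
by move=> e; rewrite (h q) e mulr1.
Qed.

Section NormalForms.
Variables (K : fieldType) (k : nat).
Local Notation index := ((nat * nat) * (K * K))%type.

(* [((i, j), (s, g))] encodes the form [x i + s * x j - g * z]; the last
   coordinate is [z], and [j] is irrelevant when [s = 0]. *)
Definition normal_form (d : index) : 'rV[K]_k.+1 :=
  \row_t ((t == d.1.1 :> nat)%:R + d.2.1 * (t == d.1.2 :> nat)%:R - d.2.2 * (t == k :> nat)%:R).

Definition z_form : 'rV[K]_k.+1 := \row_t (t == k :> nat)%:R.

Definition normal_index (d : index) : bool :=
  if d.2.1 == 0 then (d.1.1 < k)%N && (d.1.2 == 0%N) else (d.1.1 < d.1.2 < k)%N.

Lemma normal_formE d (t : nat) : (t <= k)%N ->
  normal_form d 0 (inord t) =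
  (t == d.1.1)%:R + d.2.1 * (t == d.1.2)%:R - d.2.2 * (t == k)%:R.
Proof. by move=> tk; rewrite mxE inordK. Qed.

Lemma normal_index_lt d : normal_index d -> (d.1.1 < k)%N.
Proof.
by rewrite /normal_index; case: ifP => _ /andP[] // h1 h2; apply: ltn_trans h2.
Qed.

Lemma normal_form_lead d (t : nat) : normal_index d -> (t <= d.1.1)%N ->
  normal_form d 0 (inord t) = (t == d.1.1)%:R.
Proof.
move=> nd td; have dk := normal_index_lt nd; rewrite normal_formE; last by lia.
have -> : (t == k) = false by lia.
move: nd; rewrite /normal_index; case: ifP => [/eqP -> _|_ nd].
  by rewrite mul0r mulr0 addr0 subr0.
have -> : (t == d.1.2) = false by lia.
by rewrite !mulr0 addr0 subr0.
Qed.

Lemma leading_one_normal d : normal_index d -> leading_one (normal_form d).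
Proof.
move=> nd; exists (inord d.1.1); rewrite normal_form_lead // eqxx; split=> // j.
have dk := normal_index_lt nd; rewrite inordK; last by lia.
by move=> jd; rewrite -[j]inord_val normal_form_lead ?ltn_eqF // ltnW.
Qed.

Lemma leading_one_z : leading_one z_form.
Proof.
exists ord_max; rewrite mxE eqxx; split=> // j /= jk.
by rewrite mxE ltn_eqF.
Qed.

Lemma normal_form_neq_z d : normal_index d -> z_form != normal_form d.
Proof.
move=> nd; apply/negP => /eqP/rowP/(_ (inord d.1.1)).
have dk := normal_index_lt nd.
rewrite normal_form_lead // eqxx mxE inordK; last by lia.
by rewrite (ltn_eqF dk) => /eqP; rewrite eq_sym oner_eq0.
Qed.

Lemma normal_form_inj : {in normal_index &, injective normal_form}.
Proof.
move=> d d'; rewrite !unfold_in => nd nd' e.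
have dk := normal_index_lt nd; have dk' := normal_index_lt nd'.
have lead (b b' : index) : normal_index b -> normal_index b' ->
    normal_form b = normal_form b' -> (b.1.1 < b'.1.1)%N -> False.
  move=> nb nb' eb lt; have := normal_form_lead nb (leqnn _).
  rewrite eb normal_form_lead 1?ltnW // eqxx (ltn_eqF lt) => /eqP.
  by rewrite eq_sym oner_eq0.
have e1 : d.1.1 = d'.1.1.
  by case: (ltngtP d.1.1 d'.1.1) => // [/(lead _ _ nd nd' e)|/(lead _ _ nd' nd (esym e))].
have at_ t : (t < k)%N -> d.2.1 * (t == d.1.2)%:R = d'.2.1 * (t == d'.1.2)%:R.
  move=> tk; have := congr1 (fun u : 'rV_k.+1 => u 0 (inord t)) e; rewrite /=.
  rewrite !normal_formE 1?ltnW // e1 (ltn_eqF tk) !mulr0 !subr0.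
  exact: addrI.
have [e2 e3] : d.1.2 = d'.1.2 /\ d.2.1 = d'.2.1.
  move: nd nd'; rewrite /normal_index.
  case: ifP => [/eqP s0|/negbT s0] /andP[h1 h2]; case: ifP => [/eqP s0'|/negbT s0'] /andP[h1' h2'].
  - by rewrite (eqP h2) (eqP h2') s0 s0'.
  - by have := at_ _ h2'; rewrite s0 mul0r eqxx mulr1 => /esym/eqP; rewrite (negPf s0').
  - by have := at_ _ h2; rewrite s0' mul0r eqxx mulr1 => /eqP; rewrite (negPf s0).
  - have := at_ _ h2; rewrite eqxx mulr1; have [->|_] := eqVneq d.1.2 d'.1.2.
      by rewrite mulr1.
    by rewrite mulr0 => /eqP; rewrite (negPf s0).
have e4 : d.2.2 = d'.2.2.
  have := congr1 (fun u : 'rV_k.+1 => u 0 (inord k)) e; rewrite /=.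
  by rewrite !normal_formE // e1 e2 e3 eqxx !mulr1 => /addrI/oppr_inj.
by move: e1 e2 e3 e4 {e nd nd' dk dk' at_}; case: d d' => [[? ?] [? ?]] [[? ?] [? ?]] /= -> -> -> ->.
Qed.

Variables (S : seq K) (P : seq (K * K)).
Hypotheses (uS : uniq S) (uP : uniq P) (P0 : forall p, p \in P -> p.1 != 0).

Definition index_pairs : seq (nat * nat) := [seq (i, j) | j <- iota 0 k, i <- iota 0 j].

Definition indices : seq index :=
  [seq ((i, 0%N), (0, g)) | i <- iota 0 k, g <- S] ++ [seq (q, p) | q <- index_pairs, p <- P].

Definition forms : seq 'rV[K]_k.+1 := z_form :: [seq normal_form d | d <- indices].

Lemma mem_index_pairs q : (q \in index_pairs) = (q.1 < q.2 < k)%N.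
Proof.
apply/allpairsPdep/idP => [[j [i [+ + ->]]]|/andP[h1 h2]].
  by rewrite !mem_iota /= !add0n => -> ->.
by exists q.2, q.1; rewrite !mem_iota /= !add0n h1 h2; split=> //; case: (q).
Qed.

Lemma indices_normal : all normal_index indices.
Proof.
apply/allP => d; rewrite mem_cat => /orP[/allpairsP[[i g] /= [+ _ ->]]|].
  by rewrite mem_iota /normal_index /= eqxx add0n => ->.
case/allpairsP => -[q p] /= [+ /P0 p0 ->].
by rewrite mem_index_pairs /normal_index /= (negPf p0).
Qed.

Lemma uniq_indices : uniq indices.
Proof.
rewrite cat_uniq; apply/and3P; split.
- by apply: allpairs_uniq; rewrite ?iota_uniq // => -[? ?] [? ?] _ _ /= [-> ->].
- apply/hasPn => d /allpairsP[[q p] /= [_ /P0 p0 ->]].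
  by apply/allpairsP => -[[i g] /= [_ _ [_ e]]]; rewrite e /= eqxx in p0.
- apply: allpairs_uniq => //; last by move=> [? ?] [? ?] _ _ /= [-> ->].
  apply: allpairs_uniq_dep => [|j _|]; try exact: iota_uniq.
  by move=> [? ?] [? ?] _ _ /= [-> ->].
Qed.

Lemma forms_leading y : y \in forms -> leading_one y.
Proof.
rewrite inE => /orP[/eqP ->|/mapP[d din ->]]; first exact: leading_one_z.
by apply/leading_one_normal/(allP indices_normal).
Qed.

Lemma uniq_forms : uniq forms.
Proof.
rewrite /= map_inj_in_uniq ?uniq_indices; last first.
  by move=> d d' /(allP indices_normal) nd /(allP indices_normal) nd'; apply: normal_form_inj.
rewrite andbT; apply/mapP => -[d din /eqP]; apply/negP.
by apply: normal_form_neq_z; apply: (allP indices_normal).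
Qed.

Lemma size_index_pairs : size index_pairs = sumn (iota 0 k).
Proof.
rewrite size_allpairs_dep; congr sumn; rewrite -[RHS]map_id.
by apply: eq_map => j; rewrite size_iota.
Qed.

Lemma size_forms : size forms = (1 + k * size S + sumn (iota 0 k) * size P)%N.
Proof.
by rewrite /= size_map size_cat !size_allpairs size_iota size_index_pairs -addSn.
Qed.

End NormalForms.

Lemma sumn_iota0 k : (2 * sumn (iota 0 k) = k * k.-1)%N.
Proof.
elim: k => // k IH; rewrite -[in iota 0 k.+1]addn1 iotaD sumn_cat mulnDr IH /= addn0 add0n.
by case: k {IH} => // k /=; nia.
Qed.

Section Constants.
Variables (R : realFieldType) (T : root_type) (l m k : nat).
Hypothesis kl : (k <= l)%N.

Definition slopes : seq R := if T is TypeA then [:: -1] else [:: 1; -1].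

Definition shifts : seq R := [seq n%:R - m%:R | n <- iota 0 (2 * m).+1].

Definition slope_shifts : seq (R * R) := [seq (s, c) | s <- slopes, c <- shifts].

(* The [g] such that [x i = g * z] is a hyperplane of the restriction. *)
Definition constants : seq R :=
  match T with
  | TypeA => [seq n%:R - m%:R | n <- iota 0 ((l - k + 2) * m).+1]
  | TypeB => [seq n%:R - ((l - k).+1 * m)%:R | n <- iota 0 (2 * ((l - k).+1 * m)).+1]
  | TypeC => [seq n%:R - (m%:R / 2 + ((l - k) * m)%:R) | n <- iota 0 (m + 2 * ((l - k) * m)).+1]
             ++ [seq n%:R - (m%:R - 1) / 2 | n <- iota 0 m]
  end.

Lemma uniq_shifted (c : R) n : uniq [seq i%:R - c | i <- iota 0 n].
Proof.
rewrite map_inj_uniq ?iota_uniq // => i j /addIr/eqP.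
by rewrite eqr_nat => /eqP.
Qed.

Lemma uniq_slope_shifts : uniq slope_shifts.
Proof.
apply: allpairs_uniq; last by move=> [? ?] [? ?] _ _ /= [-> ->].
  rewrite /slopes; case: T => //=; rewrite inE andbT; apply/eqP; lra.
exact: uniq_shifted.
Qed.

Lemma slope_shifts_neq0 p : p \in slope_shifts -> p.1 != 0.
Proof.
case/allpairsP => -[s c] /= [+ _ ->] /=; rewrite /slopes.
by case: T; rewrite !inE; do ?[case/orP]; move/eqP ->; rewrite ?oppr_eq0 oner_eq0.
Qed.

Lemma uniq_constants : uniq constants.
Proof.
rewrite /constants; case: T; try exact: uniq_shifted.
rewrite cat_uniq !uniq_shifted andbT andTb; apply/hasPn => _ /mapP[n _ ->].
apply/mapP => -[n' _ e].
(* The two families of type C differ in the parity of $2g$. *)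
have : (2 * n + 1 + 2 * ((l - k) * m))%:R = (2 * n')%:R :> R.
  by rewrite !natrD !natrM; move: e; rewrite !natrM; lra.
by move/eqP; rewrite eqr_nat => /eqP; lia.
Qed.

Lemma size_slope_shifts :
  size slope_shifts = ((if T is TypeA then 1 else 2) * (2 * m).+1)%N.
Proof. by rewrite size_allpairs size_map size_iota /slopes; case: T. Qed.

Lemma size_constants :
  size constants = (if T is TypeA then ((l - k + 2) * m).+1 else (2 * ((l - k).+1 * m)).+1)%N.
Proof.
rewrite /constants; case: T; rewrite ?size_cat !size_map !size_iota //.
lia.
Qed.

(** The degree condition of Saito's criterion on the flat with [k] free coordinates. The left side
    counts $z=0$, the constants for each free coordinate, and the sums and differences of two free
    coordinates. *)
Lemma size_forms_exponents :
  size (forms k constants slope_shifts) =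
  sumn (take k.+1 (1%N :: [seq exponent T l m r | r <- iota 0 l])).
Proof.
rewrite size_forms size_constants size_slope_shifts /= -map_take take_iota (minn_idPl kl).
have -> : sumn [seq exponent T l m r | r <- iota 0 k] =
  (if T is TypeA then k * (m * l.+1).+1 + sumn (iota 0 k)
   else k * (2 * (m * l)).+1 + 2 * sumn (iota 0 k))%N.
  rewrite /exponent; elim: (k) => [|k' IH]; first by case: T.
  rewrite -[in iota 0 k'.+1]addn1 iotaD map_cat !sumn_cat IH /= !add0n; case: T; lia.
have := sumn_iota0 k; set t := sumn _.
have [d ->] : exists d, l = (k + d)%N by exists (l - k)%N; lia.
rewrite addKn; case: T; case: (k) => [|k'] /=; nia.
Qed.

End Constants.

(** * The cone over the Catalan arrangement *)

Lemma memv_bigcap (K : fieldType) (V : vectType K) (I : Type) (r : seq I) (P : pred I)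
    (F : I -> {vspace V}) (v : V) :
  (v \in \bigcap_(i <- r | P i) F i)%VS = all (fun i => P i ==> (v \in F i)) r.
Proof.
elim: r => [|i r IH]; first by rewrite big_nil memvf.
by rewrite big_cons /=; case: (P i); rewrite ?memv_cap IH.
Qed.

(** The remainder may equal [m], so that the extreme value $(d+1)m$ still has quotient [d]. *)
Lemma quotient_bounded m d N : (0 < m)%N -> (N <= d.+1 * m)%N ->
  exists q r, [/\ (q <= d)%N, (r <= m)%N & N = (q * m + r)%N].
Proof.
move=> m0; elim: d N => [|d IH] N hN; first by exists 0%N, N; split=> //; lia.
have [Nm|Nm] := leqP N m; first by exists 0%N, N; split=> //; lia.
have [|q [r [qd rm e]]] := IH (N - m)%N; first by lia.
by exists q.+1, r; split=> //; lia.
Qed.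

Section Cone.
Variables (R : realType) (l : nat) (T : root_type) (m : nat).
Variables (Phi Phip Delta : {fset 'rV[R]_l}).
Hypotheses (l0 : (0 < l)%N) (m0 : (0 < m)%N).
Hypotheses (hPhi : root_system Phi) (hPhip : positive_system Phi Phip).
Hypothesis hDelta : simple_system Phip Delta.
Variables (a : 'I_l -> 'rV[R]_l) (v : 'I_l -> 'cV[R]_l).
Hypotheses (a_inj : injective a) (Delta_a : Delta = [fset a i | i in 'I_l]%fset).
Hypothesis corootP : forall j, is_coroot Phi (a j) (v j).
Hypothesis cartanP : forall i j, pairing (a i) (v j) = (cartan T i j)%:~R.
Local Notation nT := (root_scale R T).
Local Notation x := (xform T a).
Local Notation V' := 'cV[R]_(l + 1).
Implicit Types (u w : V').

Definition form_at (b : 'rV[R]_l) u : R := (row_mx b (0 : 'M_1) *m u) 0 0.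
Definition zcoord u : R := (row_mx (0 : 'rV[R]_l) (1%:M : 'M_1) *m u) 0 0.
Definition xcoord u (i : nat) : R := form_at (x i) u.

Lemma form_atD b c u : form_at (b + c) u = form_at b u + form_at c u.
Proof. by rewrite /form_at -[X in row_mx _ X]addr0 -add_row_mx mulmxDl mxE. Qed.

Lemma form_atZ k b u : form_at (k *: b) u = k * form_at b u.
Proof. by rewrite /form_at -[X in row_mx _ X](scaler0 _ k) -scale_row_mx -scalemxAl mxE. Qed.

Lemma form_atB b c u : form_at (b - c) u = form_at b u - form_at c u.
Proof. by rewrite -scaleN1r form_atD form_atZ mulN1r. Qed.

Lemma xcoord_ge u i : (l <= i)%N -> xcoord u i = 0.
Proof.
by move=> li; rewrite /xcoord xform_ge // /form_at row_mx0 mul0mx mxE.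
Qed.

Lemma form_row b c u :
  (row_mx b (- c)%:M *m u) 0 0 = form_at b u - c * zcoord u.
Proof.
rewrite /form_at /zcoord -[u]vsubmxK !mul_row_col !mul0mx addr0 add0r mul1mx.
by rewrite mul_scalar_mx mxE [X in _ + X]mxE mulNr.
Qed.

Lemma mem_cH b c u : (u \in cH b c) = (form_at b u == c%:~R * zcoord u).
Proof. by rewrite memv_ker_form form_row subr_eq0. Qed.

Lemma mem_ker_z u : (u \in ker_z R l) = (zcoord u == 0).
Proof. by rewrite memv_ker_form. Qed.

Lemma cCatP H : reflect (H = ker_z R l \/
    exists b c, [/\ b \in Phip, (`|c : int| <= m)%N & H = cH b c]) (H \in cCat m Phip).
Proof.
rewrite /cCat in_fset1U; apply: (iffP orP) => -[/eqP ->|]; [by left| |by left|].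
  case/imfset2P => b /= bP [k /=].
  rewrite -[_ :: _]/(iota 0 (2 * m).+1) mem_iota => /andP[_ km] ->.
  by right; exists b, (k%:Z - m%:Z); split=> //; lia.
move=> [b [c [bP cm ->]]]; right; apply/imfset2P; exists b => //=.
exists (absz (c + m%:Z)%R); last by congr (cH _ _); lia.
by rewrite /= -[_ :: _]/(iota 0 (2 * m).+1) mem_iota; lia.
Qed.

Definition make_point (g : nat -> R) (c : R) : V' :=
  col_mx (invmx (xform_mx T a) *m \col_(i < l) g i) c%:M.

Lemma xunit : xform_mx T a \in unitmx.
Proof. exact: (xform_mx_unit T hDelta Delta_a). Qed.

Lemma zcoord_make g c : zcoord (make_point g c) = c.
Proof. by rewrite /zcoord mul_row_col mul0mx add0r mul1mx mxE eqxx. Qed.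

Lemma xcoord_make g c i : (i < l)%N -> xcoord (make_point g c) i = g i.
Proof.
move=> il; rewrite /xcoord /form_at mul_row_col mul0mx addr0.
rewrite -[x i](rowK (fun k : 'I_l => x k) (Ordinal il)) -row_mul mulmxA.
by rewrite mulmxV ?xunit // mul1mx !mxE.
Qed.

Lemma xcoordE u (i : 'I_l) : xcoord u i = (xform_mx T a *m usubmx u) i 0.
Proof.
rewrite /xcoord /form_at -{1}[u]vsubmxK mul_row_col mul0mx addr0.
by rewrite -{1}[x i](rowK (fun k : 'I_l => x k) i) -row_mul [LHS]mxE.
Qed.

Lemma zcoordE u : zcoord u = dsubmx u 0 0.
Proof. by rewrite /zcoord -{1}[u]vsubmxK mul_row_col mul0mx add0r mul1mx. Qed.

Lemma coords_eq u w : (forall i, (i < l)%N -> xcoord u i = xcoord w i) ->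
  zcoord u = zcoord w -> u = w.
Proof.
move=> hx hz; rewrite -[u]vsubmxK -[w]vsubmxK; congr col_mx; last first.
  by apply/matrixP => i j; rewrite !ord1 -!zcoordE.
rewrite -[LHS](mulKmx xunit) -[RHS](mulKmx xunit); congr (_ *m _).
by apply/matrixP => i j; rewrite ord1 -!xcoordE hx.
Qed.

Definition catalan_field (r : nat) u : V' :=
  if r is r'.+1 then
    make_point (fun i => component T l m (xcoord u) (zcoord u) 'X^r' (xcoord u i)) 0
  else u.

Definition exponents : seq nat := 1%N :: [seq exponent T l m r | r <- iota 0 l].

Lemma homog_catalan_field r i : (r < l + 1)%N ->
  homog_fun (nth 0%N exponents r) (fun u => catalan_field r u i 0).
Proof.
case: r => [_|r]; first exact: homog_fun_coord.
move=> rl1; have rl : (r < l)%N by rewrite addn1 in rl1.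
rewrite /= (nth_map 0%N) ?size_iota // nth_iota // add0n.
apply: (@homog_fun_ext _ _ _ (fun u => match split i with
  | inl i' => \sum_j invmx (xform_mx T a) i' j *
       component T l m (xcoord u) (zcoord u) 'X^r (xcoord u j)
  | inr _ => 0 end)).
  move=> u; rewrite /make_point mxE; case: split => j; last by rewrite !mxE ord1 mul0rn.
  by rewrite mxE; apply: eq_bigr => k _; rewrite mxE.
case: split => j; last exact: homog_fun0.
apply: homog_fun_sum => k _; apply: homog_funZ.
apply: (@homog_component R T l m _ (fun i u => xcoord u i) zcoord _ _ (fun u => xcoord u k) r).
- by move=> i'; apply: homog_fun_form.
- exact: homog_fun_form.
- exact: homog_fun_form.
Qed.

(** Apart from the Euler field, the fields have last component $0$, so tangency to [cH b c] means
    that [b] vanishes on the value of the field. Each shape of a signed root is one of the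
    statements on components; an overall minus sign replaces [c] by [- c]. *)
Lemma catalan_field_tangent H r u : H \in cCat m Phip -> u \in H ->
  catalan_field r u \in H.
Proof.
case: r => // r /cCatP[->|[b [c [bP cm ->]]]].
  by rewrite !mem_ker_z /= zcoord_make.
rewrite !mem_cH /= zcoord_make mulr0 => /eqP hu; apply/eqP.
set g := fun i => _; set w := make_point g 0.
have gE i : (i < l)%N -> form_at (x i) w = g i by exact: xcoord_make.
have g0 : form_at (x l) w = 0 by exact: xcoord_ge.
have := Phip_signed_root hPhi hPhip hDelta a_inj Delta_a corootP cartanP l0 bP.
have cm' : (`|- c| <= m)%N by rewrite abszN.
rewrite /signed_root; have [TA|TA] := root_type_dec T TypeA.
  have genA (P P' : Prop) : (if T is TypeA then P else P') -> P by rewrite TA.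
  move/genA => -[i [j [il jl ij bE]]]; rewrite bE !form_atB in hu *.
  have [il'|il'] := ltnP i l; have [jl'|jl'] := ltnP j l.
  - rewrite !gE // /g; apply/eqP; rewrite subr_eq0; apply/eqP.
    exact: (component_diff T (x := xcoord u) _ il' jl' ij hu cm).
  - have jE : j = l by lia.
    rewrite jE -[form_at (x l) u]/(xcoord u l) xcoord_ge // subr0 in hu.
    rewrite jE g0 subr0 gE //; apply: (component_root (x := xcoord u) _ il' _ cm).
    by rewrite TA mul1r.
  - have iE : i = l by lia.
    rewrite iE -[form_at (x l) u]/(xcoord u l) xcoord_ge // sub0r in hu.
    rewrite iE g0 sub0r gE //; apply/eqP; rewrite oppr_eq0; apply/eqP.
    apply: (component_root (x := xcoord u) _ jl' _ cm').
    by rewrite TA mul1r mulrNz mulNr -hu opprK.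
  - by case/eqP: ij; lia.
have gen' (P : Prop) (P' : Prop) : (if T is TypeA then P else P') -> P' by move: TA; case: (T).
move/gen' => [[i [j [s [t [il jl ij bE]]]]]|[i [s [il bE]]]]; last first.
  rewrite bE !form_atZ in hu *; rewrite gE // /g.
  suff -> : component T l m (xcoord u) (zcoord u) 'X^r (xcoord u i) = 0 by rewrite !mulr0.
  case: s hu {bE} => /=; rewrite ?expr0 ?expr1 ?mul1r ?mulN1r => hu.
    by apply: (component_root (x := xcoord u) _ il _ cm'); rewrite mulrNz mulNr -hu opprK.
  by apply: (component_root (x := xcoord u) _ il _ cm); rewrite -hu.
rewrite bE !form_atD !form_atZ in hu *; rewrite !gE // /g.
move: hu; rewrite -!/(xcoord _ _) => hu {bE}.
case: s t hu => -[] /=; rewrite ?expr0 ?expr1 ?mul1r ?mulN1r => hu.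
- suff : component T l m (xcoord u) (zcoord u) 'X^r (xcoord u i) +
    component T l m (xcoord u) (zcoord u) 'X^r (xcoord u j) = 0.
    by rewrite -opprD => ->; rewrite oppr0.
  apply: (component_sum (x := xcoord u) _ TA il jl ij _ cm').
  by rewrite mulrNz mulNr -hu; ring.
- rewrite (_ : component T l m (xcoord u) (zcoord u) 'X^r (xcoord u i) =
    component T l m (xcoord u) (zcoord u) 'X^r (xcoord u j)) ?addNr //.
  apply: (component_diff T (x := xcoord u) _ il jl ij _ cm').
  by rewrite mulrNz mulNr -hu; ring.
- rewrite (_ : component T l m (xcoord u) (zcoord u) 'X^r (xcoord u i) =
    component T l m (xcoord u) (zcoord u) 'X^r (xcoord u j)) ?subrr //.
  exact: (component_diff T (x := xcoord u) _ il jl ij hu cm).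
- exact: (component_sum (x := xcoord u) _ TA il jl ij hu cm).
Qed.

Lemma form_at_lin b c u w : form_at b (c *: u + w) = c * form_at b u + form_at b w.
Proof. by rewrite /form_at mulmxDr -scalemxAr mxE [X in X + _]mxE. Qed.

Lemma zcoord_lin c u w : zcoord (c *: u + w) = c * zcoord u + zcoord w.
Proof. by rewrite /zcoord mulmxDr -scalemxAr mxE [X in X + _]mxE. Qed.

(** The solution, in units of $z$, of $x_i-x_{i+1}=mz$ together with [nT] times the last coordinate
    being $mz$. *)
Definition base_coord (i : nat) : R :=
  (l - i)%:R * m%:R - (if T is TypeC then m%:R / 2 else 0).

Lemma base_coordS i : (i.+1 < l)%N -> base_coord i = m%:R + base_coord i.+1.
Proof.
move=> il; rewrite /base_coord (_ : (l - i = (l - i.+1).+1)%N); last by lia.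
by rewrite -natr1; ring.
Qed.

Lemma base_coord_last i : i.+1 = l -> nT * base_coord i = m%:R.
Proof.
move=> il; rewrite /base_coord (_ : (l - i = 1)%N); last by lia.
rewrite mul1r /root_scale.
by case: (T); rewrite ?subr0 ?mul1r //; field.
Qed.

(** [k] is the number of coordinates left free; with $z$ the dimension is [k.+1]. *)
Definition flat_of (k : nat) : {vspace V'} :=
  (\bigcap_(i < l | (k <= i)%N) cH (a i) m%:Z)%VS.

Lemma mem_flatP k u : (u \in flat_of k) <->
  forall i : 'I_l, (k <= i)%N -> form_at (a i) u = m%:R * zcoord u.
Proof.
rewrite /flat_of memv_bigcap; split=> [/allP h i ki|h].
  by have /implyP/(_ ki) := h i (mem_index_enum i); rewrite mem_cH => /eqP.
by apply/allP => i _; apply/implyP => ki; rewrite mem_cH h.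
Qed.

Lemma mem_flat k u : (u \in flat_of k) <->
  forall i, (k <= i < l)%N -> xcoord u i = base_coord i * zcoord u.
Proof.
split=> [/mem_flatP h i /andP[ki il]|h]; last first.
  apply/mem_flatP => i ki; have [il|il] := ltnP i.+1 l.
    rewrite (simple_diff T a il) form_atB -!/(xcoord _ _) !h ?ki ?(leqW ki) ?ltn_ord //.
    by rewrite (base_coordS il); ring.
  have {}il : i.+1 = l by have := ltn_ord i; lia.
  rewrite (simple_last T a il) form_atZ -!/(xcoord _ _) h ?ki ?ltn_ord //.
  by rewrite mulrA base_coord_last.
have [d hd] := ubnP (l - i); elim: d i ki il hd => // d IH i ki il hd.
have := h (Ordinal il) ki; have [il'|il'] := ltnP i.+1 l.
  rewrite (simple_diff T a (i := Ordinal il) il') form_atB -!/(xcoord _ _) /=.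
  rewrite (IH i.+1) ?(leqW ki) //; last by lia.
  by rewrite (base_coordS il') => /eqP; rewrite subr_eq => /eqP ->; ring.
have lE : (Ordinal il).+1 = l by rewrite /=; lia.
rewrite (simple_last T a lE) form_atZ -!/(xcoord _ _) -(base_coord_last lE) -mulrA.
by move/(mulfI _); apply; rewrite gt_eqF // root_scale_gt0.
Qed.

Lemma flat_of_full k : (l <= k)%N -> flat_of k = fullv.
Proof.
move=> lk; apply/vspaceP => u; rewrite memvf; apply/mem_flat => i; lia.
Qed.

Lemma flat_ofS k k' : (k <= k')%N -> (flat_of k <= flat_of k')%VS.
Proof.
move=> kk'; apply/subvP => u /mem_flat h; apply/mem_flat => i /andP[ki il].
by apply: h; rewrite il (leq_trans kk').
Qed.

Lemma catalan_field_flat k r u : u \in flat_of k -> catalan_field r u \in flat_of k.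
Proof.
rewrite /flat_of !memv_bigcap => /allP h; apply/allP => i hi; apply/implyP => ki.
apply: catalan_field_tangent; last by have /implyP := h i hi; apply.
apply/cCatP; right; exists (a i), m%:Z; split=> //.
exact: (simple_Phip hDelta Delta_a).
Qed.

(** * Coordinates on the flats and independence there *)

Section FlatCoordinates.
Variable k : nat.
Hypothesis kl : (k <= l)%N.

Definition make_flat (y : 'cV[R]_k.+1) : V' :=
  make_point (fun i => if (i < k)%N then y (inord i) 0 else base_coord i * y ord_max 0)
    (y ord_max 0).

Lemma make_flat_is_linear : linear make_flat.
Proof.
move=> c y y'; apply: coords_eq => [i il|].
  rewrite /xcoord form_at_lin -!/(xcoord _ _) !xcoord_make //.
  by case: ifP => _; rewrite !mxE //; ring.
by rewrite zcoord_lin !zcoord_make !mxE.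
Qed.

HB.instance Definition _ :=
  GRing.isLinear.Build R 'cV[R]_k.+1 V' _ make_flat make_flat_is_linear.

Lemma make_flat_mem y : make_flat y \in flat_of k.
Proof.
apply/mem_flat => i /andP[ki il]; rewrite xcoord_make // zcoord_make.
by rewrite ltnNge ki.
Qed.

Definition flat_coords (u : V') : 'cV[R]_k.+1 :=
  \col_j if (j < k)%N then xcoord u j else zcoord u.

Lemma flat_coordsK u : u \in flat_of k -> make_flat (flat_coords u) = u.
Proof.
move=> /mem_flat h; apply: coords_eq => [i il|].
  rewrite xcoord_make // !mxE /= ltnn; case: ltnP => ik; last by rewrite -h ?ik.
  by rewrite inordK ?ik // ltnS ltnW.
by rewrite zcoord_make mxE /= ltnn.
Qed.

Lemma make_flatK y : flat_coords (make_flat y) = y.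
Proof.
apply/matrixP => i j; rewrite ord1 mxE; case: ltnP => ik.
  by rewrite xcoord_make ?ik ?(leq_trans ik) // inord_val.
rewrite zcoord_make; congr (y _ _); apply/val_inj => /=.
by have := ltn_ord i; lia.
Qed.

Lemma dim_flat : \dim (flat_of k) = k.+1.
Proof.
have <- : limg (linfun make_flat) = flat_of k.
  apply/vspaceP => u; apply/idP/idP => [/memv_imgP[y _ ->]|uX].
    by rewrite lfunE make_flat_mem.
  by rewrite -(flat_coordsK uX) -(lfunE make_flat) memv_img ?memvf.
rewrite limg_dim_eq ?dimvf /dim /= ?muln1 //.
apply/eqP; rewrite -subv0; apply/subvP => y; rewrite memv_cap memv_ker lfunE memv0.
by case/andP=> _ /eqP /= h; rewrite -(make_flatK y) h -(make_flatK 0) linear0.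
Qed.

Definition flat_form (y : 'rV[R]_k.+1) : 'rV[R]_(l + 1) :=
  \sum_(i < k) y 0 (inord i) *: row_mx (x i) 0 + y 0 ord_max *: row_mx 0 1%:M.

Lemma flat_formE y u : (flat_form y *m u) 0 0 =
  \sum_(i < k) y 0 (inord i) * xcoord u i + y 0 ord_max * zcoord u.
Proof.
rewrite mulmxDl mulmx_suml mxE summxE -scalemxAl [X in _ + X]mxE; congr (_ + _).
by apply: eq_bigr => i _; rewrite -scalemxAl mxE.
Qed.

Lemma flat_form_make y y' : (flat_form y *m make_flat y') 0 0 = (y *m y') 0 0.
Proof.
rewrite flat_formE zcoord_make mxE big_ord_recr /=; congr (_ + _).
apply: eq_bigr => i _; have ik := ltn_ord i.
rewrite xcoord_make ?(leq_trans ik) //=; congr (y 0 _ * y' _ 0); apply/val_inj.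
  by rewrite /= inordK // ltnS ltnW.
by rewrite /= inordK // ltnS ltnW.
Qed.

(** The largest fixed coordinate at $z=1$, or $0$ on the whole space. *)
Definition base_start : R := if (k < l)%N then base_coord k else 0.

Definition base_point : V' :=
  make_point (fun i => if (i < k)%N then base_start + (k - i)%:R * m.+1%:R
                       else base_coord i) 1.

Lemma base_point_flat : base_point \in flat_of k.
Proof.
apply/mem_flat => i /andP[ki il]; rewrite xcoord_make // zcoord_make mulr1.
by rewrite ltnNge ki.
Qed.

Lemma base_coord_ge0 i : (i < l)%N -> 0 <= base_coord i.
Proof.
move=> il; rewrite /base_coord; have h : 1 <= (l - i)%:R :> R by rewrite ler1n subn_gt0.
have hm : 0 <= m%:R :> R by [].
by case: (T); nra.
Qed.

Lemma base_coord_le i j : (i <= j)%N -> base_coord j <= base_coord i.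
Proof.
move=> ij; rewrite /base_coord lerD2r ler_wpM2r // ler_nat; lia.
Qed.

(** [d] is general because the lemma is applied with [l + 1] and with the dimension of the flat. *)
Lemma catalan_field_independent d (c : 'I_d -> R) : d = k.+1 ->
  \sum_(r < d) c r *: catalan_field r base_point = 0 -> forall r, c r = 0.
Proof.
move=> dk; subst d; rewrite big_ord_recl /= => h.
(* Only the Euler field has a nonzero last coordinate. *)
have z0 : c ord0 = 0.
  move: (congr1 zcoord h); rewrite zcoord_lin zcoord_make mulr1.
  have zs (I : Type) (r : seq I) (F : I -> V') :
      zcoord (\sum_(i <- r) F i) = \sum_(i <- r) zcoord (F i).
    by rewrite /zcoord mulmx_sumr summxE.
  rewrite zs big1 ?addr0 => [->|i _]; first by rewrite /zcoord mulmx0 mxE.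
  by rewrite -[_ *: _]addr0 zcoord_lin zcoord_make mulr0 add0r /zcoord mulmx0 mxE.
rewrite z0 scale0r add0r in h.
have [lam hlam] : exists lam : nat -> R, forall r : 'I_k, lam r = c (lift ord0 r).
  exists (fun r => if insub r is Some r' then c (lift ord0 r') else 0) => r.
  by rewrite valK.
have xc i : (i < l)%N -> \sum_(r < k) lam r *
    component T l m (xcoord base_point) 1 'X^r (xcoord base_point i) = 0.
  move=> il; have xs (I : Type) (r : seq I) (F : I -> V') :
      xcoord (\sum_(i' <- r) F i') i = \sum_(i' <- r) xcoord (F i') i.
    by rewrite /xcoord /form_at mulmx_sumr summxE.
  have x0 : xcoord 0 i = 0 by rewrite /xcoord /form_at mulmx0 mxE.
  have e := congr1 (fun u => xcoord u i) h; rewrite /= xs x0 in e.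
  rewrite -[RHS]e; apply: eq_bigr => r _.
  rewrite hlam -[_ *: _]addr0 /xcoord form_at_lin -!/(xcoord _ _) x0 addr0.
  by rewrite xcoord_make // zcoord_make.
have bE i : (i < k)%N -> xcoord base_point i = base_start + (k - i)%:R * m.+1%:R.
  by move=> ik; rewrite xcoord_make ?(leq_trans ik).
have bE' i : (k <= i < l)%N -> xcoord base_point i = base_coord i.
  by move=> /andP[ki il]; rewrite xcoord_make // ltnNge ki.
have lam0 : forall r, (r < k)%N -> lam r = 0.
  apply: (component_independent (T := T) (l := l) (m := m) (x := xcoord base_point)
    (b := base_start)) => //.
  - by rewrite /base_start; case: ltnP => // kl'; apply: base_coord_ge0.
  - move=> i kil; rewrite bE' //; case/andP: kil => ki il; rewrite base_coord_ge0 //.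
    by rewrite /base_start (leq_ltn_trans ki il) base_coord_le.
  - rewrite /base_start; case: (ltnP k l) => kl'; last by right; split=> //; lia.
    by left; exists k; rewrite ?leqnn // bE' ?leqnn.
  (* The field stays in the flat and its last coordinate is $0$; its coordinate of index [k], which
     is [base_coord k] times the last one, vanishes too. *)
  - move=> r rk; rewrite /base_start; case: (ltnP k l) => kl'; last first.
      by rewrite /component /partner; case: (T); rewrite ?oppr0 subrr.
    have /mem_flat/(_ k) := catalan_field_flat r.+1 base_point_flat.
    rewrite leqnn kl' => /(_ isT); rewrite /= xcoord_make // !zcoord_make mulr0.
    by rewrite bE' ?leqnn.
  - by move=> i ik; apply: xc; apply: leq_trans kl.
move=> r; case: (unliftP ord0 r) => [r' ->|-> //].
by rewrite -hlam lam0.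
Qed.

End FlatCoordinates.

(** * Hyperplanes of the restrictions *)

Section Covering.
Variable k : nat.
Hypothesis kl : (k <= l)%N.

Definition covered (i : nat) (g : R) : Prop :=
  exists2 H, H \in cCat m Phip & forall u, u \in flat_of k ->
    (u \in H) = (xcoord u i == g * zcoord u).

Lemma covered_scaled i g (c : int) : (i < l)%N -> nT * g = c%:~R -> (`|c| <= m)%N ->
  covered i g.
Proof.
move=> il e cm; exists (cH (nT *: x i) c).
  apply/cCatP; right; exists (nT *: x i), c; split=> //.
  by have [_ + _] := Phip_list hPhip hDelta Delta_a corootP cartanP; apply.
move=> u _; rewrite mem_cH form_atZ -/(xcoord _ _) -e -mulrA.
by rewrite (inj_eq (mulfI _)) // gt_eqF // root_scale_gt0.
Qed.

Lemma covered_diff i j g (c : int) : (i < k)%N -> (k <= j < l)%N ->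
  g = base_coord j + c%:~R -> (`|c| <= m)%N -> covered i g.
Proof.
move=> ik kjl -> cm; case/andP: (kjl) => kj jl; exists (cH (x i - x j) c).
  apply/cCatP; right; exists (x i - x j), c; split=> //.
  have [+ _ _] := Phip_list hPhip hDelta Delta_a corootP cartanP; apply=> //.
  exact: leq_trans kj.
move=> u /mem_flat h; rewrite mem_cH form_atB -!/(xcoord _ _) (h j kjl).
by rewrite subr_eq [X in _ == X]addrC -mulrDl.
Qed.

Lemma covered_sum i j g (c : int) : T <> TypeA -> (i < k)%N -> (k <= j < l)%N ->
  g = - (base_coord j + c%:~R) -> (`|c| <= m)%N -> covered i g.
Proof.
move=> TA ik kjl -> cm; case/andP: (kjl) => kj jl; exists (cH (x i + x j) (- c)).
  apply/cCatP; right; exists (x i + x j), (- c); split; rewrite ?abszN //.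
  have [_ _ +] := Phip_list hPhip hDelta Delta_a corootP cartanP; apply=> //.
  exact: leq_trans kj.
move=> u /mem_flat h; rewrite mem_cH form_atD -!/(xcoord _ _) (h j kjl).
rewrite -subr_eq0 -[in RHS]subr_eq0; congr (_ == 0).
by rewrite mulrNz; ring.
Qed.

Lemma base_coord_sub q : (0 < q <= l - k)%N -> (k <= l - q < l)%N /\
  base_coord (l - q) = q%:R * m%:R - (if T is TypeC then m%:R / 2 else 0).
Proof.
move=> h; split; first by lia.
by rewrite /base_coord subKn //; lia.
Qed.

(** Write $N=qm+r$ with $r\le m$. For $q=0$ the root $x_i$ at level $r$ is used, otherwise
    $x_i-x_{l-q}$ at level $r$, with $x_{l-q}$ fixed at $qmz$. *)
Lemma covered_pos i N : T <> TypeC -> (i < k)%N -> (N <= (l - k).+1 * m)%N ->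
  covered i N%:R.
Proof.
move=> TC ik /(quotient_bounded m0)[q [r [qd rm ->]]].
have il : (i < l)%N by apply: leq_trans kl.
have [q0|q0] := posnP q.
  apply: (@covered_scaled _ _ r%:Z) => //; rewrite q0 mul0n add0n.
  by rewrite /root_scale; move: TC; case: (T); rewrite // mul1r.
have [|jl jE] := @base_coord_sub q; first by rewrite q0.
apply: (@covered_diff _ (l - q)%N _ r%:Z) => //; rewrite jE natrD natrM.
by congr (_ + _); move: TC; case: (T); rewrite // subr0.
Qed.

Lemma covered_neg i N : T = TypeB -> (i < k)%N -> (N <= (l - k).+1 * m)%N ->
  covered i (- N%:R).
Proof.
move=> TB ik /(quotient_bounded m0)[q [r [qd rm ->]]].
have il : (i < l)%N by apply: leq_trans kl.
have [q0|q0] := posnP q.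
  apply: (@covered_scaled _ _ (- r%:Z)); rewrite ?abszN // q0 mul0n add0n.
  by rewrite /root_scale TB mul1r mulrNz.
have [|jl jE] := @base_coord_sub q; first by rewrite q0.
apply: (@covered_sum _ (l - q)%N _ r%:Z); rewrite ?TB // jE natrD natrM.
by rewrite TB subr0.
Qed.

Lemma covered_half i N : T = TypeC -> (i < k)%N -> (0 < N <= (l - k) * m)%N ->
  covered i (m%:R / 2 + N%:R) /\ covered i (- (m%:R / 2 + N%:R)).
Proof.
move=> TC ik /andP[N0 hN].
have d0 : (0 < l - k)%N by case: (l - k)%N hN => //; rewrite mul0n; lia.
have := hN; rewrite -{1}(prednK d0) => /(quotient_bounded m0)[q [r [qd rm NE]]].
have [|jl jE] := @base_coord_sub q.+1; first by lia.
have e : m%:R / 2 + N%:R = base_coord (l - q.+1) + r%:Z%:~R.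
  by rewrite jE TC NE natrD natrM -natr1 -pmulrn; field.
split; first by apply: (@covered_diff _ (l - q.+1)%N _ r%:Z).
by apply: (@covered_sum _ (l - q.+1)%N _ r%:Z); rewrite ?TC ?e.
Qed.

(** The fixed coordinates are $qmz$ with $1\le q\le l-k$, lowered by $mz/2$ in type C. The windows
    of radius $m$ around them, and in types B and C around their negatives, join those of the roots
    [nT *: x i] without gaps. In type C the roots $2x_i$ move in half steps and give a second class
    of values modulo $1$. *)
Lemma covered_constants i g : (i < k)%N -> g \in constants R T l m k -> covered i g.
Proof.
move=> ik; have il : (i < l)%N by apply: leq_trans kl.
rewrite /constants; have [TA|TA] := root_type_dec T TypeA.
  rewrite {1}TA => /mapP[n]; rewrite mem_iota /= add0n ltnS => hn ->.
  have [nm|nm] := leqP m n.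
    by rewrite -natrB //; apply: covered_pos => //; [rewrite TA|lia].
  apply: (@covered_scaled _ _ (n%:Z - m%:Z)); rewrite ?intrB //; last by lia.
  by rewrite /root_scale TA mul1r.
have [TB|TB] := root_type_dec T TypeB.
  rewrite {1}TB => /mapP[n]; rewrite mem_iota /= add0n ltnS => hn ->.
  have [nm|nm] := leqP ((l - k).+1 * m) n.
    by rewrite -natrB //; apply: covered_pos => //; [rewrite TB|lia].
  by rewrite -opprB -natrB 1?ltnW //; apply: covered_neg => //; lia.
have TC : T = TypeC by move: TA TB; case: (T).
rewrite {1}TC mem_cat => /orP[]/mapP[n]; rewrite mem_iota /= add0n => hn ->; last first.
  (* The level is $2g$ for $g=n-(m-1)/2$. *)
  apply: (@covered_scaled _ _ (2 * n%:Z - m%:Z + 1)) => //; last by lia.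
  by rewrite /root_scale TC intrD intrB intrM -!pmulrn; field.
(* Values above $m/2$ come from differences with fixed coordinates, those below $-m/2$ from sums,
   and those between from $2x_i$. *)
rewrite ltnS in hn; have [h1|h1] := ltnP ((l - k) * m + m) n.
  have [|h _] := @covered_half i (n - ((l - k) * m + m)) TC ik; first by lia.
  suff -> : n%:R - (m%:R / 2 + ((l - k) * m)%:R) =
      m%:R / 2 + (n - ((l - k) * m + m))%:R :> R by [].
  by rewrite natrB 1?ltnW // natrD; field.
have [h2|h2] := ltnP n ((l - k) * m).
  have [|_ h] := @covered_half i ((l - k) * m - n) TC ik; first by lia.
  suff -> : n%:R - (m%:R / 2 + ((l - k) * m)%:R) =
      - (m%:R / 2 + ((l - k) * m - n)%:R) :> R by [].
  by rewrite natrB 1?ltnW //; ring.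
apply: (@covered_scaled _ _ (2 * (n - (l - k) * m)%N%:Z - m%:Z)) => //; last by lia.
by rewrite /root_scale TC intrB intrM -!pmulrn natrB //; field.
Qed.

Lemma delta_sum i (f : nat -> R) : (i < k)%N -> \sum_(t < k) (t == i :> nat)%:R * f t = f i.
Proof.
move=> ik; rewrite (bigD1 (Ordinal ik)) //= eqxx mul1r big1 ?addr0 // => t.
by rewrite -val_eqE /= => /negPf ->; rewrite mul0r.
Qed.

Lemma flat_form_normal d u : normal_index k d ->
  (flat_form (normal_form k d) *m u) 0 0 =
  xcoord u d.1.1 + d.2.1 * xcoord u d.1.2 - d.2.2 * zcoord u.
Proof.
move=> nd; have dk := normal_index_lt nd; rewrite flat_formE.
have -> : normal_form k d 0 ord_max = - d.2.2.
  rewrite mxE /= eqxx mulr1 (gtn_eqF dk) add0r; move: nd; rewrite /normal_index.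
  by case: ifP => [/eqP -> _|_ /andP[_ h]]; rewrite ?mul0r ?(gtn_eqF h) ?mulr0 add0r.
rewrite mulNr; congr (_ - _).
rewrite (eq_bigr (fun t : 'I_k => (t == d.1.1 :> nat)%:R * xcoord u t +
    d.2.1 * ((t == d.1.2 :> nat)%:R * xcoord u t))); last first.
  move=> t _; rewrite normal_formE; last exact: ltnW.
  by rewrite (ltn_eqF (ltn_ord t)) mulr0 subr0 mulrDl mulrA.
rewrite big_split /= delta_sum // -mulr_sumr; congr (_ + _).
move: nd; rewrite /normal_index; case: ifP => [/eqP -> _|_ /andP[_ h]].
  by rewrite !mul0r.
by rewrite delta_sum.
Qed.

Definition flat_forms : seq 'rV[R]_(l + 1) :=
  [seq flat_form y | y <- forms k (constants R T l m k) (slope_shifts R T m)].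

Lemma size_flat_forms : size flat_forms = sumn (take k.+1 exponents).
Proof. by rewrite size_map size_forms_exponents. Qed.

Lemma flat_forms_sep i j : (i < j < size flat_forms)%N ->
  exists2 u, u \in (ker_form flat_forms`_j :&: flat_of k)%VS &
    u \notin ker_form flat_forms`_i.
Proof.
rewrite size_map => /andP[ij js]; have is_ := ltn_trans ij js.
set F := forms _ _ _ in js is_ *.
have uF : uniq F.
  by apply: uniq_forms; [apply: uniq_constants|apply: uniq_slope_shifts|apply: slope_shifts_neq0].
have [|||w wj wi] := @leading_one_sep _ _ F`_j F`_i.
- by apply: forms_leading (mem_nth _ js); apply: slope_shifts_neq0.
- by apply: forms_leading (mem_nth _ is_); apply: slope_shifts_neq0.
- by rewrite nth_uniq // gtn_eqF.
exists (make_flat w).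
  rewrite memv_cap make_flat_mem // andbT memv_ker_form (nth_map 0) //.
  by rewrite flat_form_make // wj.
by rewrite memv_ker_form (nth_map 0) // flat_form_make.
Qed.

Lemma flat_forms_neq0 b : b \in flat_forms -> ~~ (flat_of k <= ker_form b)%VS.
Proof.
case/mapP => y yF ->; have [i [yi _]] := forms_leading (slope_shifts_neq0 (m := m)) yF.
apply/negP => /subvP/(_ (make_flat (delta_mx i 0)) (make_flat_mem _)).
rewrite memv_ker_form flat_form_make // -colE mxE yi.
by rewrite oner_eq0.
Qed.

Lemma flat_forms_cover b : b \in flat_forms ->
  exists2 H, H \in cCat m Phip & (H :&: flat_of k = ker_form b :&: flat_of k)%VS.
Proof.
have ext (H : {vspace V'}) (y : 'rV[R]_k.+1) : (forall u, u \in flat_of k -> (u \in H) = ((flat_form y *m u) 0 0 == 0)) ->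
    (H :&: flat_of k = ker_form (flat_form y) :&: flat_of k)%VS.
  move=> h; apply/vspaceP => u; rewrite !memv_cap memv_ker_form.
  by case uX: (u \in flat_of k); rewrite ?andbF // h.
case/mapP => y; rewrite inE => /orP[/eqP -> ->|/mapP[d dI -> ->]].
  exists (ker_z R l); first by apply/cCatP; left.
  apply: ext => u _; rewrite mem_ker_z flat_formE mxE eqxx mul1r.
  rewrite big1 ?add0r // => i _; rewrite mxE inordK ?(ltn_eqF (ltn_ord i)) ?mul0r //.
  by rewrite ltnS ltnW.
have nd := allP (indices_normal k _ (@slope_shifts_neq0 R T m)) d dI.
suff [H HC hH] : exists2 H, H \in cCat m Phip & forall u, u \in flat_of k ->
    (u \in H) = (xcoord u d.1.1 + d.2.1 * xcoord u d.1.2 - d.2.2 * zcoord u == 0).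
  by exists H => //; apply: ext => u uX; rewrite hH // flat_form_normal.
move: dI; rewrite mem_cat => /orP[/allpairsP[[i g] /= [+ gS ->]]|].
  rewrite mem_iota /= add0n => ik; have [H HC hH] := covered_constants ik gS.
  by exists H => // u uX; rewrite hH // mul0r addr0 subr_eq0.
case/allpairsP => -[[i j] [s g]] /= [+ /allpairsP[[s' g'] /= [+ + [-> ->]]] ->] /=.
rewrite mem_index_pairs /= => /andP[ij jk] sS /mapP[n]; rewrite mem_iota add0n => /andP[_ nm] ->.
have jl : (j < l)%N by apply: leq_trans kl.
have [hd _ hs] := Phip_list hPhip hDelta Delta_a corootP cartanP.
have cm : (`|n%:Z - m%:Z| <= m)%N by lia.
have gE : n%:R - m%:R = (n%:Z - m%:Z)%:~R :> R by rewrite intrB.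
have [s1|[TA s1]] : s' = -1 \/ (T <> TypeA /\ s' = 1).
  move: sS; rewrite /slopes; case: (T); rewrite !inE; do ?[case/orP]; move/eqP; auto.
  by move=> ->; right.
  by move=> ->; right.
- exists (cH (x i - x j) (n%:Z - m%:Z)).
    by apply/cCatP; right; exists (x i - x j), (n%:Z - m%:Z); split=> //; apply: hd.
  move=> u _; rewrite mem_cH form_atB -!/(xcoord _ _) s1 mulN1r gE.
  by rewrite -[RHS](inj_eq (addIr ((n%:Z - m%:Z)%:~R * zcoord u))) subrK add0r.
- exists (cH (x i + x j) (n%:Z - m%:Z)).
    by apply/cCatP; right; exists (x i + x j), (n%:Z - m%:Z); split=> //; apply: hs.
  move=> u _; rewrite mem_cH form_atD -!/(xcoord _ _) s1 mul1r gE.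
  by rewrite -[RHS](inj_eq (addIr ((n%:Z - m%:Z)%:~R * zcoord u))) subrK add0r.
Qed.

End Covering.

Lemma size_exponents : size exponents = l.+1.
Proof. by rewrite /= size_map size_iota. Qed.

Lemma nth_exponents r : (r < l)%N -> nth 0%N exponents r.+1 = exponent T l m r.
Proof. by move=> rl; rewrite /= (nth_map 0%N) ?size_iota // nth_iota. Qed.

Lemma sorted_exponents : sorted leq exponents.
Proof.
apply/(sortedP 0%N) => -[|i]; rewrite size_exponents => il.
  by rewrite nth_exponents // /exponent; case: (T).
rewrite nth_exponents; last by rewrite ltnW.
rewrite nth_exponents // /exponent.
by case: (T); rewrite ltnS ?leq_mul2l leq_add2l leqnSn.
Qed.

(** The case [k = l], where the flat is the whole space, without passing to coordinates of the
    flat. *)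
Lemma cCat_free : free_with_exponents (cCat m Phip) exponents.
Proof.
apply: (@saito_criterion _ _ _ _ catalan_field (base_point l) (flat_forms l)).
- by rewrite size_exponents addn1.
- by move=> r i; apply: homog_catalan_field.
- by move=> H r u HC _; apply: catalan_field_tangent.
- by move=> c; apply: catalan_field_independent; rewrite ?addn1.
- by rewrite size_flat_forms // take_oversize // size_exponents.
- move=> b bF; have [H HC] := flat_forms_cover (leqnn l) bF.
  by rewrite flat_of_full // !capvf => <-.
- apply/negP => /(flat_forms_neq0 (leqnn l))/negP; apply.
  by apply/subvP => u _; rewrite memv_ker_form mul0mx mxE.
- move=> i j ij; have [u] := flat_forms_sep (leqnn l) ij.
  by rewrite memv_cap => /andP[uj _] ui; exists u.
Qed.

Lemma restriction_free k : (k <= l)%N ->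
  free_with_exponents (in_coordinates (flat_of k) (restriction (cCat m Phip) (flat_of k)))
    (take k.+1 exponents).
Proof.
move=> kl; have dk := dim_flat kl.
apply: (@free_restriction _ _ _ _ _ catalan_field (base_point k) (flat_forms k)).
- by rewrite size_takel ?dk // size_exponents.
- move=> r i; rewrite dk => rk; rewrite nth_take //.
  by apply: homog_catalan_field; rewrite addn1 (leq_trans rk).
- by move=> H r u HC _; apply: catalan_field_tangent.
- by move=> r u _; apply: catalan_field_flat.
- exact: base_point_flat.
- by move=> c; apply: catalan_field_independent.
- by rewrite size_flat_forms.
- by move=> b; apply: flat_forms_cover.
- by move=> b; apply: flat_forms_neq0.
- by move=> i j; apply: flat_forms_sep.
Qed.

Lemma flat_of_flat k : flat (cCat m Phip) (flat_of k).
Proof.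
exists [fset cH (a i) m%:Z | i in [seq i : 'I_l <- enum 'I_l | (k <= i)%N]]%fset.
  apply/fsubsetP => _ /imfsetP[i _ ->]; apply/cCatP; right.
  by exists (a i), m%:Z; split=> //; apply: (simple_Phip hDelta Delta_a).
apply/vspaceP => u; rewrite /flat_of !memv_bigcap; apply/allP/allP => h H.
  case/imfsetP => i /=; rewrite mem_filter => /andP[ki _] ->.
  by have /implyP := h i (mem_index_enum i); apply.
move=> _; apply/implyP => kH; apply: h; apply/imfsetP; exists H => //=.
by rewrite mem_filter kH mem_enum.
Qed.

Lemma flag_witness : flag_accuracy_witness (cCat m Phip) (fun d => flat_of d.-1).
Proof.
exists exponents; split.
- exact: sorted_exponents.
- exact: cCat_free.
- by rewrite flat_of_full // addn1.
- by move=> d _; apply: flat_ofS; apply: leq_pred.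
move=> d /andP[d0 dl]; have dl' : (d.-1 <= l)%N by lia.
split; first exact: flat_of_flat.
  by rewrite dim_flat // prednK.
by have := restriction_free dl'; rewrite prednK.
Qed.

Lemma flag_simple_root : simple_root_flag Delta (fun d => flat_of d.-1).
Proof.
(* The numbering is reversed: the flat of codimension [s] is [flat_of (l - s)], which fixes the last
   [s] simple roots. *)
have lt (i : 'I_(l.-1)) : (l.-1 - i < l)%N by lia.
exists (fun i => a (Ordinal (lt i))), (fun=> m%:Z); split=> [i|s /andP[s0 sl]].
  exact: (simple_Delta Delta_a).
apply/vspaceP => u; rewrite /flat_of !memv_bigcap; apply/allP/allP => h i _; apply/implyP => hi.
  by have /implyP := h (Ordinal (lt i)) (mem_index_enum _); apply; rewrite /=; lia.
have il : (l.-1 - i < l.-1)%N by have := ltn_ord i; lia.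
have /implyP := h (Ordinal il) (mem_index_enum _).
rewrite (_ : Ordinal (lt (Ordinal il)) = i); last first.
  by apply/val_inj; rewrite /=; have := ltn_ord i; lia.
by apply; rewrite /=; have := ltn_ord i; lia.
Qed.

End Cone.

Theorem theorem5p8 (R : realType) (l : nat) (hl : (0 < l)%N) (T : root_type)
    (Phi Phip Delta : {fset 'rV[R]_l}) (m : nat)
    (hPhi : root_system Phi)
    (hPhip : positive_system Phi Phip)
    (hDelta : simple_system Phip Delta)
    (hT : has_type T Phi Delta)
    (hm : (0 < m)%N) :
  exists Y : nat -> {vspace 'cV[R]_(l + 1)},
    flag_accuracy_witness (cCat m Phip) Y /\ simple_root_flag Delta Y.
Proof.
have [a [a_inj Delta_a ha]] := hT.
have ha' j : exists v, is_coroot Phi (a j) v /\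
    forall i, pairing (a i) v = (cartan T i j)%:~R.
  by have [v hv hc] := ha j; exists v.
have [v hv] := fin_all_exists ha'.
exists (fun d => flat_of m a d.-1); split.
  apply: (@flag_witness _ _ T _ _ _ _ hl hm hPhi hPhip hDelta a v) => //.
    by move=> j; have [] := hv j.
  by move=> i j; have [_] := hv j.
exact: flag_simple_root.
Qed.
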